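(* Let $(J^s)_{s\in(1/2,1)}$ satisfy Hypothesis (H1) below with constant $\delta>0$. For $\varepsilon\in(0,1]$ and $s\in(1/2,1)$ let $F^s_\varepsilon$ be the probability equilibrium of $\partial_tu=\varepsilon^{-2s}(J^s_\varepsilon*u-u)+\mathrm{div}(xu)$ and let $F^s$ be the equilibrium of $\partial_tv=-(-\Delta)^sv+\mathrm{div}(xv)$, i.e. $\widehat{F^s}(\xi)=e^{-|\xi|^{2s}/(2s)}$. Let $0\le k<m<1$ and $\theta=\frac{m-k}{m+d/2}$. Then there exists a constant $C$ independent of $s$ (and of $\varepsilon$) such that $$\|F^s_\varepsilon-F^s\|_{L^1_k}\le C\varepsilon^{\theta\delta}.$$
   Context: $\langle x\rangle=(1+|x|^2)^{1/2}$; $\|f\|_{L^1_k}=\int\langle x\rangle^k|f|$; $(-\Delta)^s$ the Fourier multiplier with symbol $|\xi|^{2s}$; $\hat f(\xi)=\int e^{-ix\cdot\xi}f$; $J^s_\varepsilon(x)=\varepsilon^{-d}J^s(x/\varepsilon)$. An equilibrium is a probability density solving the stationary equation weakly. Hypothesis (H1): $(J^s)_{s\in(1/2,1)}$ is a family of probability densities on $\mathbb{R}^d$ with $J^s\in L^1\cap L^p$ for some $p\in(1,\infty]$, such that (i) $\int\min\{1,|y|^2\}J^s<\infty$; (ii) there exist $\delta,C_0>0$ independent of $s$ with $\hat J^s(\xi)=1-|\xi|^{2s}+R_s(\xi)$, $|R_s(\xi)|\le C_0|\xi|^{2s+\delta}$ for $|\xi|\le1$; (iii) there exist $C,R>0$,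 $\Psi$ with $\int(1+|x|^2)|\Psi|<\infty$, $\int x\Psi=0$, independent of $s$, with $J^s(x)\le C(1-s)|x|^{-d-2s}+\Psi(x)$ for $|x|\ge R$. *)

(* Defs.v *)
From HB Require Import structures.
From mathcomp Require Import all_boot all_order all_algebra.
From mathcomp Require Import all_classical all_reals all_analysis.
Set Implicit Arguments. Unset Strict Implicit. Unset Printing Implicit Defensive.
Import Order.TTheory GRing.Theory Num.Theory.
Import numFieldNormedType.Exports.
Local Open Scope classical_set_scope.
Local Open Scope ring_scope.

Section Defs.
Variable R : realType.

Definition dotp (d : nat) (x y : 'rV[R]_d) : R := \sum_(i < d) x ord0 i * y ord0 i.
Definition enorm (d : nat) (x : 'rV[R]_d) : R := Num.sqrt (dotp x x).
Definition jbr (d : nat) (x : 'rV[R]_d) : R := Num.sqrt (1 + enorm x ^+ 2).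

Definition borel_sets (d : nat) : set (set 'rV[R]_d) := <<s [set U | open U] >>.
Definition borel_fun (d : nat) (f : 'rV[R]_d -> R) : Prop :=
  forall U : set R, open U -> @borel_sets d (f @^-1` U).

(* Lebesgue integral over R^d of a nonnegative function (extended-real
   valued), defined as the iterated one-dimensional Lebesgue integral
   (equal to the d-dimensional Lebesgue integral for Borel functions
   by Tonelli). *)
Fixpoint iint (d : nat) : ('rV[R]_d -> \bar R) -> \bar R :=
  match d with
  | 0 => fun f => f 0
  | n.+1 => fun f =>
      (\int[@lebesgue_measure R]_(t in setT)
         iint (fun y : 'rV[R]_n => f (row_mx (const_mx t : 'rV[R]_1) y)))%E
  end.

Definition integrable (d : nat) (f : 'rV[R]_d -> R) : Prop :=
  borel_fun f /\ (iint (fun x => (`|f x|)%:E) < +oo)%E.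
Definition rint (d : nat) (f : 'rV[R]_d -> R) : R :=
  fine (iint (fun x => (Num.max (f x) 0)%:E))
  - fine (iint (fun x => (Num.max (- f x) 0)%:E)).

Definition prob_density (d : nat) (f : 'rV[R]_d -> R) : Prop :=
  borel_fun f /\ (forall x, 0 <= f x) /\ iint (fun x => (f x)%:E) = 1%E.

(* f in L^p, p in (1, +oo] : [p = None] encodes p = +oo *)
Definition in_Lp (d : nat) (p : option R) (f : 'rV[R]_d -> R) : Prop :=
  borel_fun f /\
  match p with
  | Some q => (iint (fun x => (`|f x| `^ q)%:E) < +oo)%E
  | None => exists M : R, iint (fun x => (if M < `|f x| then 1 else 0)%:E) = 0%E
  end.

Definition fourier_re (d : nat) (f : 'rV[R]_d -> R) (xi : 'rV[R]_d) : R :=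
  rint (fun x => cos (dotp x xi) * f x).
Definition fourier_im (d : nat) (f : 'rV[R]_d -> R) (xi : 'rV[R]_d) : R :=
  - rint (fun x => sin (dotp x xi) * f x).

Definition rescale (d : nat) (J : 'rV[R]_d -> R) (eps : R) (x : 'rV[R]_d) : R :=
  eps ^- d * J (eps^-1 *: x).

(* convolution (J * u)(x) = int J(x-y) u(y) dy, for nonnegative J, u *)
Definition conv (d : nat) (J u : 'rV[R]_d -> R) (x : 'rV[R]_d) : R :=
  fine (iint (fun y => (J (x - y) * u y)%:E)).

Definition test_fun (d : nat) (phi : 'rV[R]_d -> R) : Prop :=
  (forall x, differentiable phi x) /\ continuous phi /\
  (forall v : 'rV[R]_d, continuous (fun x => 'D_v phi x)) /\
  (exists M : R, forall x, M < enorm x -> phi x = 0).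

(* F is a probability equilibrium of
     d_t u = eps^{-2s} (J_eps * u - u) + div (x u),
   i.e. a probability density solving the stationary equation weakly:
     int [ eps^{-2s} (J_eps * F - F) phi - F (x . grad phi) ] = 0
   for every test function phi  (note x . grad phi (x) = D_x phi (x)). *)
Definition equilibrium (d : nat) (J : 'rV[R]_d -> R) (s eps : R)
    (F : 'rV[R]_d -> R) : Prop :=
  prob_density F /\
  forall phi, test_fun phi ->
    rint (fun x => eps `^ (- (2 * s)) * (conv (rescale J eps) F x - F x) * phi x
                   - F x * 'D_x phi x) = 0.

Definition H1 (d : nat) (J : R -> 'rV[R]_d -> R) (delta : R) : Prop :=
  (forall s, 1/2 < s < 1 ->
     prob_density (J s) /\
     (exists p : option R, (if p is Some q then 1 < q else True) /\ in_Lp p (J s)) /\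
     (iint (fun y => (Num.min 1 (enorm y ^+ 2) * J s y)%:E) < +oo)%E) /\
  0 < delta /\
  (exists C0 : R, 0 < C0 /\
     forall s, 1/2 < s < 1 -> forall xi : 'rV[R]_d, enorm xi <= 1 ->
       Num.sqrt ((fourier_re (J s) xi - (1 - enorm xi `^ (2 * s))) ^+ 2
                 + fourier_im (J s) xi ^+ 2)
       <= C0 * enorm xi `^ (2 * s + delta)) /\
  (exists (C Rad : R) (Psi : 'rV[R]_d -> R),
     0 < C /\ 0 < Rad /\ borel_fun Psi /\
     (iint (fun x => ((1 + enorm x ^+ 2) * `|Psi x|)%:E) < +oo)%E /\
     (forall i : 'I_d, rint (fun x => x ord0 i * Psi x) = 0) /\
     forall s, 1/2 < s < 1 -> forall x, Rad <= enorm x ->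
       J s x <= C * (1 - s) * enorm x `^ (- (d%:R) - 2 * s) + Psi x).

(* F is the equilibrium of d_t v = -(-Delta)^s v + div(x v):
   integrable with Fourier transform exp(-|xi|^{2s}/(2s)). *)
Definition frac_equilibrium (d : nat) (s : R) (G : 'rV[R]_d -> R) : Prop :=
  integrable G /\
  forall xi, fourier_re G xi = expR (- (enorm xi `^ (2 * s)) / (2 * s))
          /\ fourier_im G xi = 0.

Definition L1k_norm (d : nat) (k : R) (f : 'rV[R]_d -> R) : \bar R :=
  iint (fun x => (jbr x `^ k * `|f x|)%:E).

End Defs.

(* Main.v *)
(* Along a ray [r w] the Fourier transform phi of the equilibrium solves
   r phi' = eps^(-2s) (hat J (eps r w) - 1) phi, phi(0) = 1, whereas the stable law gives
   psi = exp(- r^(2s) / (2s)). Comparing the two equations for eps r <= r0 and using, for larger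
   r, that 1 - Re hat J (xi) <= 2 (1 - Re hat J (eta)) + 2 (1 - Re hat J (xi + eta)) prevents
   Re hat J from staying close to 1, one gets |phi - psi| <= C eps^delta (1 + |xi|^2)^(-d/2) and
   1 - Re phi (xi) <= C |xi| near 0, uniformly in s. The first bound controls F - G in L^2 (by
   duality against continuous functions, with a Fejer kernel in place of Plancherel's theorem),
   the second one moments of order m < 1. Splitting the weight <x>^k at the radius rho with
   rho^(m + d/2) = eps^(-delta) balances both. The stable density is only given by its Fourier
   transform; its nonnegativity, needed for its moments, follows from the central limit theorem
   for the symmetrized J. *)
Require Import Defs.
From HB Require Import structures.
From mathcomp Require Import all_boot all_order all_algebra.
From mathcomp Require Import all_classical all_reals all_analysis.
From mathcomp Require Import measurable_realfun ring lra.
Set Implicit Arguments. Unset Strict Implicit. Unset Printing Implicit Defensive.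
Import Order.TTheory GRing.Theory Num.Theory.
Import numFieldNormedType.Exports.
Local Open Scope classical_set_scope.
Local Open Scope ring_scope.

(** Two constraints shape the argument. No moment of the equilibrium is known beforehand, so plane
    waves cannot be used as tests: their derivative in the direction [x] grows linearly. They are
    replaced by plane waves averaged over a segment of the ray, [g u = int_0^T cos (r u - th) dr],
    for which [g u] and [u g' u] are both bounded; the equation along the ray then appears in
    integrated form, and differentiability of the transform is an outcome. Secondly, all constants
    must be uniform in [s]: of the exponent [p = 2 s] the estimates only use [1 <= p <= 2]. Beyond
    [r0 / eps] the expansion of the symbol says nothing, but the damping cannot be weak both at [r]
    and at [r + r0 / eps]; this gives decay with a power of order [eps^(-p)], which is at least the
    required one once [eps (8 d + 1) <= r0]. For larger [eps] the right-hand side of the theorem is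
    bounded below and the moment bounds alone suffice. The normalization of the Fourier transform is
    never computed: the constant [mass] only has to be positive. *)

Local Notation mfun := (measurable_fun setT).

(** * Borel sets of R^d and the Lebesgue measure behind the iterated integral *)

Section BorelRd.
Variable R : realType.

(** An alias of the row vectors whose measurable structure is the Borel sigma-algebra of their
    topology; being convertible to the matrix type, it lets one function be seen both as continuous
    and as measurable. *)
Definition bor (d : nat) := g_sigma_algebraType [set U : set 'rV[R]_d | open U].

Lemma open_bor d (U : set 'rV[R]_d) : open U -> measurable (U : set (bor d)).
Proof. exact: sub_sigma_algebra. Qed.

Lemma measurable_to_R d (T : measurableType d) (f : T -> R) :
  (forall U : set R, open U -> measurable (f @^-1` U)) -> mfun f.
Proof.
move=> H; apply: (measurability _ (RGenOpens.measurableE R)).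
by move=> _ [_ [a [b ->] <-]]; rewrite setTI; apply: H; exact: interval_open.
Qed.

Lemma borel_funP d (f : 'rV[R]_d -> R) :
  borel_fun f <-> mfun (f : bor d -> R).
Proof.
split=> [H|H U oU]; first exact: measurable_to_R.
rewrite -[X in borel_sets X]setTI.
by apply: H => //; exact: open_measurable.
Qed.

Lemma cont_bor d (f : 'rV[R]_d -> R) :
  continuous f -> mfun (f : bor d -> R).
Proof.
move=> /continuousP cf; apply: measurable_to_R => U oU.
by apply: open_bor; exact: cf.
Qed.

Lemma meas_coord d (i : 'I_d) :
  mfun ((fun x => x ord0 i) : bor d -> R).
Proof. by apply: cont_bor; exact: coord_continuous. Qed.

Lemma mx_ballE d (x : 'rV[R]_d) (e : R) : 0 < e ->
  ball x e = [set y | forall i, `|x ord0 i - y ord0 i| < e].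
Proof.
move=> e0; apply/seteqP; split => y /=.
  by move=> [_ H] i; have := H ord0 i; rewrite /ball/=.
by move=> H; split=> // i j; rewrite ord1; have := H j.
Qed.

(** Second countability in explicit form. The [if] assigns the empty set to the rational balls not
    contained in [U], so that the union runs over a whole countable type. *)
Lemma open_rational_balls d (U : set 'rV[R]_d) : open U ->
  U = \bigcup_(p : 'rV[rat]_d * rat)
      (if `[< 0 < p.2 /\ ball (map_mx (@ratr R) p.1) (ratr p.2) `<=` U >]
       then ball (map_mx (@ratr R) p.1) (ratr p.2 : R) else set0).
Proof.
move=> oU; apply/seteqP; split => x /=; last first.
  by move=> [p _]; case: ifPn => [/asboolP[_ H] /H|].
move=> Ux; have /nbhs_ballP[e /= e0 eU] := open_nbhs_nbhs (conj oU Ux).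
(* Half of [e]: two points within [r] of the rational center are within [e] of each other. *)
have [r] := @rat_in_itvoo R 0 (e / 2) (divr_gt0 e0 (ltr0Sn _ 1)).
rewrite in_itv/= => /andP[r0 re].
have H (i : 'I_d) : exists q : rat, `|ratr q - x ord0 i| < ratr r.
  have [q] := @rat_in_itvoo R (x ord0 i - ratr r) (x ord0 i + ratr r) ltac:(lra).
  by rewrite in_itv/= => qq; exists q; rewrite ltr_norml; lra.
have [q hq] := choice H.
have r0' : 0 < r by rewrite -(ltr0q R).
have bx : ball (map_mx (@ratr R) (\row_i q i)) (ratr r) x.
  by rewrite mx_ballE//= => i; rewrite !mxE.
exists (\row_i q i, r) => //=; case: ifPn => // /asboolPn; apply.
split=> // y; rewrite mx_ballE//= => hy; apply: eU.
rewrite mx_ballE//= => i; have := hy i; have := hq i; rewrite !mxE.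
by rewrite !ltr_norml; lra.
Qed.

(** Balls of row vectors are cubes, so the preimage of a rational ball is a finite intersection of
    coordinate conditions, and an open set is a countable union of such balls. This identifies the
    Borel sigma-algebra with the one generated by the coordinates. *)
Lemma measurable_to_bor dd (T : measurableType dd) d (f : T -> bor d) :
  (forall i, mfun (fun t => f t ord0 i)) -> mfun f.
Proof.
move=> mf; apply: (@measurability _ _ T (bor d) setT f [set U | open U]) => //.
move=> _ [U oU <-]; rewrite setTI (open_rational_balls oU) preimage_bigcup.
apply: (countable_bigcupT_measurable (countableP _)) => -[q r] /=.
case: ifPn => [/asboolP[r0 _]|_]; last by rewrite preimage_set0.
rewrite mx_ballE ?ltr0q//.
rewrite (_ : _ @^-1` _ = \bigcap_(i in [set: 'I_d])
   (setT `&` ((fun t => f t ord0 i) @^-1` ball (ratr (q ord0 i) : R) (ratr r)))).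
  apply: fin_bigcap_measurable => // i _.
  by apply: mf => //; apply: open_measurable; exact: ball_open.
apply/seteqP; split=> t /= H i; have := H i; rewrite !mxE //=.
  by move=> /(_ Logic.I)[_].
Qed.

Definition cons1 (n : nat) (p : R * bor n) : bor n.+1 :=
  row_mx (const_mx p.1 : 'rV[R]_1) p.2.

Lemma cons1_0 n (p : R * bor n) : cons1 p ord0 ord0 = p.1.
Proof.
rewrite /cons1 mxE; case: splitP => [j|j]/=; first by rewrite mxE.
by rewrite add1n.
Qed.

Lemma cons1_S n (p : R * bor n) i : cons1 p ord0 (lift ord0 i) = p.2 ord0 i.
Proof.
rewrite /cons1 mxE; case: splitP => [j|j]/=.
  by rewrite /bump/= ord1.
by rewrite /bump/= !add1n => -[/val_inj ->].
Qed.

Lemma measurable_cons1 n : mfun (@cons1 n).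
Proof.
apply: measurable_to_bor => i; case: (unliftP ord0 i) => [j|] ->.
  rewrite (_ : (fun t => _) = (fun t : R * bor n => t.2 ord0 j)); last first.
    by apply/funext => t; rewrite cons1_S.
  exact: (measurableT_comp (meas_coord j) measurable_snd).
rewrite (_ : (fun t => _) = fst); last by apply/funext => t; rewrite cons1_0.
exact: measurable_fst.
Qed.

(** Cubes of finite measure exhaust the space, which gives sigma-finiteness; their volume returns in
    the final interpolation. *)
Definition box d (r : R) : set (bor d) := [set x | forall i, `|x ord0 i| <= r].

Lemma measurable_box d r : measurable (@box d r).
Proof.
rewrite (_ : @box d r = \bigcap_(i in [set: 'I_d])
   (setT `&` ((fun t : bor d => t ord0 i) @^-1` `[-r, r]))).
  by apply: fin_bigcap_measurable => // i _; apply: meas_coord.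
apply/seteqP; split=> t /= H i; have := H i; rewrite /= !in_itv/= ler_norml//.
by move=> /(_ Logic.I)[_].
Qed.

Section sigma_finite_measure_of.
Context d (T : measurableType d) (m : {measure set T -> \bar R}).

(* A copy of [m] carrying the sigma-finiteness proof as a canonical instance. *)
Definition sfm of sigma_finite setT m : set T -> \bar R := m.

HB.instance Definition _ (sf : sigma_finite setT m) := Measure.on (sfm sf).

HB.instance Definition _ (sf : sigma_finite setT m) :=
  Measure_isSigmaFinite.Build _ _ _ (sfm sf) sf.

End sigma_finite_measure_of.

(* Lebesgue measure on R^(n+1) is the push-forward of the product measure under [cons1],
   which matches the iterated integral [iint]. *)
Lemma succ_measure n (mu : {sigma_finite_measure set (bor n) -> \bar R}) :
  (forall r : R, 0 <= r -> mu (@box n r) = ((2 * r) ^+ n)%:E) ->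
  exists nu : {sigma_finite_measure set (bor n.+1) -> \bar R},
    (forall r : R, 0 <= r -> nu (@box n.+1 r) = ((2 * r) ^+ n.+1)%:E) /\
    forall f : bor n.+1 -> \bar R, mfun f -> (forall x, 0 <= f x)%E ->
      (\int[nu]_x f x = \int[@lebesgue_measure R]_t \int[mu]_y f (cons1 (t, y)))%E.
Proof.
move=> mubox.
have mc := @measurable_cons1 n.
pose nu1 : {measure set (bor n.+1) -> \bar R} :=
  pushforward (@lebesgue_measure R \x mu)%E (@cons1 n).
pose nu0 := nu1 mc.
have nuE (A : set R) (B : set (bor n)) (C : set (bor n.+1)) : measurable A -> measurable B ->
    (@cons1 n) @^-1` C = A `*` B -> (nu0 C = lebesgue_measure A * mu B)%E.
  move=> mA mB e; rewrite /nu0/= /pushforward e.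
  exact: product_measure1E.
have nubox (r : R) : 0 <= r -> nu0 (@box n.+1 r) = ((2 * r) ^+ n.+1)%:E.
  move=> r0; rewrite (nuE `[-r, r]%classic (@box n r)) ?mubox//.
  - rewrite lebesgue_measure_itv/= lte_fin exprS; case: ifPn => rr.
      by rewrite -EFinD -EFinM; congr (_%:E); ring.
    have -> : r = 0 by lra.
    by rewrite mulr0 !mul0r mul0e.
  - exact: measurable_box.
  - apply/seteqP; split=> -[t y] /=.
      move=> H; split=> [|i].
        by have := H ord0; rewrite cons1_0/= in_itv/= ler_norml.
      by have := H (lift ord0 i); rewrite cons1_S.
    rewrite in_itv/= -ler_norml => -[H1 H2] i.
    by case: (unliftP ord0 i) => [j|] ->; rewrite ?cons1_S ?cons1_0.
have sf : sigma_finite setT nu0.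
  exists (fun k => @box n.+1 k%:R); last first.
    by move=> k; split; [exact: measurable_box|rewrite nubox// ltry].
  apply/seteqP; split=> // x _ /=.
  exists (Num.bound (\sum_i `|x ord0 i|)) => // i /=.
  rewrite (le_trans _ (ltW (archi_boundP _)))//; last exact: sumr_ge0.
  by rewrite (bigD1 i)//= lerDl sumr_ge0.
pose nu : {sigma_finite_measure set (bor n.+1) -> \bar R} :=
  sfm sf.
exists nu; split=> // f mf f0.
rewrite (_ : (\int[nu]_x f x = \int[nu0]_x f x)%E)//.
rewrite [LHS]ge0_integral_pushforward//.
transitivity (\int[@lebesgue_measure R \x mu]_x (f \o @cons1 n) x)%E.
  by rewrite preimage_setT.
rewrite fubini_tonelli1//; first exact: (measurableT_comp mf mc).
by move=> x; exact: f0.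
Qed.

Lemma mu_data0 (r : R) : 0 <= r -> dirac (0 : bor 0) (@box 0 r) = ((2 * r) ^+ 0)%:E.
Proof. by move=> r0; rewrite /dirac indicE mem_set// => -[]. Qed.

(** The volume of cubes is carried along because the sigma-finiteness of the next measure is proved
    from it. *)
Fixpoint mu_data d : {mu : {sigma_finite_measure set (bor d) -> \bar R} |
    forall r : R, 0 <= r -> mu (@box d r) = ((2 * r) ^+ d)%:E} :=
  match d with
  | 0 => exist _ (dirac (0 : bor 0) : {sigma_finite_measure set (bor 0) -> \bar R})
           mu_data0
  | n.+1 => let: exist mu mubox := mu_data n in
     let: exist nu Hnu := cid (succ_measure mubox) in exist _ nu Hnu.1
  end.

Definition leb d : {sigma_finite_measure set (bor d) -> \bar R} := sval (mu_data d).

Lemma leb_box d (r : R) : 0 <= r -> leb d (@box d r) = ((2 * r) ^+ d)%:E.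
Proof. exact: (svalP (mu_data d)). Qed.

Lemma lebS n (f : bor n.+1 -> \bar R) :
  mfun f -> (forall x, 0 <= f x)%E ->
  (\int[leb n.+1]_x f x =
   \int[@lebesgue_measure R]_t \int[leb n]_y f (cons1 (t, y)))%E.
Proof.
move=> mf f0; rewrite /leb/=; case: (mu_data n) => mu mubox /=.
by case: (cid _) => nu [nubox nuE] /=; exact: nuE.
Qed.

Lemma rV0E (x : 'rV[R]_0) : x = 0.
Proof. by apply/rowP => -[]. Qed.

Lemma leb0 (f : bor 0 -> \bar R) : mfun f ->
  (\int[leb 0]_x f x)%E = f (0 : 'rV[R]_0).
Proof.
move=> mf; rewrite integral_dirac// diracT mul1e.
by [].
Qed.

Lemma measurable_cons1r n t : mfun (fun y : bor n => cons1 (t, y)).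
Proof. exact: (measurable_fun_pair2 _ (@measurable_cons1 n)). Qed.

Lemma iintE d (f : bor d -> \bar R) :
  mfun f -> (forall x, 0 <= f x)%E ->
  iint f = (\int[leb d]_x f x)%E.
Proof.
elim: d f => [|n IH] f mf f0; first by rewrite leb0.
rewrite lebS//=; apply: eq_integral => t _; rewrite IH//.
exact: (measurableT_comp mf (@measurable_cons1r n t)).
Qed.

Lemma iint_EFin d (f : 'rV[R]_d -> R) :
  borel_fun f -> (forall x, 0 <= f x) ->
  iint (fun x => (f x)%:E) = (\int[leb d]_x (f x)%:E)%E.
Proof. by move=> /borel_funP mf f0; rewrite iintE//; exact/measurable_EFinP. Qed.

Definition integ d (f : 'rV[R]_d -> R) := (leb d).-integrable setT (EFin \o f).

Definition II d (f : 'rV[R]_d -> R) : R := Rintegral (leb d) setT f.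

Lemma integP d (f : 'rV[R]_d -> R) : Defs.integrable f <-> integ f.
Proof.
split=> [[/borel_funP mf]|/integrableP[/measurable_EFinP mf]].
  rewrite iint_EFin//; last exact/borel_funP/measurableT_comp.
  by move=> H; apply/integrableP; split=> //; exact/measurable_EFinP.
move=> H; split; first exact/borel_funP.
by rewrite iint_EFin//; exact/borel_funP/measurableT_comp.
Qed.

Lemma rintE d (f : 'rV[R]_d -> R) : integ f -> rint f = II f.
Proof.
move=> fi; have /integrableP[/measurable_EFinP mf _] := fi.
rewrite /rint /II /Rintegral integralE fineB//.
- rewrite !iint_EFin.
  + congr (fine _ - fine _); apply: eq_integral => x _.
      by rewrite funeposE/= EFin_max.
    by rewrite funenegE/= EFin_max EFinN.
  + by apply/borel_funP; apply: measurable_maxr => //; exact: measurableT_comp.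
  + by move=> x; rewrite le_max lexx orbT.
  + by apply/borel_funP; apply: measurable_maxr => //; exact: measurableT_comp.
  + by move=> x; rewrite le_max lexx orbT.
- by apply: integrable_fin_num => //; exact: integrable_funepos.
- by apply: integrable_fin_num => //; exact: integrable_funeneg.
Qed.

(** The push-forward of Lebesgue measure, multiplied by [|a|], agrees with Lebesgue measure on
    half-open intervals, hence everywhere by uniqueness. *)
Lemma affine1 (a b : R) (f : R -> \bar R) : a != 0 ->
  mfun f -> (forall x, 0 <= f x)%E ->
  (`|a|%:E * \int[@lebesgue_measure R]_t f (a * t + b)%R =
   \int[@lebesgue_measure R]_t f t)%E.
Proof.
move=> a0 mf f0.
pose phi : measurableTypeR R -> measurableTypeR R := fun t => a * t + b.
have mphi : mfun phi.
  by apply: measurable_funD => //; exact: measurable_funM.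
pose m1 : {measure set (measurableTypeR R) -> \bar R} :=
  pushforward (@lebesgue_measure R) phi.
pose m2 := m1 mphi.
have na0 : 0 <= `|a| by [].
pose m3 : {measure set (measurableTypeR R) -> \bar R} := mscale (NngNum na0) m2.
have m3E A : measurable A -> lebesgue_measure A = m3 A.
  apply: lebesgue_measure_unique => _ [[u v] _ <-].
  rewrite /m3/= /mscale/= /m2 /m1/= /pushforward lebesgue_measure_itv/= lte_fin.
  (* For negative [a] the preimage of a half-open interval is closed at its other end; its length is
     the same. *)
  have [aneg|apos] := ltP a 0.
  - rewrite (_ : _ @^-1` _ = `[(v - b) / a, (u - b) / a[%classic); last first.
      apply/seteqP; split => t /=; rewrite !in_itv/= /phi.
        by rewrite ler_ndivrMr// ltr_ndivlMr//; lra.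
      by rewrite ler_ndivrMr// ltr_ndivlMr//; lra.
    rewrite lebesgue_measure_itv/= lte_fin ltr_ndivrMr// divfK// ltrD2r.
    case: ifPn => _; last by rewrite mule0.
    rewrite -!EFinD -EFinM ltr0_norm//; congr (_%:E).
    by field.
  - have {}apos : 0 < a by rewrite lt_neqAle eq_sym a0.
    rewrite (_ : _ @^-1` _ = `](u - b) / a, (v - b) / a]%classic); last first.
      apply/seteqP; split => t /=; rewrite !in_itv/= /phi.
        by rewrite ler_pdivlMr// ltr_pdivrMr//; lra.
      by rewrite ler_pdivlMr// ltr_pdivrMr//; lra.
    rewrite lebesgue_measure_itv/= lte_fin ltr_pdivrMr// divfK// ltrD2r.
    case: ifPn => _; last by rewrite mule0.
    rewrite -!EFinD -EFinM gtr0_norm//; congr (_%:E).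
    by field.
rewrite [RHS](_ : _ = \int[m3]_t f t)%E; last first.
  by apply: eq_measure_integral => A mA _; exact: m3E.
rewrite ge0_integral_mscale//=; congr (_ * _)%E.
by rewrite ge0_integral_pushforward.
Qed.

Lemma affine_coord d (a : R) (x b : 'rV[R]_d) i :
  (a *: x + b) ord0 i = a * x ord0 i + b ord0 i.
Proof. by rewrite !mxE. Qed.

Lemma measurable_affine d (a : R) (b : 'rV[R]_d) :
  mfun (fun x : bor d => a *: x + b : bor d).
Proof.
apply: measurable_to_bor => i.
rewrite (_ : (fun t => _) = (fun t : bor d => a * t ord0 i + b ord0 i)); last first.
  by apply/funext => t; rewrite !mxE.
by apply: measurable_funD => //; apply: measurable_funM => //; exact: meas_coord.
Qed.

(** Induction on the dimension: the one-dimensional change of variables handles the first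
    coordinate, the induction hypothesis the remaining ones with the tail of [b]. *)
Lemma leb_affine d (a : R) (b : 'rV[R]_d) (f : bor d -> \bar R) : a != 0 ->
  mfun f -> (forall x, 0 <= f x)%E ->
  ((`|a| ^+ d)%:E * \int[leb d]_x f (a *: x + b)%R = \int[leb d]_x f x)%E.
Proof.
move=> a0; elim: d b f => [|n IH] b f mf f0.
  rewrite expr0 mul1e; apply: eq_integral => x _; congr f.
  by rewrite [LHS]rV0E [RHS]rV0E.
have maff := @measurable_affine n.+1 a b.
rewrite !lebS//; last first.
  exact: (measurableT_comp mf maff).
pose g (t : R) := (\int[leb n]_y f (cons1 (t, y)))%E.
have mg : mfun (g : measurableTypeR R -> \bar R).
  apply: (@measurable_fun_fubini_tonelli_F _ _ (measurableTypeR R) (bor n) R (leb n)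
     (f \o @cons1 n)).
    exact: (measurableT_comp mf (@measurable_cons1 n)).
  by move=> ?; exact: f0.
have g0 t : (0 <= g t)%E by apply: integral_ge0.
rewrite -(affine1 (b ord0 ord0) a0 mg g0) exprS EFinM -muleA; congr (_ * _)%E.
rewrite -ge0_integralZl//; last 2 first.
- apply: (@measurable_fun_fubini_tonelli_F _ _ (measurableTypeR R) (bor n) R (leb n)
     (fun x => f (a *: cons1 x + b))).
    exact: (measurableT_comp (measurableT_comp mf maff) (@measurable_cons1 n)).
  by move=> ?; exact: f0.
- by move=> t _; apply: integral_ge0.
apply: eq_integral => t _.
rewrite /g -[RHS](IH (\row_i b ord0 (lift ord0 i))) //; last first.
  exact: (measurableT_comp mf (@measurable_cons1r n _)).
congr (_ * _)%E; apply: eq_integral => y _; congr f.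
apply/rowP => i; case: (unliftP ord0 i) => [j|] ->; rewrite affine_coord.
  by rewrite !cons1_S affine_coord mxE.
by rewrite !cons1_0.
Qed.

Lemma II_affine d (a : R) (b : 'rV[R]_d) (f : 'rV[R]_d -> R) : a != 0 ->
  integ f -> integ (fun x => f (a *: x + b)) /\
  II f = `|a| ^+ d * II (fun x => f (a *: x + b)).
Proof.
move=> a0 /integrableP[mf ifoo].
have ad0 : 0 < `|a| ^+ d by rewrite exprn_gt0// normr_gt0.
have fi : integ (fun x => f (a *: x + b)).
  apply/integrableP; split.
    exact: (measurableT_comp mf (@measurable_affine d a b)).
  move: ifoo; rewrite -(leb_affine b a0)//; last exact: measurableT_comp.
  have : (0 <= \int[leb d]_x (abse \o (EFin \o f)) (a *: x + b)%R)%E.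
    by apply: integral_ge0 => x _; exact: abse_ge0.
  rewrite /=; case: integral => [r| |]//; first by move=> *; rewrite ltry.
  by rewrite gt0_muley ?lte_fin.
split=> //.
pose g := EFin \o (fun x => f (a *: x + b)).
have gp : (\int[leb d]_x (EFin \o f)^\+ (a *: x + b)%R = \int[leb d]_x g^\+ x)%E.
  by apply: eq_integral => x _; rewrite !funeposE.
have gn : (\int[leb d]_x (EFin \o f)^\- (a *: x + b)%R = \int[leb d]_x g^\- x)%E.
  by apply: eq_integral => x _; rewrite !funenegE.
have hp : (\int[leb d]_x g^\+ x)%E \is a fin_num.
  exact: (integrable_fin_num measurableT (integrable_funepos measurableT fi)).
have hn : (\int[leb d]_x g^\- x)%E \is a fin_num.
  exact: (integrable_fin_num measurableT (integrable_funeneg measurableT fi)).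
rewrite /II /Rintegral -/g [in LHS]integralE [in RHS]integralE.
rewrite -(leb_affine b a0 (measurable_funepos mf))//.
rewrite -(leb_affine b a0 (measurable_funeneg mf))//.
by rewrite gp gn -(fineK hp) -(fineK hn) -!EFinM -!EFinN -!EFinD/= mulrBr.
Qed.

End BorelRd.

(** * Real-valued integrals: linearity, comparison, dominated convergence *)

Section RealInt.
Context dd (T : measurableType dd) (R : realType) (mu : {measure set T -> \bar R}).
Implicit Types f g h : T -> R.

Definition intg f := mu.-integrable setT (EFin \o f).

Lemma intg_meas f : intg f -> mfun f.
Proof. by case/integrableP => /measurable_EFinP. Qed.

Lemma intg_le f g : mfun f -> intg g -> (forall x, `|f x| <= g x) -> intg f.
Proof.
move=> mf ig fg; apply: (le_integrable _ _ _ ig) => //; first exact/measurable_EFinP.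
by move=> x _ /=; rewrite lee_fin (le_trans (fg x))// ler_norm.
Qed.

Lemma intg_abs f : intg f -> intg (fun x => `|f x|).
Proof.
move=> fi; apply: (le_integrable _ _ _ fi) => //.
  by apply/measurable_EFinP; apply: measurableT_comp => //; exact: intg_meas.
by move=> x _ /=; rewrite lee_fin normr_id.
Qed.

Lemma intgD f g : intg f -> intg g -> intg (fun x => f x + g x).
Proof. by move=> fi gi; exact: (integrableD _ fi gi). Qed.

Lemma intgB f g : intg f -> intg g -> intg (fun x => f x - g x).
Proof. by move=> fi gi; exact: (integrableB _ fi gi). Qed.

Lemma intgZ (c : R) f : intg f -> intg (fun x => c * f x).
Proof. by move=> fi; exact: (integrableZl _ c fi). Qed.

Lemma intg_eq f g : f =1 g -> intg f -> intg g.
Proof. by move=> /funext ->. Qed.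

Lemma intg_mulb h f (M : R) : mfun h -> (forall x, `|h x| <= M) ->
  intg f -> intg (fun x => h x * f x).
Proof.
move=> mh hM fi; apply: (intg_le (g := fun x => M * `|f x|)).
- by apply: measurable_funM => //; exact: intg_meas.
- exact/intgZ/intg_abs.
- by move=> x; rewrite normrM ler_wpM2r.
Qed.

Lemma Rint_ge0 f : (forall x, 0 <= f x) -> 0 <= \int[mu]_x f x.
Proof. by move=> f0; apply: Rintegral_ge0. Qed.

Lemma Rint_le f g : intg f -> intg g -> (forall x, f x <= g x) ->
  \int[mu]_x f x <= \int[mu]_x g x.
Proof. by move=> fi gi fg; apply: le_Rintegral. Qed.

Lemma RintD f g : intg f -> intg g ->
  \int[mu]_x (f x + g x) = \int[mu]_x f x + \int[mu]_x g x.
Proof. by move=> fi gi; rewrite RintegralD. Qed.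

Lemma RintB f g : intg f -> intg g ->
  \int[mu]_x (f x - g x) = \int[mu]_x f x - \int[mu]_x g x.
Proof. by move=> fi gi; rewrite RintegralB. Qed.

Lemma RintZ c f : intg f -> \int[mu]_x (c * f x) = c * \int[mu]_x f x.
Proof. by move=> fi; rewrite RintegralZl. Qed.

Lemma Rint_eq f g : f =1 g -> \int[mu]_x f x = \int[mu]_x g x.
Proof. by move=> /funext ->. Qed.

Lemma Rint_norm f : intg f -> `|\int[mu]_x f x| <= \int[mu]_x `|f x|.
Proof. by move=> fi; apply: le_normr_Rintegral. Qed.

Lemma Rint_normb f g : intg f -> intg g -> (forall x, `|f x| <= g x) ->
  `|\int[mu]_x f x| <= \int[mu]_x g x.
Proof.
move=> fi gi fg; apply: le_trans (Rint_norm fi) _.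
by apply: Rint_le => //; exact: intg_abs.
Qed.

Lemma Rint_fin f : intg f -> (\int[mu]_x f x)%:E = (\int[mu]_x (f x)%:E)%E.
Proof. by move=> fi; rewrite fineK//; exact: integrable_fin_num. Qed.

Lemma intg_ge0P f : mfun f -> (forall x, 0 <= f x) ->
  intg f <-> (\int[mu]_x (f x)%:E < +oo)%E.
Proof.
move=> mf f0; split=> [/integrableP[_]|H].
  by under eq_integral do rewrite /= ger0_norm//.
apply/integrableP; split; first exact/measurable_EFinP.
by under eq_integral do rewrite /= ger0_norm//.
Qed.

Lemma Rint_dct (f_ : nat -> T -> R) f g :
  (forall n, mfun (f_ n)) ->
  (forall x, f_ n x @[n --> \oo] --> f x) -> intg g ->
  (forall n x, `|f_ n x| <= g x) ->
  intg f /\ (\int[mu]_x f_ n x @[n --> \oo] --> \int[mu]_x f x).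
Proof.
move=> mf ff gi fg.
have mf_ n : mfun (fun x => (f_ n x)%:E) by exact/measurable_EFinP.
have cf x : setT x -> (f_ n x)%:E @[n --> \oo] --> (f x)%:E.
  by move=> _; apply: cvg_EFin (ff x); exact: nearW.
have g_fin x : setT x -> (EFin \o g) x \is a fin_num by [].
have fg' n x : setT x -> (`|(f_ n x)%:E| <= (EFin \o g) x)%E.
  by move=> _; rewrite /= lee_fin.
have mlim : mfun f.
  apply/measurable_EFinP.
  exact: (emeasurable_fun_cvg (fun n x => (f_ n x)%:E) _ mf_ cf).
have fi : intg f.
  apply: (intg_le mlim gi) => x.
  have : `|f_ n x| @[n --> \oo] --> `|f x| by apply: cvg_norm; exact: ff.
  by move=> h; apply: (cvgr_to_le h); apply: nearW => n.
split=> //; apply: fine_cvg; rewrite -/(Rintegral mu setT f).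
have := dominated_cvg measurableT mf_ cf g_fin gi fg'.
by rewrite -Rint_fin.
Qed.

End RealInt.

(** * Fubini's theorem for real-valued integrals *)

Section RealFubini.
Context d1 d2 (T1 : measurableType d1) (T2 : measurableType d2) (R : realType).
Variables (m1 : {sigma_finite_measure set T1 -> \bar R})
          (m2 : {sigma_finite_measure set T2 -> \bar R}).
Implicit Type F : T1 * T2 -> R.

Lemma intg_prod F (f : T1 -> R) (g : T2 -> R) : mfun F ->
  intg m1 f -> intg m2 g -> (forall x y, `|F (x, y)| <= f x * g y) ->
  intg (m1 \x m2)%E F.
Proof.
move=> mF fi gi H.
have mG : mfun (fun p : T1 * T2 => `|f p.1| * `|g p.2|).
  apply: measurable_funM; apply: measurableT_comp => //.
    exact: (measurableT_comp (intg_meas fi) measurable_fst).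
  exact: (measurableT_comp (intg_meas gi) measurable_snd).
apply: (@intg_le _ _ _ _ _ (fun p => `|f p.1| * `|g p.2|)) => //; last first.
  by move=> -[x y] /=; rewrite -normrM (le_trans (H x y))// ler_norm.
apply/integrable12ltyP; first exact/measurable_EFinP.
under eq_integral => x _.
  under eq_integral => y _ do rewrite /= ger0_norm ?mulr_ge0// EFinM.
  rewrite ge0_integralZl//; last first.
    by apply/measurable_EFinP; apply: measurableT_comp => //; exact: intg_meas gi.
  rewrite -(Rint_fin (intg_abs gi)).
  over.
rewrite ge0_integralZr//; last 2 first.
- by apply/measurable_EFinP; apply: measurableT_comp => //; exact: intg_meas fi.
- by rewrite lee_fin Rint_ge0.
by rewrite -(Rint_fin (intg_abs fi)) -EFinM ltry.
Qed.

Lemma abse_fine_le (z : \bar R) : (`|(fine z)%:E| <= `|z|)%E.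
Proof. by case: z => [r| |] //=; rewrite normr0 leey. Qed.

(** The real-valued inner integral differs from the extended one only where the section is not
    integrable, a null set on which [fine] returns 0; both outer integrals are therefore
    unchanged. *)
Lemma RFubini F : intg (m1 \x m2)%E F ->
  [/\ intg m1 (fun x => \int[m2]_y F (x, y)), intg m2 (fun y => \int[m1]_x F (x, y)) &
   \int[m1]_x \int[m2]_y F (x, y) = \int[m2]_y \int[m1]_x F (x, y)].
Proof.
move=> Fi.
have A1 : ae_eq m1 setT (fun x => (\int[m2]_y (F (x, y))%:E)%E)
    (fun x => (\int[m2]_y F (x, y))%:E).
  have := ae_integrable1 Fi; apply: filterS => x /= H _.
  by rewrite (Rint_fin H).
have A2 : ae_eq m2 setT (fun y => (\int[m1]_x (F (x, y))%:E)%E)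
    (fun y => (\int[m1]_x F (x, y))%:E).
  have := ae_integrable2 Fi; apply: filterS => x /= H _.
  by rewrite (Rint_fin H).
have I1 : intg m1 (fun x => \int[m2]_y F (x, y)).
  apply: (le_integrable measurableT _ _ (integrable_fubini_F Fi)).
    apply/measurable_EFinP; apply: (measurableT_comp (fine_measurable measurableT)).
    exact: (measurable_fubini_F Fi).
  by move=> x _; exact: abse_fine_le.
have I2 : intg m2 (fun y => \int[m1]_x F (x, y)).
  have mF : mfun (EFin \o F) by apply/measurable_EFinP; exact: intg_meas Fi.
  apply/integrableP; split.
    apply/measurable_EFinP; apply: (measurableT_comp (fine_measurable measurableT)).
    exact: (measurable_fubini_G Fi).
  apply: le_lt_trans ((integrable21ltyP _ _ mF).1 Fi).
  apply: ge0_le_integral => //.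
  - apply: measurableT_comp => //.
    apply/measurable_EFinP; apply: (measurableT_comp (fine_measurable measurableT)).
    exact: (measurable_fubini_G Fi).
  - apply: (measurable_fun_fubini_tonelli_G (abse \o (EFin \o F))) => //.
      exact: measurableT_comp.
    by move=> x; exact: abse_ge0.
  - move=> y _; apply: le_trans (abse_fine_le _) _.
    by apply: le_abse_integral => //; exact: (measurableT_comp mF).
split=> //.
have /= E1 := Fubini Fi.
rewrite /Rintegral; congr fine.
transitivity (\int[m1]_x \int[m2]_y (F (x, y))%:E)%E.
  apply/esym/ae_eq_integral => //.
  - exact: (measurable_fubini_F Fi).
  - by apply/measurable_EFinP; exact: intg_meas I1.
rewrite E1; apply/ae_eq_integral => //.
  - exact: (measurable_fubini_G Fi).
  - by apply/measurable_EFinP; exact: intg_meas I2.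
Qed.

(** The shape in which Fubini is used for trigonometric kernels: two integrable functions of
    separate variables and a bounded coupling [h]. *)
Lemma swap_bdd f k (h : T1 * T2 -> R) M : intg m1 f -> intg m2 k ->
  mfun h -> (forall p, `|h p| <= M) ->
  \int[m1]_x (f x * \int[m2]_y (k y * h (x, y))) =
  \int[m2]_y (k y * \int[m1]_x (h (x, y) * f x)) /\
  intg m2 (fun y => k y * \int[m1]_x (h (x, y) * f x)).
Proof.
move=> fi ki mh hM.
have mf := intg_meas fi; have mk := intg_meas ki.
have Fi : intg (m1 \x m2)%E (fun p => f p.1 * (k p.2 * h p)).
  apply: (@intg_prod _ (fun x => M * `|f x|) (fun y => `|k y|)).
  - apply: measurable_funM; first exact: (measurableT_comp mf).
    by apply: measurable_funM => //; exact: (measurableT_comp mk).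
  - exact/intgZ/intg_abs.
  - exact: intg_abs.
  - move=> x y /=; rewrite !normrM mulrA [M * _]mulrC mulrAC; apply: ler_wpM2r => //.
    exact: ler_wpM2l.
have [_ I2 E] := RFubini Fi.
have C x : intg m2 (fun y => k y * h (x, y)).
  have C' : intg m2 (fun y => h (x, y) * k y).
    by apply: (intg_mulb (M := M)) ki => //; exact: (measurable_fun_pair2 _ mh).
  by apply: (intg_eq _ C') => y; rewrite mulrC.
have E2 y : \int[m1]_x (f x * (k y * h (x, y))) = k y * \int[m1]_x (h (x, y) * f x).
  rewrite -RintZ; first by apply: Rint_eq => x; ring.
  by apply: (intg_mulb (M := M)) fi => //; exact: (measurable_fun_pair1 _ mh).
split; last by apply: (intg_eq _ I2) => y; rewrite /= E2.
transitivity (\int[m1]_x \int[m2]_y (f x * (k y * h (x, y)))).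
  by apply: Rint_eq => x; rewrite RintZ.
by rewrite E; apply: Rint_eq => y; rewrite E2.
Qed.

End RealFubini.

Lemma RintZ_ge0 dd (T : measurableType dd) (R : realType)
    (mu : {measure set T -> \bar R}) (c : R) (g : T -> R) :
  mfun g -> (forall x, 0 <= g x) ->
  \int[mu]_x (c * g x) = c * \int[mu]_x g x.
Proof.
move=> mg g0.
have mg' : mfun (EFin \o g) by exact/measurable_EFinP.
have P (e : R) : 0 <= e -> (\int[mu]_x (e * g x)%:E = e%:E * \int[mu]_x (g x)%:E)%E.
  move=> e0; under eq_integral do rewrite EFinM.
  by apply: ge0_integralZl => // x _; rewrite /= lee_fin.
have [/P E|cneg] := leP 0 c.
  rewrite /Rintegral E; case: integral => [r| |] //=.
    by rewrite mulry mulr0; case: sgrP => *; rewrite ?mul0e ?mul1e ?mulN1e.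
  by rewrite mulrNy mulr0; case: sgrP => *; rewrite ?mul0e ?mul1e ?mulN1e.
rewrite /Rintegral.
rewrite (_ : (\int[mu]_x (c * g x)%:E = - \int[mu]_x (- c * g x)%:E)%E).
  rewrite P; last by lra.
  case: integral => [r| |] /=; first by rewrite mulNr opprK.
    by rewrite mulry mulr0; case: sgrP => *; rewrite ?mul0e ?mul1e ?mulN1e ?oppe0.
  by rewrite mulrNy mulr0; case: sgrP => *; rewrite ?mul0e ?mul1e ?mulN1e ?oppe0.
rewrite -integral_ge0N//; last first.
  by move=> x _; rewrite lee_fin mulr_ge0//; lra.
by apply: eq_integral => x _; rewrite -EFinN mulNr opprK.
Qed.

(** * Cosine and sine transforms, rescaling and convolution of densities *)

Section FT.
Variable R : realType.
Variable d : nat.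
Implicit Types (f g J u : 'rV[R]_d -> R) (x y xi : 'rV[R]_d).

Local Notation mu := (@leb R d).

Lemma meas_coordf dd (T : measurableType dd) (f : T -> bor R d) i :
  mfun f -> mfun (fun t => f t ord0 i).
Proof. by move=> mf; exact: (measurableT_comp (@meas_coord R d i) mf). Qed.

Lemma meas_dotp dd (T : measurableType dd) (f g : T -> bor R d) :
  mfun f -> mfun g ->
  mfun (fun t => dotp (f t) (g t)).
Proof.
move=> mf mg; apply: measurable_sum => i.
by apply: measurable_funM; exact: meas_coordf.
Qed.

Lemma meas_subv dd (T : measurableType dd) (f g : T -> bor R d) :
  mfun f -> mfun g ->
  mfun (fun t => f t - g t : bor R d).
Proof.
move=> mf mg; apply: measurable_to_bor => i.
rewrite (_ : (fun t => _) = (fun t => f t ord0 i - g t ord0 i)); last first.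
  by apply/funext => t; rewrite !mxE.
by apply: measurable_funB; exact: meas_coordf.
Qed.

Lemma meas_addv dd (T : measurableType dd) (f g : T -> bor R d) :
  mfun f -> mfun g ->
  mfun (fun t => f t + g t : bor R d).
Proof.
move=> mf mg; apply: measurable_to_bor => i.
rewrite (_ : (fun t => _) = (fun t => f t ord0 i + g t ord0 i)); last first.
  by apply/funext => t; rewrite !mxE.
by apply: measurable_funD; exact: meas_coordf.
Qed.

Lemma meas_cos : mfun (@cos R).
Proof. by apply: continuous_measurable_fun; exact: continuous_cos. Qed.

Lemma meas_sin : mfun (@sin R).
Proof. by apply: continuous_measurable_fun; exact: continuous_sin. Qed.

Lemma dotpDl x y xi : dotp (x + y) xi = dotp x xi + dotp y xi.
Proof. by rewrite /dotp -big_split/=; apply: eq_bigr => i _; rewrite mxE mulrDl. Qed.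

Lemma dotpZl a x xi : dotp (a *: x) xi = a * dotp x xi.
Proof. by rewrite /dotp mulr_sumr; apply: eq_bigr => i _; rewrite mxE mulrA. Qed.

Lemma dotpC x xi : dotp x xi = dotp xi x.
Proof. by rewrite /dotp; apply: eq_bigr => i _; rewrite mulrC. Qed.

Lemma dotpZr a x xi : dotp x (a *: xi) = a * dotp x xi.
Proof. by rewrite dotpC dotpZl dotpC. Qed.

Lemma dotpNl x xi : dotp (- x) xi = - dotp x xi.
Proof. by rewrite -scaleN1r dotpZl mulN1r. Qed.

Lemma dotp0l xi : dotp 0 xi = 0.
Proof. by rewrite -(scale0r (0 : 'rV[R]_d)) dotpZl mul0r. Qed.

(* [fc] is [fourier_re] and [fs] is the opposite of [fourier_im]. *)
Definition fc f xi : R := \int[mu]_x (cos (dotp x xi) * f x).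
Definition fs f xi : R := \int[mu]_x (sin (dotp x xi) * f x).

Lemma normr_cos (t : R) : `|cos t| <= 1.
Proof. by rewrite ler_norml cos_geN1 cos_le1. Qed.

Lemma normr_sin (t : R) : `|sin t| <= 1.
Proof. by rewrite ler_norml sin_geN1 sin_le1. Qed.

Lemma meas_cosdot xi : mfun (fun x : bor R d => cos (dotp x xi)).
Proof. by apply: (measurableT_comp meas_cos); exact: meas_dotp. Qed.

Lemma meas_sindot xi : mfun (fun x : bor R d => sin (dotp x xi)).
Proof. by apply: (measurableT_comp meas_sin); exact: meas_dotp. Qed.

Lemma intg_cos f xi : intg mu f -> intg mu (fun x => cos (dotp x xi) * f x).
Proof.
apply: (intg_mulb (M := 1)); first exact: meas_cosdot.
by move=> x; exact: normr_cos.
Qed.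

Lemma intg_sin f xi : intg mu f -> intg mu (fun x => sin (dotp x xi) * f x).
Proof.
apply: (intg_mulb (M := 1)); first exact: meas_sindot.
by move=> x; exact: normr_sin.
Qed.

Lemma fourier_reE f xi : intg mu f -> fourier_re f xi = fc f xi.
Proof. by move=> fi; rewrite /fourier_re rintE//; exact: intg_cos. Qed.

Lemma fourier_imE f xi : intg mu f -> fourier_im f xi = - fs f xi.
Proof. by move=> fi; rewrite /fourier_im rintE//; exact: intg_sin. Qed.

Lemma fc_le f xi : intg mu f -> `|fc f xi| <= \int[mu]_x `|f x|.
Proof.
move=> fi; apply: Rint_normb; [exact: intg_cos|exact: intg_abs|move=> x].
by rewrite normrM ler_piMl// normr_cos.
Qed.

Lemma fs_le f xi : intg mu f -> `|fs f xi| <= \int[mu]_x `|f x|.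
Proof.
move=> fi; apply: Rint_normb; [exact: intg_sin|exact: intg_abs|move=> x].
by rewrite normrM ler_piMl// normr_sin.
Qed.

Lemma fc0 f : fc f 0 = \int[mu]_x f x.
Proof.
by apply: Rint_eq => x; rewrite dotpC dotp0l cos0 mul1r.
Qed.

Lemma fs0 f : fs f 0 = 0.
Proof.
rewrite /fs (_ : (fun x => _) = cst 0) ?Rintegral_cst ?mul0r//.
by apply/funext => x; rewrite dotpC dotp0l sin0 mul0r.
Qed.

Definition pdens f := [/\ intg mu f, (forall x, 0 <= f x) & \int[mu]_x f x = 1].

Lemma prob_densityP f : prob_density f <-> pdens f.
Proof.
split=> [[mf [f0 f1]]|[fi f0 f1]].
  have mf' := (borel_funP f).1 mf.
  have fi : intg mu f by apply/intg_ge0P => //; rewrite -iint_EFin// f1 ltry.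
  split=> //; have := Rint_fin fi.
  by rewrite -iint_EFin// f1 => -[].
have mf : borel_fun f by apply/borel_funP; exact: intg_meas fi.
by split=> //; split=> //; rewrite iint_EFin// -(Rint_fin fi) f1.
Qed.

Lemma Rint_affine a b f : a != 0 -> intg mu f ->
  intg mu (fun x => f (a *: x + b)) /\
  \int[mu]_x f x = `|a| ^+ d * \int[mu]_x f (a *: x + b).
Proof. exact: II_affine. Qed.

Lemma Rint_shift b f : intg mu f ->
  intg mu (fun x => f (x + b)) /\ \int[mu]_x f (x + b) = \int[mu]_x f x.
Proof.
move=> fi; have [h1 h2] := @Rint_affine 1 b f (oner_neq0 R) fi.
split; first by apply: (intg_eq _ h1) => x; rewrite scale1r.
by rewrite h2 normr1 expr1n mul1r; apply: Rint_eq => x; rewrite scale1r.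
Qed.

Lemma rescale_FT J eps : 0 < eps -> intg mu J ->
  [/\ intg mu (rescale J eps), forall xi, fc (rescale J eps) xi = fc J (eps *: xi),
    forall xi, fs (rescale J eps) xi = fs J (eps *: xi) &
    \int[mu]_x rescale J eps x = \int[mu]_x J x].
Proof.
move=> e0 Ji.
have en0 : eps^-1 != 0 by rewrite invr_neq0// gt_eqF.
have A (h : R -> R) xi : intg mu (fun x => h (dotp x (eps *: xi)) * J x) ->
   \int[mu]_x (h (dotp x xi) * rescale J eps x) =
   \int[mu]_x (h (dotp x (eps *: xi)) * J x).
  move=> hi; have [h1 ->] := Rint_affine 0 en0 hi.
  rewrite -RintZ//; apply: Rint_eq => x.
  rewrite /rescale addr0 dotpZl dotpZr [eps^-1 * _]mulrA mulVf ?gt_eqF// mul1r.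
  by rewrite ger0_norm ?invr_ge0 ?ltW// exprVn mulrCA.
have [h1 h2] := Rint_affine 0 en0 Ji.
split.
- apply: (intg_eq _ (intgZ (eps ^- d) h1)) => x.
  by rewrite addr0.
- by move=> xi; apply: (A cos); exact: intg_cos.
- by move=> xi; apply: (A sin); exact: intg_sin.
- rewrite h2 -RintZ//; apply: Rint_eq => x.
  by rewrite addr0 ger0_norm ?invr_ge0 ?ltW// exprVn.
Qed.

Lemma rescale_pdens J eps : 0 < eps -> pdens J -> pdens (rescale J eps).
Proof.
move=> e0 [Ji J0 J1]; have [h1 _ _ h2] := rescale_FT e0 Ji.
split=> //; last by rewrite h2.
by move=> x; rewrite mulr_ge0// invr_ge0 exprn_ge0// ltW.
Qed.

(** By Tonelli, integrating in [x] first: translation invariance makes the inner integral a constant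
    multiple of [|u y|]. *)
Lemma intg_conv_kernel J u : intg mu J -> intg mu u ->
  intg (mu \x mu)%E (fun p => J (p.1 - p.2) * u p.2).
Proof.
move=> Ji ui.
have mJ : mfun (fun p : bor R d * bor R d => J (p.1 - p.2)).
  by apply: (measurableT_comp (intg_meas Ji)); exact: meas_subv.
have mF : mfun (fun p : bor R d * bor R d => J (p.1 - p.2) * u p.2).
  by apply: measurable_funM => //; exact: (measurableT_comp (intg_meas ui)).
apply/integrable21ltyP; first exact/measurable_EFinP.
have uai := intg_abs ui.
rewrite (_ : (fun y => _) = (fun y => (\int[mu]_x `|J x| * `|u y|)%:E)).
  have := intgZ (\int[mu]_x `|J x|) uai; move/integrableP => [_].
  apply: le_lt_trans; apply: ge0_le_integral => //.
  - by move=> y _; rewrite lee_fin mulr_ge0// Rint_ge0.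
  - apply/measurable_EFinP; apply: measurable_funM => //.
    exact: intg_meas uai.
  - apply: measurableT_comp => //; apply/measurable_EFinP; apply: measurable_funM => //.
    exact: intg_meas uai.
  - by move=> y _; rewrite lee_fin/= ler_norm.
apply/funext => y.
have [h1 h2] := Rint_shift (- y) (intg_abs Ji).
rewrite -h2 EFinM (Rint_fin h1) -ge0_integralZr//.
- by apply: eq_integral => x _; rewrite /= normrM EFinM.
- by apply/measurable_EFinP; exact: intg_meas h1.
Qed.

Lemma convE J u x : intg mu J -> intg mu u -> (forall x, 0 <= J x) ->
  (forall x, 0 <= u x) -> Defs.conv J u x = \int[mu]_y (J (x - y) * u y).
Proof.
move=> Ji ui J0 u0; rewrite /Defs.conv iint_EFin//; last by move=> y; rewrite mulr_ge0.
apply/borel_funP; apply: measurable_funM; last exact: intg_meas ui.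
by apply: (measurableT_comp (intg_meas Ji)); exact: meas_subv.
Qed.

(** Moves a bounded function through the convolution; [h] constant gives the total mass, [h] a
    cosine or a sine gives the transforms. *)
Lemma conv_int J u (h : bor R d -> R) M : intg mu J -> intg mu u ->
  (forall x, 0 <= J x) -> (forall x, 0 <= u x) ->
  mfun h -> (forall x, `|h x| <= M) ->
  \int[mu]_x (h x * Defs.conv J u x) = \int[mu]_y ((\int[mu]_z (h (z + y) * J z)) * u y) /\
  intg mu (Defs.conv J u).
Proof.
move=> Ji ui J0 u0 mh hM.
have Ki := intg_conv_kernel Ji ui.
have hKi : intg (mu \x mu)%E (fun p => h p.1 * (J (p.1 - p.2) * u p.2)).
  apply: (intg_mulb (M := M)) => //; first exact: (measurableT_comp mh).
have [I1 _ _] := RFubini Ki.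
have Ci : intg mu (Defs.conv J u).
  by apply: (intg_eq _ I1) => x; rewrite convE.
split=> //.
have [_ _ E] := RFubini hKi.
transitivity (\int[mu]_x \int[mu]_y (h x * (J (x - y) * u y))); last first.
  rewrite E; apply: Rint_eq => y /=.
  have hJ : intg mu (fun z => h (z + y) * J z).
    apply: (intg_mulb (M := M)) => //.
    by apply: (measurableT_comp mh); exact: meas_addv.
  have [h1 h2] := Rint_shift (- y) hJ.
  rewrite -h2 -RintegralZr//; apply: Rint_eq => x.
  by rewrite subrK mulrA.
(* At points where the convolution integral is infinite, both sides take the default value 0. *)
apply: Rint_eq => x; rewrite (convE x Ji ui J0 u0) RintZ_ge0 => [//||].
- apply: measurable_funM; last exact: intg_meas ui.
  by apply: (measurableT_comp (intg_meas Ji)); exact: meas_subv.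
- by move=> y; rewrite mulr_ge0.
Qed.

Lemma conv_pdens J u : pdens J -> pdens u -> pdens (Defs.conv J u).
Proof.
move=> [Ji J0 J1] [ui u0 u1].
have [|h1 h2] := @conv_int J u (fun=> 1) 1 Ji ui J0 u0 (measurable_cst _).
  by move=> x; rewrite normr1.
split=> //.
  by move=> x; rewrite convE// Rint_ge0// => y; rewrite mulr_ge0.
rewrite (@Rint_eq _ _ _ _ _ (fun x : bor R d => 1 * Defs.conv J u x)); last by move=> x; rewrite mul1r.
rewrite h1 -[RHS]u1; apply: Rint_eq => y.
by rewrite (@Rint_eq _ _ _ _ _ (J : bor R d -> R)) ?J1 ?mul1r// => z; rewrite mul1r.
Qed.

Lemma conv_FT J u xi : pdens J -> pdens u ->
  fc (Defs.conv J u) xi = fc J xi * fc u xi - fs J xi * fs u xi /\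
  fs (Defs.conv J u) xi = fs J xi * fc u xi + fc J xi * fs u xi.
Proof.
move=> [Ji J0 J1] [ui u0 u1].
split.
  have [|h1 _] := @conv_int J u (fun x => cos (dotp x xi)) 1 Ji ui J0 u0 (@meas_cosdot xi).
    by move=> x; exact: normr_cos.
  rewrite /fc h1 -!RintZ; [|exact: intg_sin|exact: intg_cos].
  rewrite -RintB; [|exact/intgZ/intg_cos|exact/intgZ/intg_sin].
  apply: Rint_eq => y.
  rewrite (@Rint_eq _ _ _ _ _ (fun z : bor R d => cos (dotp y xi) * (cos (dotp z xi) * J z) - 
      sin (dotp y xi) * (sin (dotp z xi) * J z))); last first.
    by move=> z; rewrite dotpDl cosD; ring.
  rewrite RintB; [|exact/intgZ/intg_cos|exact/intgZ/intg_sin].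
  rewrite !RintZ; [|exact: intg_sin|exact: intg_cos].
  by rewrite /fc /fs; ring.
have [|h1 _] := @conv_int J u (fun x => sin (dotp x xi)) 1 Ji ui J0 u0 (@meas_sindot xi).
  by move=> x; exact: normr_sin.
rewrite [fs (Defs.conv J u) xi]/fs h1 [fc u xi]/fc [fs u xi]/fs -!RintZ; [|exact: intg_sin|exact: intg_cos].
rewrite -RintD; [|exact/intgZ/intg_cos|exact/intgZ/intg_sin].
apply: Rint_eq => y.
rewrite (@Rint_eq _ _ _ _ _ (fun z : bor R d => cos (dotp y xi) * (sin (dotp z xi) * J z) + 
    sin (dotp y xi) * (cos (dotp z xi) * J z))); last first.
  by move=> z; rewrite dotpDl sinD; ring.
rewrite RintD; [|exact/intgZ/intg_sin|exact/intgZ/intg_cos].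
rewrite !RintZ; [|exact: intg_cos|exact: intg_sin].
by rewrite /fc /fs; ring.
Qed.

End FT.

(** * One-variable calculus: Taylor remainders, averaged waves and a cutoff *)

Section Calc.
Variable R : realType.
Implicit Types f g : R -> R.

Definition der f (x l : R) := is_derive x (1 : R) f l.

Lemma der_eq f x l l' : der f x l -> l = l' -> der f x l'.
Proof. by move=> ? <-. Qed.

Lemma derC (c x : R) : der (fun=> c) x 0.
Proof. exact: is_derive_cst. Qed.

Lemma der_id (x : R) : der (fun y => y) x 1.
Proof. exact: is_derive_id. Qed.

Lemma derD f g x a b : der f x a -> der g x b -> der (fun y => f y + g y) x (a + b).
Proof. by move=> ? ?; exact: (@is_deriveD _ _ _ f g). Qed.

Lemma derN f x a : der f x a -> der (fun y => - f y) x (- a).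
Proof. by move=> ?; exact: (@is_deriveN _ _ _ f). Qed.

Lemma derB f g x a b : der f x a -> der g x b -> der (fun y => f y - g y) x (a - b).
Proof. by move=> ? ?; exact: (@is_deriveB _ _ _ f g). Qed.

Lemma derM f g x a b : der f x a -> der g x b ->
  der (fun y => f y * g y) x (a * g x + f x * b).
Proof.
move=> fa gb; apply: der_eq (@is_deriveM _ _ f g x 1 a b fa gb) _.
by rewrite addrC [a * _]mulrC.
Qed.

Lemma derZ c f x a : der f x a -> der (fun y => c * f y) x (c * a).
Proof.
by move=> fa; apply: der_eq (derM (derC c x) fa) _; rewrite mul0r add0r.
Qed.

Lemma derX n f x a : der f x a -> der (fun y => f y ^+ n) x (n%:R * f x ^+ n.-1 * a).
Proof.
move=> fa; elim: n => [|n IH].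
  by apply: der_eq (derC 1 x) _; rewrite !mul0r.
rewrite (_ : (fun y => _) = (fun y => f y * f y ^+ n)); last by apply/funext => y; rewrite exprS.
apply: der_eq (derM fa IH) _ => /=; case: n {IH} => [|n] /=; first by rewrite !expr0; ring.
by rewrite -[in RHS]natr1 exprS; ring.
Qed.

Lemma der_comp f g x a b : der f (g x) a -> der g x b -> der (fun y => f (g y)) x (a * b).
Proof.
by move=> fa gb; exact: is_derive1_comp fa gb.
Qed.

Lemma derV f x a : f x != 0 -> der f x a -> der (fun y => (f y)^-1) x (- (f x) ^- 2 * a).
Proof. by move=> f0 fa; exact: (is_deriveV f0). Qed.

Lemma der_cos (x : R) : der cos x (- sin x).
Proof. exact: is_derive_cos. Qed.

Lemma der_sin (x : R) : der sin x (cos x).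
Proof. exact: is_derive_sin. Qed.

Lemma der_exp (x : R) : der expR x (expR x).
Proof. exact: is_derive_expR. Qed.

Lemma der_near f g x a : (\forall y \near x, f y = g y) -> der f x a -> der g x a.
Proof. by move=> fg fa; apply: near_eq_is_derive fa. Qed.

Lemma der_cont f x a : der f x a -> {for x, continuous f}.
Proof.
by move=> [df _]; apply/differentiable_continuous/derivable1_diffP.
Qed.

Lemma der_itv_mvt f f' a b : a < b -> (forall x, a <= x <= b -> der f x (f' x)) ->
  exists2 c, a < c < b & f b - f a = f' c * (b - a).
Proof.
move=> ab df; have [| |c ci E] := @MVT R f f' a b ab.
- by move=> x; rewrite in_itv/= => /andP[h1 h2]; apply: df; rewrite !ltW.
- apply: derivable_within_continuous => x; rewrite in_itv/= => /df.
  by case.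
by exists c => //; move: ci; rewrite in_itv/=.
Qed.

Lemma der_nonincr f f' a b : a <= b -> (forall x, a <= x <= b -> der f x (f' x)) ->
  (forall x, a < x < b -> f' x <= 0) -> f b <= f a.
Proof.
move=> ab df f'0; have [->//|ne] := eqVneq a b.
have {}ab : a < b by rewrite lt_neqAle ne ab.
have [c ci E] := der_itv_mvt ab df.
by rewrite -subr_le0 E mulr_le0_ge0 ?f'0 ?subr_ge0 ?ltW.
Qed.

(** The mean value theorem gains one power of [|x|] at the same constant. Iterated below, it yields
    Taylor remainders of sine and cosine valid on the whole line; their constants are not sharp. *)
Lemma der_bound n f f' C : (forall x, der f x (f' x)) -> f 0 = 0 ->
  (forall x, `|f' x| <= C * `|x| ^+ n) -> forall x, `|f x| <= C * `|x| ^+ n.+1.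
Proof.
move=> df f0 f'C x.
have C0 : 0 <= C by have := f'C 1; rewrite normr1 expr1n mulr1; apply: le_trans.
have K c : `|c| <= `|x| -> `|f' c * x| <= C * `|x| ^+ n.+1.
  move=> cx; rewrite normrM exprSr mulrA ler_wpM2r// (le_trans (f'C c))//.
  by rewrite ler_wpM2l// lerXn2r// nnegrE.
have [x0|x0|->] := ltgtP x 0.
- have [c /andP[c1 c2] E] := der_itv_mvt x0 (fun y _ => df y).
  rewrite -normrN -[- f x]add0r -{1}f0 E sub0r mulrN normrN K//.
  by rewrite !ltr0_norm//; lra.
- have [c /andP[c1 c2] E] := der_itv_mvt x0 (fun y _ => df y).
  rewrite -[f x]subr0 -{1}f0 E subr0 K//.
  by rewrite !gtr0_norm//; lra.
- by rewrite f0 normr0 expr0n/= mulr0.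
Qed.

(** Gives derivatives at the two delicate points: the removable singularity of a quotient and the
    kink of a positive part. *)
Lemma der_quad f x l C : (forall y, `|y| <= 1 -> `|f (x + y) - f x - l * y| <= C * y ^+ 2) -> der f x l.
Proof.
move=> H.
have C0 : 0 <= C.
  have := H 1; rewrite normr1 expr1n [C * 1]mulr1 => /(_ (lexx _)) h.
  exact: le_trans (normr_ge0 _) h.
have cv : h^-1 *: (f (h *: (1 : R) + x) - f x) @[h --> 0^'] --> (l : R).
  apply/cvgrPdist_le => /= e e0.
  have d0 : 0 < Num.min 1 (e / (C + 1)).
    by rewrite lt_min ltr01 divr_gt0//; lra.
  near=> h.
  have hd : `|h| < Num.min 1 (e / (C + 1)).
    near: h; apply: dnbhs0_lt; exact: d0.
  have h0 : h != 0 by near: h; exact: nbhs_dnbhs_neq.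
  move: hd; rewrite lt_min => /andP[h1 h2].
  rewrite (_ : l - _ = - (f (x + h) - f x - l * h) / h); last first.
    by rewrite /GRing.scale/= mulr1 [h + x]addrC; field.
  rewrite normrM normrN normfV ler_pdivrMr ?normr_gt0//.
  apply: le_trans (H h (ltW h1)) _.
  rewrite -real_normK ?num_real// expr2 mulrA ler_wpM2r//.
  move: h2; rewrite ltr_pdivlMr; last by lra.
  have := normr_ge0 h; nra.
split; first by apply/cvg_ex; exists l.
exact: (cvg_lim (@Rhausdorff R) cv).
Unshelve. all: by end_near. Qed.

Lemma cos_quad (v : R) : `|1 - cos v| <= 1 * `|v| ^+ 2.
Proof.
have sinb : forall x : R, `|sin x| <= 1 * `|x| ^+ 1.
  apply: (der_bound der_sin) => [|x]; first exact: sin0.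
  by rewrite expr0 mulr1 ler_norml cos_geN1 cos_le1.
apply: (@der_bound 1 (fun v => 1 - cos v) sin) => [x||//].
  by apply: der_eq (derB (derC 1 x) (der_cos x)) _; rewrite sub0r opprK.
by rewrite cos0 subrr.
Qed.

Lemma sin_lin (x : R) : `|sin x| <= `|x|.
Proof.
have : `|sin x| <= 1 * `|x| ^+ 1.
  apply: (der_bound der_sin) => [|y]; first exact: sin0.
  by rewrite expr0 mulr1 ler_norml cos_geN1 cos_le1.
by rewrite mul1r expr1.
Qed.

Lemma sin_cub (v : R) : `|sin v - v| <= 1 * `|v| ^+ 3.
Proof.
apply: (@der_bound 2 (fun v => sin v - v) (fun v => cos v - 1)) => [x||x].
- exact: derB (der_sin x) (der_id x).
- by rewrite sin0 subrr.
- by rewrite distrC cos_quad.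
Qed.

Lemma sin_quad (v : R) : `|sin v - v| <= 2 * `|v| ^+ 2.
Proof.
have [v1|v1] := leP `|v| 1.
  apply: le_trans (sin_cub v) _; have := normr_ge0 v; nra.
apply: le_trans (ler_normB _ _) _; have := sin_lin v; nra.
Qed.

Lemma cos_cub (v : R) : `|1 - cos v - v ^+ 2 / 2| <= 2 * `|v| ^+ 3.
Proof.
apply: (@der_bound 2 (fun v => 1 - cos v - v ^+ 2 / 2) (fun v => sin v - v)) => [x||x].
- apply: der_eq (derB (derB (derC 1 x) (der_cos x)) (derM (derX 2 (der_id x)) (derC (2^-1) x))) _.
  by rewrite /= expr1; field.
- by rewrite cos0 expr0n/= mul0r !subrr.
- exact: sin_quad.
Qed.

Lemma near_neq0 (u : R) : u != 0 -> \forall y \near u, y != 0.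
Proof.
move=> u0; apply/nbhs_ballP; exists `|u| => /=; first by rewrite normr_gt0.
move=> y; rewrite /ball/= => uy; apply/eqP => y0.
by move: uy; rewrite y0 subr0 ltxx.
Qed.

Section quot.
Variables (h h' h'' : R -> R) (a b C : R).
Hypothesis dh : forall u, der h u (h' u).
Hypothesis dh' : forall u, der h' u (h'' u).
Hypothesis h'b : forall u, `|h' u - a - b * u| <= C * `|u| ^+ 2.
Hypothesis hb : forall u, `|h u - a * u - b / 2 * u ^+ 2| <= C * `|u| ^+ 3.

(** A quotient [h u / u] with its singularity removed; the values at 0 are Taylor coefficients of
    [h]. *)
Definition qg u := if u == 0 then a else h u / u.
Definition qg' u := if u == 0 then b / 2 else (u * h' u - h u) / u ^+ 2.

Lemma der_qg u : der qg u (qg' u).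
Proof.
rewrite /qg'; case: eqVneq => [->|u0].
  apply: (@der_quad _ _ _ C) => y _; rewrite add0r /qg eqxx.
  case: eqVneq => [->|y0]; first by rewrite subrr mulr0 subrr normr0 expr0n/= mulr0.
  rewrite (_ : _ - _ = (h y - a * y - b / 2 * y ^+ 2) / y); last by field.
  rewrite normrM normfV ler_pdivrMr ?normr_gt0// (le_trans (hb y))//.
  by rewrite exprSr mulrA real_normK ?num_real.
apply: (@der_near (fun y => h y * y^-1)).
  have := near_neq0 u0; apply: filterS => y y0.
  by rewrite /qg (negbTE y0).
apply: der_eq (derM (dh u) (derV u0 (der_id u))) _.
by field.
Qed.

(** Away from 0 the formula is differentiable; at 0 the two Taylor remainders, of order [|u|^3]
    after multiplication of the first by [u], are divided by [u^2]. *)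
Lemma cont_qg' : continuous qg'.
Proof.
move=> u; have [->|u0] := eqVneq u 0.
  apply/cvgrPdist_le => /= e e0.
  have C0 : 0 <= C.
    have := le_trans (normr_ge0 _) (h'b 1); rewrite normr1 expr1n; lra.
  have d0 : 0 < e / (2 * C + 1) by rewrite divr_gt0//; lra.
  apply/nbhs_ballP; exists (e / (2 * C + 1)) => // y.
  rewrite /ball/= sub0r normrN => yd.
  rewrite /qg' eqxx; case: eqVneq => [_|y0]; first by rewrite subrr normr0 ltW.
  rewrite distrC.
  rewrite (_ : _ - _ = (y * (h' y - a - b * y) - (h y - a * y - b / 2 * y ^+ 2)) / y ^+ 2);
    last by field.
  rewrite normrM normfV normrX ler_pdivrMr ?exprn_gt0 ?normr_gt0//.
  apply: le_trans (ler_normB _ _) _; rewrite normrM.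
  have h1 : `|y| * `|h' y - a - b * y| <= C * `|y| ^+ 3.
    by rewrite exprS mulrCA ler_wpM2l.
  apply: le_trans (lerD h1 (hb y)) _.
  rewrite exprS -mulrDr -mulrDl mulrA ler_wpM2r ?exprn_ge0//.
  move: yd; rewrite ltr_pdivlMr; last by lra.
  have := normr_ge0 y; nra.
have D : der qg' u ((1 * h' u + u * h'' u - h' u) * (u ^+ 2)^-1 +
     (u * h' u - h u) * (- (u ^+ 2) ^- 2 * (2%:R * u ^+ 1 * 1))).
  apply: (@der_near (fun y => (y * h' y - h y) * (y ^+ 2)^-1)).
    have := near_neq0 u0; apply: filterS => y y0.
    by rewrite /qg' (negbTE y0).
  apply: derM; first by apply: derB (dh u); apply: derM (dh' u); exact: der_id.
  by apply: derV; [rewrite expf_neq0|apply: (derX 2); exact: der_id].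
exact: der_cont D.
Qed.

Lemma qg_mul u : u * qg' u = h' u - qg u.
Proof.
rewrite /qg' /qg; case: eqVneq => [->|u0].
  have := h'b 0; rewrite normr0 expr0n/= !mulr0 subr0 normr_le0 => /eqP.
  by move=> /subr0_eq ->; rewrite mul0r subrr.
by field.
Qed.

End quot.

(* The smooth extension of [(sin (T u - th) + sin th) / u], that is of
   [u |-> int_0^T cos (r u - th) dr]. *)
Definition phasef th T := qg (fun u => sin (T * u - th) + sin th) (T * cos th).

Lemma der_phase th T u : der (fun u => T * u - th) u T.
Proof. by apply: der_eq (derB (derZ T (der_id u)) (derC th u)) _; ring. Qed.

(** The last clause is the purpose of averaging: its right-hand side is bounded by [2 T], so
    [u * g' u] is bounded although the derivative of a plane wave times [u] is not. *)
Lemma phasefP th (T : R) : 0 < T -> exists g', [/\ forall u, der (phasef th T) u (g' u),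
  continuous g' & forall u, u * g' u = T * cos (T * u - th) - phasef th T u].
Proof.
move=> T0.
pose h u := sin (T * u - th) + sin th.
pose h' u := T * cos (T * u - th); pose h'' u := - T ^+ 2 * sin (T * u - th).
have d1 u : der h u (h' u).
  by apply: der_eq (derD (der_comp (der_sin _) (der_phase th T u)) (derC _ u)) _; rewrite /h'; ring.
have d2 u : der h' u (h'' u).
  by apply: der_eq (derZ T (der_comp (der_cos _) (der_phase th T u))) _; rewrite /h''; ring.
have cs v w C : 0 <= C -> `|v| <= C -> `|w| <= 2 * C -> `|cos th * v + sin th * w| <= 3 * C.
  move=> C0 hv hw; rewrite (_ : 3 * C = C + 2 * C); last by ring.
  apply: le_trans (ler_normD _ _) (lerD _ _); rewrite normrM.
    by apply: le_trans hv; rewrite ler_piMl// ler_norml cos_geN1 cos_le1.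
  by apply: le_trans hw; rewrite ler_piMl// ler_norml sin_geN1 sin_le1.
have nT u : `|T * u| = T * `|u| by rewrite normrM gtr0_norm.
have b1 u : `|h' u - T * cos th - T ^+ 2 * sin th * u| <= 3 * T ^+ 3 * `|u| ^+ 2.
  (* The addition formula separates [th] and leaves Taylor remainders at [T * u], bounded uniformly
     in [th]. *)
  rewrite (_ : _ - _ = T * (cos th * - (1 - cos (T * u)) + sin th * (sin (T * u) - T * u))); last first.
    by rewrite /h' cosB; ring.
  rewrite normrM gtr0_norm// (_ : 3 * _ * _ = T * (3 * `|T * u| ^+ 2)); last by rewrite nT; ring.
  apply: ler_wpM2l; first exact: ltW.
  by apply: cs; [exact: sqr_ge0|rewrite normrN -[leRHS]mul1r cos_quad|exact: sin_quad].
have b2 u : `|h u - T * cos th * u - T ^+ 2 * sin th / 2 * u ^+ 2| <= 3 * T ^+ 3 * `|u| ^+ 3.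
  rewrite (_ : _ - _ = cos th * (sin (T * u) - T * u) + sin th * (1 - cos (T * u) - (T * u) ^+ 2 / 2)); last first.
    by rewrite /h sinB; field.
  rewrite (_ : 3 * _ * _ = 3 * `|T * u| ^+ 3); last by rewrite nT; ring.
  by apply: cs; [exact: exprn_ge0|rewrite -[leRHS]mul1r sin_cub|exact: cos_cub].
exists (qg' h h' (T ^+ 2 * sin th)); split; [exact: der_qg d1 b2|exact: cont_qg' d1 d2 b1 b2|].
by move=> u; rewrite (@qg_mul _ _ (T * cos th) (T ^+ 2 * sin th) (3 * T ^+ 3)).
Qed.

Lemma phasef_bound th T u : 0 < T -> `|phasef th T u| <= T.
Proof.
move=> T0; rewrite /phasef /qg; case: eqVneq => [_|u0].
  rewrite normrM gtr0_norm//; apply: ler_piMr; first exact: ltW.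
  by rewrite ler_norml cos_geN1 cos_le1.
rewrite normrM normfV ler_pdivrMr ?normr_gt0// (_ : T * `|u| = `|T * u|); last by rewrite normrM gtr0_norm.
have : `|sin (T * u - th) + sin th| <= 1 * `|T * u| ^+ 1.
  apply: (@der_bound 0 (fun v => sin (v - th) + sin th) (fun v => cos (v - th))) => [x||x].
  - by apply: der_eq (derD (der_comp (der_sin _) (derB (der_id x) (derC th x))) (derC _ x)) _; ring.
  - by rewrite sub0r sinN addNr.
  - by rewrite expr0 mulr1 ler_norml cos_geN1 cos_le1.
by rewrite mul1r expr1.
Qed.

Definition ppart (t : R) := Num.max t 0.

(** The square makes the cutoff continuously differentiable, which is the regularity that [test_fun]
    demands. *)
Definition etaf (t : R) := ppart (1 - t) ^+ 2.

Lemma ppartE t : ppart t = (t + `|t|) / 2.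
Proof. by rewrite /ppart; case: ger0P => t0; lra. Qed.

Lemma der_etaf t : der etaf t (- 2 * ppart (1 - t)).
Proof.
apply: (@der_quad _ _ _ 1) => y _; rewrite mul1r /etaf !ppartE.
by case: (ger0P (1 - t)) => h1; case: (ger0P (1 - (t + y))) => h2; rewrite ler_norml; nra.
Qed.

Lemma cont_ppart1 : continuous (fun t : R => ppart (1 - t)).
Proof.
move=> t; rewrite (_ : (fun t => _) = (fun t => (1 - t + `|1 - t|) * 2^-1)); last first.
  by apply/funext => x; rewrite ppartE.
have h : continuous_at t (fun t : R => 1 - t) by apply: cvgB; [exact: cvg_cst|exact: cvg_id].
apply: cvgM; last exact: cvg_cst.
by apply: cvgD; [exact: h|apply: cvg_norm; exact: h].
Qed.

End Calc.

(** * Admissible test functions obtained by truncating functions of one linear form *)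

Section TestFun.
Variable R : realType.
Variable d : nat.
Implicit Types (x v w : 'rV[R]_d).

Lemma diff_coord (i : 'I_d) x : is_diff x (fun y : 'rV[R]_d => y ord0 i) (fun v => v ord0 i).
Proof.
have H : linear (fun y : 'rV[R]_d => y ord0 i : R^o) by move=> a u v; rewrite !mxE.
pose L : {linear 'rV[R]_d -> R^o} := HB.pack (fun y : 'rV[R]_d => y ord0 i : R^o)
  (GRing.isLinear.Build _ _ _ _ _ H).
have cL : continuous L by exact: coord_continuous.
split; first exact: (@linear_differentiable _ _ _ L).
exact: (@diff_lin _ _ _ L x).
Qed.

Lemma diff_ext (f g df dg : 'rV[R]_d -> R) x :
  is_diff x f df -> f =1 g -> df =1 dg -> is_diff x g dg.
Proof. by move=> H /funext <- /funext <-. Qed.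

Lemma contC (k : R) : continuous (fun _ : 'rV[R]_d => k).
Proof. by move=> x; exact: cst_continuous. Qed.

Lemma contM (f g : 'rV[R]_d -> R) : continuous f -> continuous g ->
  continuous (fun x => f x * g x).
Proof. by move=> cf cg x; exact: (cvgM (cf x) (cg x)). Qed.

Lemma contD (f g : 'rV[R]_d -> R) : continuous f -> continuous g ->
  continuous (fun x => f x + g x).
Proof. by move=> cf cg x; exact: (cvgD (cf x) (cg x)). Qed.

Lemma diff_sum n (f df : 'I_n -> 'rV[R]_d -> R) x :
  (forall i, is_diff x (f i) (df i)) ->
  is_diff x (fun y => \sum_(i < n) f i y) (fun v => \sum_(i < n) df i v).
Proof.
elim: n f df => [|n IH] f df H.
  rewrite (_ : (fun y => _) = cst 0); last by apply/funext => y; rewrite big_ord0.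
  rewrite (_ : (fun v => _) = 0); first exact: is_diff_cst.
  by apply/funext => y; rewrite big_ord0.
have H1 := IH (fun i => f (lift ord0 i)) (fun i => df (lift ord0 i)) (fun i => H _).
by apply: diff_ext (is_diffD (H ord0) H1) _ _ => y; rewrite big_ord_recl.
Qed.

Lemma diff_mul (f g df dg : 'rV[R]_d -> R) x : is_diff x f df -> is_diff x g dg ->
  is_diff x (fun y => f y * g y) (fun v => f x * dg v + g x * df v).
Proof. by move=> fx gx; exact: (@is_diffM _ _ f g df dg x). Qed.

Lemma diff_dotp w x : is_diff x (fun y => dotp y w) (fun v => dotp v w).
Proof.
apply: diff_sum => i.
apply: diff_ext (diff_mul (diff_coord i x) (@is_diff_cst R _ _ (w ord0 i : R) x)) _ _ => // v.
by rewrite /= mulr0 add0r mulrC.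
Qed.

Lemma diff_sq x : is_diff x (fun y => dotp y y) (fun v => 2 * dotp x v).
Proof.
apply: diff_ext (@diff_sum d (fun i y => y ord0 i * y ord0 i) _ x
   (fun i => diff_mul (diff_coord i x) (diff_coord i x))) _ _ => // v.
by rewrite /dotp mulr_sumr; apply: eq_bigr => i _; ring.
Qed.

Lemma diff_comp1 (g : R -> R) l (f df : 'rV[R]_d -> R) x : is_diff x f df ->
  der g (f x) l -> is_diff x (fun y => g (f y)) (fun v => df v * l).
Proof.
move=> fx gx; have [gd gv] := gx.
have gdiff : is_diff (f x) g (fun h => h * l).
  split; first exact/derivable1_diffP.
  by rewrite deriv1E//; apply/funext => h; rewrite derive1E gv.
exact: (is_diff_comp fx gdiff).
Qed.

Lemma dotp_ge0 x : 0 <= dotp x x.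
Proof. by apply: sumr_ge0 => i _; rewrite -expr2 sqr_ge0. Qed.

Lemma enorm_sq x : enorm x ^+ 2 = dotp x x.
Proof. by rewrite /enorm sqr_sqrtr// dotp_ge0. Qed.

Lemma cont_dotp w : continuous (fun x : 'rV[R]_d => dotp x w).
Proof. by move=> x; have [h _] := diff_dotp w x; exact: differentiable_continuous. Qed.

Lemma cont_sq : continuous (fun x : 'rV[R]_d => dotp x x).
Proof. by move=> x; have [h _] := diff_sq x; exact: differentiable_continuous. Qed.

Section cutoff.
Variables (g g' : R -> R) (c : R) (w : 'rV[R]_d).
Hypothesis dg : forall u, der g u (g' u).
Hypothesis cg' : continuous g'.
Hypothesis c0 : 0 < c.

(** Supported in the ball of radius [c^(-1/2)]; as [c] tends to 0 it tends to the plane profile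
    [g (x . w)], which is not compactly supported. *)
Definition cutf x := g (dotp x w) * etaf (c * dotp x x).

Definition dcutf x v := g (dotp x w) * ((2 * dotp x v) * (c * (- 2 * ppart (1 - c * dotp x x)))) +
   etaf (c * dotp x x) * (dotp v w * g' (dotp x w)).

Lemma diff_cutf x : is_diff x cutf (dcutf x).
Proof.
apply: diff_mul; first exact: diff_comp1 (diff_dotp w x) (dg _).
have dc : der (fun t => etaf (c * t)) (dotp x x) (c * (- 2 * ppart (1 - c * dotp x x))).
  apply: der_eq (der_comp (der_etaf _) (derZ c (der_id _))) _; ring.
exact: (diff_comp1 (diff_sq x) dc).
Qed.

Lemma derive_cutf x v : 'D_v cutf x = dcutf x v.
Proof. by have [h1 h2] := diff_cutf x; rewrite deriveE// h2. Qed.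

Lemma cont_comp1 (h : R -> R) (f : 'rV[R]_d -> R) :
  continuous h -> continuous f -> continuous (fun x => h (f x)).
Proof. by move=> ch cf x; apply: continuous_comp; [exact: cf|exact: ch]. Qed.

Lemma cont_etaf : continuous (@etaf R).
Proof. by move=> t; exact: der_cont (der_etaf t). Qed.

Lemma test_cutf : test_fun cutf.
Proof.
split; last split; last split.
- by move=> x; have [] := diff_cutf x.
- by move=> x; apply: differentiable_continuous; have [] := diff_cutf x.
- move=> v; rewrite (_ : (fun x => _) = (fun x => dcutf x v)); last first.
    by apply/funext => x; rewrite derive_cutf.
  have cg : continuous g by move=> u; exact: der_cont (dg u).
  have c1 : continuous (fun x : 'rV[R]_d => c * dotp x x).
    by apply: contM; [exact: contC|exact: cont_sq].
  have c2 : continuous (fun x : 'rV[R]_d => dotp x w) by exact: cont_dotp.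
  apply: contD; apply: contM.
  + exact: (cont_comp1 cg c2).
  + apply: contM; first apply: contM; first exact: contC.
      apply/continuousP => A oA.
      rewrite (_ : _ @^-1` A = (fun y => dotp y v) @^-1` A).
        by move: A oA; apply/continuousP; exact: cont_dotp.
      by apply/seteqP; split=> y /=; rewrite dotpC.
    apply: contM; first exact: contC.
    apply: contM; first exact: contC.
    apply: (cont_comp1 (h := fun t => ppart (1 - t)) _ c1).
    exact: cont_ppart1.
  + exact: (cont_comp1 cont_etaf c1).
  + by apply: contM; [exact: contC|exact: (cont_comp1 cg' c2)].
- exists (Num.sqrt c^-1) => x xM; rewrite /cutf.
  have h : 1 < c * dotp x x.
    have : c^-1 < enorm x ^+ 2.
      rewrite -[X in X < _](@sqr_sqrtr _ c^-1) ?invr_ge0 ?ltW//.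
      by rewrite ltr_pXn2r// nnegrE ?sqrtr_ge0.
    by rewrite enorm_sq => hh; rewrite mulrC -ltr_pdivrMr// mul1r.
  by rewrite /etaf ppartE ltr0_norm; [rewrite subrr mul0r expr0n/= mulr0|lra].
Qed.

End cutoff.
End TestFun.

(** * From the weak stationary equation to an ordinary differential equation along rays *)

Section ODE.
Variable R : realType.
Variable d : nat.
Implicit Types (x v w xi : 'rV[R]_d).

Local Notation mu := (@leb R d).

Lemma seqc (f : R -> R) (u : nat -> R) (l : R) : continuous f ->
  u n @[n --> \oo] --> l -> f (u n) @[n --> \oo] --> f l.
Proof. by move=> cf ul; apply: (cvg_comp u f ul); exact: cf. Qed.

Definition gencol (J F : 'rV[R]_d -> R) (s eps : R) x :=
  eps `^ (- (2 * s)) * (Defs.conv (rescale J eps) F x - F x).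

Lemma intg_gencol J F s eps : 0 < eps -> pdens J -> pdens F ->
  intg mu (gencol J F s eps).
Proof.
move=> e0 HJ HF; apply: intgZ; apply: intgB; last by case: HF.
by case: (conv_pdens (rescale_pdens e0 HJ) HF).
Qed.

(** Real part and opposite of the imaginary part of [eps^(-2s) (hat J (eps xi) - 1) hat F (xi)]. *)
Lemma gencol_FT J F s eps xi : 0 < eps -> pdens J -> pdens F ->
  fc (gencol J F s eps) xi = eps `^ (- (2 * s)) *
    ((fc J (eps *: xi) - 1) * fc F xi - fs J (eps *: xi) * fs F xi) /\
  fs (gencol J F s eps) xi = eps `^ (- (2 * s)) *
    ((fc J (eps *: xi) - 1) * fs F xi + fs J (eps *: xi) * fc F xi).
Proof.
move=> e0 HJ HF; have HJe := rescale_pdens e0 HJ.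
have [Ji _ _] := HJ; have [Fi _ _] := HF; have [Ci _ _] := conv_pdens HJe HF.
have [_ Jc Js _] := rescale_FT e0 Ji; have [Hc Hs] := conv_FT xi HJe HF.
pose C := Defs.conv (rescale J eps) F.
have L (k : 'rV[R]_d -> R) : intg mu (fun x => k x * C x) -> intg mu (fun x => k x * F x) ->
    \int[mu]_x (k x * gencol J F s eps x) =
    eps `^ (- (2 * s)) * (\int[mu]_x (k x * C x) - \int[mu]_x (k x * F x)).
  move=> iC iF; rewrite -RintB// -RintZ; last exact: intgB.
  by apply: Rint_eq => x; rewrite /gencol /C; ring.
split.
  rewrite /fc (L (fun x => cos (dotp x xi)))//; [|exact: intg_cos|exact: intg_cos].
  by have := Hc; rewrite Jc Js /fc -/C => ->; rewrite /fs; ring.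
rewrite /fs (L (fun x => sin (dotp x xi)))//; [|exact: intg_sin|exact: intg_sin].
by have := Hs; rewrite Jc Js /fs -/C => ->; rewrite /fc; ring.
Qed.

(* Only [g] and [u g' u] have to be bounded, so no moment of [F] is needed. *)
Section weak.
Variables (A F : 'rV[R]_d -> R).
Hypothesis Ai : intg mu A.
Hypothesis Fi : intg mu F.
Hypothesis weak : forall phi, test_fun phi -> rint (fun x => A x * phi x - F x * 'D_x phi x) = 0.
Variables (g g' : R -> R) (w : 'rV[R]_d) (M M' : R).
Hypothesis dg : forall u, der g u (g' u).
Hypothesis cg' : continuous g'.
Hypothesis gM : forall u, `|g u| <= M.
Hypothesis gM' : forall u, `|u * g' u| <= M'.

Let c n : R := n.+1%:R^-1.

Let c0 n : 0 < c n. Proof. by rewrite invr_gt0. Qed.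

Let cphi n := cutf g (c n) w.

Let M0 : 0 <= M. Proof. exact: le_trans (normr_ge0 _) (gM 0). Qed.

Lemma etaf01 (t : R) : 0 <= t -> `|etaf t| <= 1.
Proof.
move=> t0; rewrite /etaf normrX ppartE; case: (ger0P (1 - t)) => h.
  by rewrite expr_le1// ler_norml; lra.
by rewrite subrr mul0r normr0 expr0n.
Qed.

Lemma mul_ppart01 (t : R) : 0 <= t -> 0 <= t * ppart (1 - t) <= 1.
Proof.
move=> t0; rewrite ppartE; case: (ger0P (1 - t)) => h; last by rewrite subrr mul0r mulr0 lexx ler01.
by apply/andP; split; nra.
Qed.

Let cphi_bound n x : `|cphi n x| <= M.
Proof.
rewrite /cphi /cutf normrM -[M]mulr1 ler_pM// etaf01//.
by rewrite mulr_ge0 ?dotp_ge0// ltW.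
Qed.

Let dphi_bound n x : `|dcutf g g' (c n) w x x| <= M * 4 + M'.
Proof.
rewrite /dcutf; apply: le_trans (ler_normD _ _) _; apply: lerD.
  rewrite normrM ler_pM//.
  rewrite (_ : _ * _ = - 4 * ((c n * dotp x x) * ppart (1 - c n * dotp x x))); last by ring.
  have /andP[h1 h2] := @mul_ppart01 (c n * dotp x x) (mulr_ge0 (ltW (c0 n)) (dotp_ge0 x)).
  by rewrite normrM (ger0_norm h1) ltr0_norm; lra.
rewrite normrM -[M']mul1r ler_pM// etaf01//.
by rewrite mulr_ge0 ?dotp_ge0// ltW.
Qed.

Let meas_g : mfun (fun x : bor R d => g (dotp x w)).
Proof.
apply: cont_bor; apply: cont_comp1 => [u|]; first exact: der_cont (dg u).
exact: cont_dotp.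
Qed.

Let meas_phi n : mfun (cphi n : bor R d -> R).
Proof. by apply: cont_bor; have [_ []] := test_cutf w dg cg' (c0 n). Qed.

Let meas_dphi n : mfun (fun x : bor R d => dcutf g g' (c n) w x x).
Proof.
have mg' : mfun (fun x : bor R d => g' (dotp x w)).
  by apply: cont_bor; apply: cont_comp1 => //; exact: cont_dotp.
have msq : mfun (fun x : bor R d => dotp x x) by apply: cont_bor; exact: cont_sq.
have mlin : mfun (fun x : bor R d => dotp x w) by apply: cont_bor; exact: cont_dotp.
have mcsq : mfun (fun x : bor R d => c n * dotp x x) by exact: measurable_funM.
apply: measurable_funD; apply: measurable_funM => //.
- apply: measurable_funM; first exact: measurable_funM.
  apply: measurable_funM => //; apply: measurable_funM => //.
  apply: (measurableT_comp (f := fun t : R => ppart (1 - t))) => //.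
  by apply: continuous_measurable_fun; exact: cont_ppart1.
- apply: (measurableT_comp (f := @etaf R)) => //.
  by apply: continuous_measurable_fun; exact: cont_etaf.
- exact: measurable_funM.
Qed.

Let cvg_c (t : R) : c n * t @[n --> \oo] --> (0 : R).
Proof.
rewrite -(mul0r t); apply: cvgM; last exact: cvg_cst.
exact: cvg_harmonic.
Qed.

(** Dominated convergence as the truncation is removed. With [t = c |x|^2], the cutoff
    differentiated in the direction [x] equals [-4 t (1 - t)_+]: it is bounded uniformly in [c],
    which explains [M * 4] in the domination, and it tends to 0 at each point. *)
Lemma weak_limit : \int[mu]_x (A x * g (dotp x w)) =
  \int[mu]_x (F x * (dotp x w * g' (dotp x w))).
Proof.
have Agi : intg mu (fun x => A x * g (dotp x w)).
  by apply: (intg_eq _ (intg_mulb meas_g (fun x => gM _) Ai)) => x; rewrite mulrC.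
have E n : \int[mu]_x (A x * cphi n x - F x * dcutf g g' (c n) w x x) = 0.
  rewrite -[RHS](weak (test_cutf w dg cg' (c0 n))) rintE.
    apply: Rint_eq => x; rewrite (derive_cutf (c n) w dg).
    by [].
  apply: intgB.
    by apply: (intg_eq _ (intg_mulb (meas_phi n) (cphi_bound n) Ai)) => x; rewrite mulrC.
  apply: (intg_eq _ (intg_mulb (meas_dphi n) (dphi_bound n) Fi)) => x.
  by rewrite mulrC (derive_cutf (c n) w dg).
have [|x||n x|Li L] := @Rint_dct _ _ _ mu
    (fun n x => A x * cphi n x - F x * dcutf g g' (c n) w x x)
    (fun x => A x * g (dotp x w) - F x * (dotp x w * g' (dotp x w)))
    (fun x => `|A x| * M + `|F x| * (M * 4 + M')).
- move=> n; apply: measurable_funB; apply: measurable_funM => //.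
  + exact: intg_meas Ai.
  + exact: intg_meas Fi.
- have e1 : etaf (c n * dotp x x) @[n --> \oo] --> (1 : R).
    have -> : (1 : R) = etaf 0 by rewrite /etaf ppartE subr0 normr1 (_ : (1+1)/2 = 1 :> R) ?expr1n//; field.
    by apply: continuous_cvg; [exact: cont_etaf|exact: cvg_c].
  have e2 : ppart (1 - c n * dotp x x) @[n --> \oo] --> ppart (1 - 0 : R).
    exact: (seqc (@cont_ppart1 R) (cvg_c _)).
  apply: cvgB; apply: cvgM; [exact: cvg_cst| |exact: cvg_cst|].
    rewrite -[X in _ --> X]mulr1; apply: cvgM => //; exact: cvg_cst.
  rewrite -[X in _ --> X]add0r -[X in _ --> _ + X]mul1r.
  apply: cvgD; last by apply: cvgM => //; exact: cvg_cst.
  rewrite (_ : (fun n => _) = (fun n => (g (dotp x w) * 2 * -2) * (c n * dotp x x) * ppart (1 - c n * dotp x x))); last first.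
    by apply/funext => n; ring.
  rewrite -(mul0r (ppart (1 - 0 : R))); apply: cvgM => //.
  rewrite -(mulr0 (g (dotp x w) * 2 * -2)); apply: cvgM; [exact: cvg_cst|exact: cvg_c].
- apply: intgD.
    by apply: (intg_eq _ (intgZ M (intg_abs Ai))) => x; rewrite mulrC.
  by apply: (intg_eq _ (intgZ (M * 4 + M') (intg_abs Fi))) => x; rewrite mulrC.
- apply: le_trans (ler_normB _ _) _.
  rewrite (normrM (A x)) (normrM (F x)).
  exact: lerD (ler_wpM2l (normr_ge0 _) (cphi_bound n x))
    (ler_wpM2l (normr_ge0 _) (dphi_bound n x)).
have : \int[mu]_x (A x * g (dotp x w) - F x * (dotp x w * g' (dotp x w))) = 0.
  apply: (cvg_unique _ L) => //.
  rewrite /= (_ : (fun n => _) = (fun=> 0)); first exact: cvg_cst.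
  by apply/funext => n; exact: E.
have Fgi : intg mu (fun x => F x * (dotp x w * g' (dotp x w))).
  apply: (intg_eq _ (intgB Agi Li)) => x; ring.
by rewrite RintB// => /subr0_eq.
Qed.

End weak.

Local Notation lam := (@lebesgue_measure R).

Lemma Rint_indic_itv (h : R -> R) (T : R) :
  \int[lam]_(r in `[0, T]) h r = \int[lam]_r (\1_(`[0, T]) r * h r).
Proof.
rewrite Rintegral_mkcond; apply: Rint_eq => r.
by rewrite patchE indicE; case: ifPn => _; rewrite ?mul1r ?mul0r.
Qed.

Lemma intg_indic T : intg lam (\1_(`[0, T]%classic) : R -> R).
Proof.
have h : (lam (`[0%R, T]%classic : set R) < +oo)%E.
  by rewrite lebesgue_measure_itv/=; case: ifPn => _; rewrite -?EFinD ?ltry.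
by apply/intg_ge0P => //; rewrite integral_indic// setIT.
Qed.

Lemma swap_ray (h : R -> R) (f : 'rV[R]_d -> R) w T : intg mu f -> continuous h ->
  (forall u, `|h u| <= 1) ->
  \int[mu]_x (f x * \int[lam]_(r in `[0, T]) h (r * dotp x w)) =
  \int[lam]_(r in `[0, T]) \int[mu]_x (h (dotp x (r *: w)) * f x).
Proof.
move=> fi ch hb.
pose G (p : bor R d * measurableTypeR R) := h (p.2 * dotp p.1 w).
have mG : mfun G.
  apply: (measurableT_comp (continuous_measurable_fun ch)).
  by apply: measurable_funM => //; apply: meas_dotp.
have [E _] := swap_bdd (m2 := lam) fi (intg_indic T) mG (fun p => hb _).
transitivity (\int[mu]_x (f x * \int[lam]_r (\1_(`[0, T]) r * G (x, r)))).
  by apply: Rint_eq => x; rewrite Rint_indic_itv.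
rewrite E Rint_indic_itv; apply: Rint_eq => r; congr (_ * _).
by apply: Rint_eq => x; rewrite /G/= dotpZr.
Qed.

Lemma FTC2 (f F : R -> R) (a b : R) : a < b -> continuous f -> (forall x : R, der F x (f x)) ->
  \int[lam]_(x in `[a, b]) f x = F b - F a.
Proof.
move=> ab cf dF; rewrite /Rintegral (continuous_FTC2 ab (F := F))//.
- exact: continuous_subspaceT.
- split=> [x _||].
  + by have [] := dF x.
  + by apply: cvg_at_right_filter; exact: der_cont (dF a).
  + by apply: cvg_at_left_filter; exact: der_cont (dF b).
- by move=> x _; rewrite derive1E; have [_ ->] := dF x.
Qed.

Lemma phasefE th (T u : R) : 0 < T ->
  phasef th T u = \int[lam]_(r in `[0, T]) cos (r * u - th).
Proof.
have D r : der (fun r => r * u - th) r u.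
  by apply: der_eq (derB (derM (der_id r) (derC u r)) (derC th r)) _; ring.
have cc : continuous (fun r : R => cos (r * u - th)).
  by move=> r; exact: der_cont (der_comp (der_cos _) (D r)).
move=> T0; rewrite /phasef /qg; case: eqVneq => [u0|u0].
  rewrite (@FTC2 _ (fun r => r * cos th))// ?mul0r ?subr0//.
  by move=> r; apply: der_eq (derM (der_id r) (derC _ r)) _; rewrite u0 mulr0 sub0r cosN; ring.
rewrite (@FTC2 _ (fun r => sin (r * u - th) / u))//.
  by rewrite mul0r sub0r sinN -mulrBl opprK.
by move=> r; apply: der_eq (derM (der_comp (der_sin _) (D r)) (derC u^-1 r)) _; field.
Qed.

Lemma seq_cont (f : R -> R) : (forall (x : R) (u : nat -> R), u n @[n --> \oo] --> x ->
  f (u n) @[n --> \oo] --> f x) -> continuous f.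
Proof. by move=> H x; apply/(@cvg_nbhsP _ R^o) => u; exact: H. Qed.

(** Dominated convergence along sequences, with [|f|] as the dominating function. *)
Lemma cont_ray (h : R -> R) (f : 'rV[R]_d -> R) w : intg mu f -> continuous h ->
  (forall u, `|h u| <= 1) ->
  continuous (fun r : R => \int[mu]_x (h (dotp x (r *: w)) * f x)).
Proof.
move=> fi ch hb; apply: seq_cont => r u ur.
have [|x|||] // := @Rint_dct _ _ _ mu (fun n x => h (dotp x (u n *: w)) * f x)
  (fun x => h (dotp x (r *: w)) * f x) (fun x => `|f x|).
- move=> n; apply: measurable_funM; last exact: intg_meas fi.
  by apply: (measurableT_comp (continuous_measurable_fun ch)); exact: meas_dotp.
- apply: cvgM; last exact: cvg_cst.
  apply: continuous_cvg; first exact: ch.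
  rewrite dotpZr; under eq_fun do rewrite dotpZr.
  by apply: cvgM => //; exact: cvg_cst.
- exact: intg_abs.
- by move=> n x; rewrite normrM ler_piMl.
Qed.

Lemma cos_pihalf_sub (t : R) : cos (t - pi / 2) = sin t.
Proof. by rewrite cosB cos_pihalf sin_pihalf mulr0 add0r mulr1. Qed.

Lemma cont_cos_phase th : continuous (fun u : R => cos (u - th)).
Proof. by move=> u; exact: der_cont (der_comp (der_cos _) (derB (der_id u) (derC th u))). Qed.

(** The hypothesis says that [T * p T] is the integral of the continuous function [q + p] over
    [[0, T]]; the fundamental theorem of calculus gives [(r p)' = q + p], that is [r p' = q]. *)
Lemma euler_ode (p q : R -> R) : continuous p -> continuous q ->
  (forall T, 0 < T -> \int[lam]_(r in `[0, T]) q r = T * p T - \int[lam]_(r in `[0, T]) p r) ->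
  forall r, 0 < r -> der p r (q r / r).
Proof.
move=> cp cq E r r0.
have ci (f : R -> R) T : continuous f -> lam.-integrable `[0, T] (EFin \o f).
  move=> cf; apply: continuous_compact_integrable; first exact: segment_compact.
  exact: continuous_subspaceT.
have cpq : continuous (fun t => q t + p t).
  by move=> t; exact: (cvgD (cq t) (cp t)).
have E' T : 0 < T -> \int[lam]_(t in `[0, T]) (q t + p t) = T * p T.
  move=> T0; rewrite RintegralD// ?E ?subrK//; exact: ci.
have [d1 d2] := @continuous_FTC1_closed R _ 0 r (r + 1) (ltr_pwDr ltr01 (lexx r))
  (ci _ (r + 1) cpq) r0 (cpq r).
have D : der (fun T => T * p T) r (q r + p r).
  apply: (@der_near _ (fun T => \int[lam]_(t in `[0, T]) (q t + p t))).
    apply/nbhs_ballP; exists r => // y; rewrite /ball/= => hy; apply: E'.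
    by move: hy; rewrite ltr_norml; lra.
  by split; [exact: d1|rewrite -derive1E; exact: d2].
have rn0 : r != 0 by rewrite gt_eqF.
apply: (@der_near _ (fun y => y * p y * y^-1)).
  have := near_neq0 rn0; apply: filterS => y y0; by field.
apply: der_eq (derM D (derV rn0 (der_id r))) _; by field.
Qed.

(* [th = 0] and [th = pi / 2] give the cosine and the sine transform. *)
Lemma phase_ode J F s eps w th : 0 < eps -> pdens J -> equilibrium J s eps F ->
  let T f (r : R) := \int[mu]_x (cos (dotp x (r *: w) - th) * f x) in
  continuous (T F) /\ forall r, 0 < r -> der (T F) r (T (gencol J F s eps) r / r).
Proof.
move=> e0 HJ [/prob_densityP HF wk] T.
have [Fi F0 F1] := HF.
have Ai := intg_gencol s e0 HJ HF.
set A := gencol J F s eps in Ai *.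
have ch := @cont_cos_phase th; have hb (u : R) : `|cos (u - th)| <= 1 by exact: normr_cos.
have cT f : intg mu f -> continuous (T f).
  by move=> fi; have := @cont_ray (fun u => cos (u - th)) f w fi ch hb.
split=> [|r r0]; first exact: cT.
apply: (euler_ode (cT _ Fi) (cT _ Ai)) r0 => t t0.
have [g' [dk cg' ug']] := phasefP th t0.
have kb u := phasef_bound th u t0.
rewrite -!(swap_ray w t _ ch hb)//.
rewrite (@Rint_eq _ _ _ _ _ (fun x : bor R d => A x * phasef th t (dotp x w))); last first.
  by move=> x; rewrite phasefE.
(* The identity for [u * g' u] turns the drift term into [t] times the transform at [t] minus its
   integral, the right-hand side that [euler_ode] expects. *)
rewrite (@weak_limit A F Ai Fi _ (phasef th t) g' w t (t * 1 + t))//; last first.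
  move=> u; rewrite ug' (le_trans (ler_normB _ _))// lerD// normrM gtr0_norm// ler_wpM2l//.
  exact: ltW.
have mk : mfun (fun x : bor R d => phasef th t (dotp x w)).
  apply: cont_bor; apply: cont_comp1 => [u|]; [exact: der_cont (dk u)|exact: cont_dotp].
have mh : mfun (fun x : bor R d => cos (dotp x (t *: w) - th)).
  by apply: cont_bor; apply: (cont_comp1 ch); exact: cont_dotp.
have h1 : intg mu (fun x => cos (dotp x (t *: w) - th) * F x) by exact: (intg_mulb (M := 1)).
have h2 : intg mu (fun x => phasef th t (dotp x w) * F x) by exact: (intg_mulb (M := t)).
rewrite -RintZ// [X in _ - X](@Rint_eq _ _ _ _ _ (fun x : bor R d => phasef th t (dotp x w) * F x)); last first.
  by move=> x; rewrite phasefE// mulrC.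
rewrite -RintB//; last exact: intgZ.
by apply: Rint_eq => x; rewrite ug' dotpZr; ring.
Qed.

Theorem equilibrium_ode J F s eps w : 0 < eps -> pdens J -> equilibrium J s eps F ->
  [/\ continuous (fun r : R => fc F (r *: w)), continuous (fun r : R => fs F (r *: w)) &
   forall r, 0 < r ->
    der (fun r => fc F (r *: w)) r (fc (gencol J F s eps) (r *: w) / r) /\
    der (fun r => fs F (r *: w)) r (fs (gencol J F s eps) (r *: w) / r)].
Proof.
move=> e0 HJ HF; have [c1 d1] := phase_ode w 0 e0 HJ HF.
have [c2 d2] := phase_ode w (pi / 2) e0 HJ HF.
have E1 f : (fun r : R => \int[mu]_x (cos (dotp x (r *: w) - 0) * f x)) = (fun r => fc f (r *: w)).
  by apply/funext => r; apply: Rint_eq => x; rewrite subr0.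
have E2 f : (fun r : R => \int[mu]_x (cos (dotp x (r *: w) - pi / 2) * f x)) = (fun r => fs f (r *: w)).
  by apply/funext => r; apply: Rint_eq => x; rewrite cos_pihalf_sub.
rewrite !E1 in c1 d1; rewrite !E2 in c2 d2.
split=> // r r0; split.
  by have := d1 r r0; rewrite (congr1 (fun k => k r) (E1 (gencol J F s eps))).
by have := d2 r r0; rewrite (congr1 (fun k => k r) (E2 (gencol J F s eps))).
Qed.

End ODE.

(** * Comparison of the equilibrium with the stable law along a ray, uniformly in the exponent *)

Section Decay.
Variable R : realType.

Lemma der_powR (p r : R) : 0 < r -> der (fun x => x `^ p) r (p * r `^ p / r).
Proof.
move=> r0.
apply: (@der_near _ (fun x => expR (p * ln x))).
  apply/nbhs_ballP; exists r => // y; rewrite /ball/= => hy.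
  have y0 : 0 < y by move: hy; rewrite ltr_norml; lra.
  by rewrite /powR gt_eqF.
have dl : der (@ln R) r r^-1 by exact: is_derive1_ln.
apply: der_eq (der_comp (der_exp _) (derZ p dl)) _.
by rewrite /powR gt_eqF//; ring.
Qed.

(** The coefficients contain real powers divided by [r], so differentiability is only available for
    positive [r]; the value at 0 enters through a right limit. *)
Lemma nonincr_right (f f' : R -> R) (L r : R) : 0 < r ->
  (forall t, 0 < t -> der f t (f' t)) -> (forall t, 0 < t < r -> f' t <= 0) ->
  f t @[t --> 0^'+] --> L -> f r <= L.
Proof.
move=> r0 df f'0 fL; apply: (cvgr_to_ge fL); near=> t.
have t0 : 0 < t by near: t; exact: nbhs_right_gt.
have tr : t < r by near: t; exact: nbhs_right_lt.
apply: (der_nonincr (f' := f') (ltW tr)) => x /andP[tx xr]; first by apply: df; lra.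
by apply: f'0; apply/andP; split; lra.
Unshelve. all: by end_near. Qed.

Lemma right_cvg (f : R -> R) L : continuous f -> f 0 = L -> f t @[t --> 0^'+] --> L.
Proof. by move=> cf <-; apply: cvg_at_right_filter; exact: cf. Qed.

Lemma le_lim0 (x y K a0 : R) : 0 < a0 -> (forall a, 0 < a <= a0 -> x <= y + K * a) -> x <= y.
Proof.
move=> a00 H; have [//|yx] := leP x y.
pose K' := `|K| + 1; have K'0 : 0 < K' by rewrite /K'; have := normr_ge0 K; lra.
pose a := Num.min a0 ((x - y) / (2 * K')).
have a0' : 0 < a.
  by rewrite lt_min a00 divr_gt0 ?mulr_gt0 ?subr_gt0.
have aa0 : a <= a0 by rewrite ge_min lexx.
have := H a; rewrite a0' aa0 => /(_ isT).
have : a <= (x - y) / (2 * K') by rewrite ge_min lexx orbT.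
rewrite ler_pdivlMr ?mulr_gt0// => h1 h2.
have : K * a <= K' * a by rewrite ler_wpM2r ?ltW// /K'; have := ler_norm K; lra.
lra.
Qed.

Lemma norm_sub_le0 (u v : R) : `|u| <= v -> u - v <= 0.
Proof. by rewrite ler_norml; lra. Qed.

Lemma norm_subN_le0 (u v : R) : `|u| <= v -> - u - v <= 0.
Proof. by rewrite ler_norml; lra. Qed.

Lemma norm_sandwich (u L B : R) : u - B <= L - 0 -> - u - B <= - L - 0 -> `|u - L| <= B.
Proof. by rewrite !subr0 ler_norml => *; apply/andP; split; lra. Qed.

(** A single term of the exponential series. *)
Lemma exp_poly (N : nat) (x : R) : 0 <= x -> x ^+ N * expR (- x) <= N`!%:R.
Proof.
move=> x0; rewrite expRN ler_pdivrMr ?expR_gt0//; case: N => [|N].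
  rewrite expr0 mul1r; have := expR_ge1Dx x; lra.
have h := expR_ge1Dxn N x0; have f0 : 0 < (N.+1)`!%:R :> R by rewrite ltr0n fact_gt0.
rewrite mulrC -ler_pdivrMr//; lra.
Qed.

Lemma exp_poly2 (N : nat) (x : R) : 0 <= x -> x ^+ N * expR (- (x / 2)) <= 2 ^+ N * N`!%:R.
Proof.
move=> x0; have h : 0 <= x / 2 by lra.
have := exp_poly N h; rewrite expr_div_n => h2.
rewrite -[x ^+ N](mulfK (x := 2 ^+ N)); last by rewrite expf_neq0.
rewrite [x ^+ N * _]mulrC -!mulrA; apply: ler_wpM2l; first by rewrite exprn_ge0.
by rewrite mulrA.
Qed.

Lemma sq1_le (r : R) (n : nat) : 1 <= r -> (1 + r ^+ 2) ^+ n <= 2 ^+ n * r ^+ (2 * n).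
Proof.
move=> r1; rewrite exprM -exprMn lerXn2r ?nnegrE//; try by have := sqr_ge0 r; lra.
by nra.
Qed.

(** Spends [m] further powers of [x] against the exponential; at [y = r0 / eps] they become the
    factor [eps^m]. *)
Lemma exp_tail (N m : nat) (x y : R) : 0 < y -> y <= x ->
  x ^+ N * expR (- x) <= (N + m)`!%:R * y^-1 ^+ m.
Proof.
move=> y0 yx; have x0 : 0 < x by lra.
have h := exp_poly (N + m) (ltW x0).
rewrite exprD mulrAC in h.
rewrite -ler_pdivlMr ?exprn_gt0// in h.
apply: le_trans h _; apply: ler_wpM2l => //.
rewrite -exprVn; apply: lerXn2r; rewrite ?nnegrE ?invr_ge0; [exact: ltW|exact: ltW|].
by rewrite lef_pV2 ?posrE.
Qed.

(* [X + i Y] is the Fourier transform of the equilibrium along a ray and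
   [a + i b = eps^(-p) (hat J - 1)], which solve [r phi' = (a + i b) phi]. *)
Section ode.
Variables (X Y a b : R -> R) (p delta C0 eps : R).
Hypotheses (p1 : 1 <= p) (p2 : p <= 2) (delta0 : 0 < delta) (C00 : 0 < C0).
Hypotheses (eps0 : 0 < eps) (eps1 : eps <= 1).
Hypothesis dX : forall r, 0 < r -> der X r ((a r * X r - b r * Y r) / r).
Hypothesis dY : forall r, 0 < r -> der Y r ((a r * Y r + b r * X r) / r).
Hypotheses (cX : continuous X) (cY : continuous Y) (X0 : X 0 = 1) (Y0 : Y 0 = 0).
Hypothesis ale0 : forall r, a r <= 0.
Hypothesis asub : forall r h, - a h <= 2 * (- a r) + 2 * (- a (r + h)).
Hypothesis areg : forall r, 0 < r -> eps * r <= 1 -> `|a r + r `^ p| <= C0 * (eps * r) `^ delta * r `^ p.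
Hypothesis breg : forall r, 0 < r -> eps * r <= 1 -> `|b r| <= C0 * (eps * r) `^ delta * r `^ p.

(** The squared modulus of the transform. The coefficient [b] cancels in its equation
    [r V' = 2 a V], so [V] is nonincreasing. *)
Definition V r := X r ^+ 2 + Y r ^+ 2.

Lemma der_V r : 0 < r -> der V r (2 * a r * V r / r).
Proof.
move=> r0; apply: der_eq (derD (derX 2 (dX r0)) (derX 2 (dY r0))) _.
by rewrite /V /= !expr1; field; rewrite gt_eqF.
Qed.

Lemma cont_V : continuous V.
Proof.
move=> r; have hX := @cX r; have hY := @cY r.
rewrite /V (_ : (fun r => _) = (fun r => X r * X r + Y r * Y r)).
  by apply: cvgD; apply: cvgM; [exact: hX|exact: hX|exact: hY|exact: hY].
by apply/funext => t; rewrite !expr2.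
Qed.

Lemma V_ge0 r : 0 <= V r.
Proof. by rewrite addr_ge0 ?sqr_ge0. Qed.

Lemma V_nonincr u v : 0 <= u -> u <= v -> V v <= V u.
Proof.
have N x : 0 < x -> 2 * a x * V x / x <= 0.
  move=> x0; rewrite pmulr_lle0 ?invr_gt0// mulr_le0_ge0 ?V_ge0//.
  by have := ale0 x; lra.
rewrite le_eqVlt => /predU1P[<-|u0] uv.
  move: uv; rewrite le_eqVlt => /predU1P[<-//|v0].
  apply: (nonincr_right v0 der_V) => [t /andP[t0 _]|]; first exact: N.
  by apply: cvg_at_right_filter; exact: cont_V.
apply: (der_nonincr (f' := fun r => 2 * a r * V r / r) uv) => x /andP[ux _].
  by apply: der_V; lra.
by apply: N; lra.
Qed.

Lemma V_le1 r : 0 <= r -> V r <= 1.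
Proof.
by move=> r0; apply: le_trans (V_nonincr (lexx 0) r0) _; rewrite /V X0 Y0 expr1n expr0n addr0.
Qed.

Lemma X_leV r : `|X r| <= Num.sqrt (V r).
Proof.
rewrite -sqrtr_sqr ler_sqrt ?V_ge0//.
by rewrite /V lerDl sqr_ge0.
Qed.

Lemma Y_leV r : `|Y r| <= Num.sqrt (V r).
Proof.
rewrite -sqrtr_sqr ler_sqrt ?V_ge0//.
by rewrite /V lerDr sqr_ge0.
Qed.

Lemma X_le1 r : 0 <= r -> `|X r| <= 1.
Proof. by move=> r0; rewrite (le_trans (X_leV r))// -[leRHS]sqrtr1 ler_sqrt// V_le1. Qed.

Lemma Y_le1 r : 0 <= r -> `|Y r| <= 1.
Proof. by move=> r0; rewrite (le_trans (Y_leV r))// -[leRHS]sqrtr1 ler_sqrt// V_le1. Qed.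

Definition Kode := 1 + 2 * C0.

Lemma small_coef r : 0 < r -> r <= 1 -> `|a r| <= (1 + C0) * r /\ `|b r| <= C0 * r.
Proof.
move=> r0 r1.
have er : eps * r <= 1 by rewrite mulr_ile1// ltW.
have er0 : 0 < eps * r by rewrite mulr_gt0.
have hp : r `^ p <= r by apply: ge1r_powR => //; rewrite r0.
have hd : (eps * r) `^ delta <= 1.
  by rewrite -[leRHS](powRr0 (eps * r)); apply: ger_powR; rewrite ?er0// ltW.
have hp0 := powR_ge0 r p; have hd0 := powR_ge0 (eps * r) delta.
have K : C0 * (eps * r) `^ delta * r `^ p <= C0 * r.
  rewrite -mulrA; apply: (ler_wpM2l (ltW C00)).
  by rewrite -[leRHS]mul1r; apply: ler_pM.
split; last exact: le_trans (breg r0 er) K.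
have h := areg r0 er.
have h' : `|a r| <= `|a r + r `^ p| + `|r `^ p| by rewrite -{1}[a r](addrK (r `^ p)) ler_normB.
apply: le_trans h' _; rewrite mulrDl mul1r addrC; apply: lerD; last exact: le_trans h K.
by rewrite (ger0_norm hp0).
Qed.

Lemma small_der (c1 c2 u v r : R) : 0 < r -> `|c1| <= (1 + C0) * r -> `|c2| <= C0 * r ->
  `|u| <= 1 -> `|v| <= 1 -> `|(c1 * u + c2 * v) / r| <= Kode.
Proof.
move=> r0 h1 h2 hu hv; rewrite normrM normfV (gtr0_norm r0) ler_pdivrMr//.
apply: le_trans (ler_normD _ _) _; rewrite !normrM /Kode.
have : `|c1| * `|u| <= (1 + C0) * r * 1 by rewrite ler_pM.
have : `|c2| * `|v| <= C0 * r * 1 by rewrite ler_pM.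
lra.
Qed.

(** As [p >= 1], one has [r^p <= r] on [[0, 1]]; both coefficients are thus at most linear there and
    the derivative of [X] is bounded. The constant is the sum of [1 + C0] for [a] and [C0] for
    [b]. *)
Lemma X_small r : 0 <= r <= 1 -> 1 - X r <= Kode * r.
Proof.
move=> /andP[r0 r1].
move: r0; rewrite le_eqVlt => /predU1P[<-|r0]; first by rewrite X0 mulr0 subrr.
have : - X r - Kode * r <= - X 0 - Kode * 0.
  apply: (@nonincr_right (fun r => - X r - Kode * r) (fun r => - ((a r * X r - b r * Y r) / r) - Kode * 1)) => //.
  - move=> t t0; apply: derB; first by apply: derN; exact: dX.
    by apply: derZ; exact: der_id.
  - move=> t /andP[t0 tr]; have [h1 h2] := small_coef t0 (ltW (lt_le_trans tr r1)).
    have h2' : `|- b t| <= C0 * t by rewrite normrN.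
    have := small_der t0 h1 h2' (X_le1 (ltW t0)) (Y_le1 (ltW t0)).
    rewrite mulNr ler_norml; lra.
  - apply: cvgB; first by apply: cvgN; apply: cvg_at_right_filter; exact: cX.
    by apply: cvgM; [exact: cvg_cst|apply: cvg_at_right_filter; exact: cvg_id].
rewrite X0; lra.
Qed.

Variable r0 : R.
Hypotheses (r00 : 0 < r0) (r01 : r0 <= 1) (C0r0 : C0 * r0 `^ delta <= 1 / 2).

(** The end of the range where the expansion of the symbol is effective, [eps * r <= r0]. *)
Definition h0 := r0 / eps.

Lemma h0_gt0 : 0 < h0. Proof. by rewrite divr_gt0. Qed.

Lemma h0_eps r : r <= h0 -> eps * r <= r0.
Proof. by rewrite /h0 ler_pdivlMr// mulrC. Qed.

(** The choice of [r0] makes the error at most half of the main term [r^p], so that real damping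
    remains. *)
Lemma coef_near r : 0 < r -> r <= h0 ->
  [/\ a r <= - (r `^ p / 2), `|a r + r `^ p| <= C0 * (eps * r) `^ delta * r `^ p &
   `|b r| <= C0 * (eps * r) `^ delta * r `^ p].
Proof.
move=> rp rh; have er := h0_eps rh; have er1 := le_trans er r01.
split; [|exact: areg|exact: breg].
have := areg rp er1; rewrite ler_norml => /andP[_ h].
have hd : (eps * r) `^ delta <= r0 `^ delta.
  by apply: ge0_ler_powR; rewrite ?nnegrE//; rewrite ltW// mulr_gt0.
have hp0 := powR_ge0 r p.
have : C0 * (eps * r) `^ delta * r `^ p <= 1 / 2 * r `^ p.
  rewrite ler_wpM2r//; apply: le_trans C0r0; rewrite ler_wpM2l//; exact: ltW.
lra.
Qed.

(** For [c = 1] the integrating factor of the limit equation, for [c = -1] the transform of the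
    stable law. *)
Definition ex (c r : R) := expR (c * r `^ p / p).

Lemma p_gt0 : 0 < p. Proof. exact: lt_le_trans ltr01 p1. Qed.

Lemma der_ex c r : 0 < r -> der (ex c) r (c * r `^ p / r * ex c r).
Proof.
move=> rp; have pn0 : p != 0 by rewrite gt_eqF// p_gt0.
have D : der (fun r => c * r `^ p / p) r (c * (r `^ p / r)).
  apply: der_eq (derM (derZ c (der_powR p rp)) (derC p^-1 r)) _; field.
  by rewrite gt_eqF//= pn0.
apply: der_eq (der_comp (der_exp _) D) _.
by rewrite /ex; ring.
Qed.

Lemma powR_right (q : R) : 0 < q -> t `^ q @[t --> 0^'+] --> (0 : R).
Proof. by move=> q0; exact: powR_cvg0. Qed.

Lemma ex_right c : ex c t @[t --> 0^'+] --> (1 : R).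
Proof.
have h : c * t `^ p / p @[t --> 0^'+] --> c * 0 / p.
  apply: cvgM; last exact: cvg_cst.
  by apply: cvgM; [exact: cvg_cst|exact: powR_right p_gt0].
have := cvg_comp _ _ h (@continuous_expR R _).
by rewrite mulr0 mul0r expR0.
Qed.

Lemma mul_ex_right (f : R -> R) (L c : R) : f t @[t --> 0^'+] --> L ->
  f t * ex c t @[t --> 0^'+] --> L.
Proof. by move=> fL; rewrite -[X in _ --> X]mulr1; apply: cvgM fL _; exact: ex_right. Qed.

(** Since [2 a <= - r^p] on this range, [V] times the integrating factor is nonincreasing. *)
Lemma V_near r : 0 < r -> r <= h0 -> V r <= ex (- 1) r.
Proof.
move=> rp rh.
suff : V r * ex 1 r <= 1.
  by rewrite /ex mul1r mulN1r mulNr expRN -ler_pdivlMr ?expR_gt0// mul1r.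
apply: (@nonincr_right (fun r => V r * ex 1 r)
  (fun r => 2 * a r * V r / r * ex 1 r + V r * (1 * r `^ p / r * ex 1 r))) => //.
- by move=> x x0; apply: derM; [exact: der_V|exact: der_ex].
- move=> x /andP[x0 xr]; have [ha _ _] := coef_near x0 (le_trans (ltW xr) rh).
  rewrite (_ : _ + _ = (2 * a x + x `^ p) * (V x * ex 1 x / x)); last by field; rewrite gt_eqF.
  apply: mulr_le0_ge0; first by lra.
  by rewrite divr_ge0 ?mulr_ge0 ?V_ge0 ?expR_ge0// ltW.
- have V0 : V 0 = 1 by rewrite /V X0 Y0 expr1n expr0n addr0.
  by apply: mul_ex_right; apply: right_cvg V0; exact: cont_V.
Qed.

(** An explicit majorant that avoids integrating the error. The error terms, times [ex 1] and with
    [X], [Y] bounded by [ex (-1/2)], are at most [Bd r / r], while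
    [r Bd' = (delta + p + r^p / 2) Bd >= Bd] because [p >= 1]. *)
Definition Bd r := 2 * C0 * eps `^ delta * r `^ delta * r `^ p * ex (1 / 2) r.

Lemma der_Bd r : 0 < r -> der Bd r ((delta + p + r `^ p / 2) * Bd r / r).
Proof.
move=> rp.
apply: der_eq (derM (derM (derZ (2 * C0 * eps `^ delta) (der_powR delta rp)) (der_powR p rp)) (der_ex (1/2) rp)) _.
by rewrite /Bd; field; rewrite gt_eqF.
Qed.

Lemma Bd_right : Bd t @[t --> 0^'+] --> (0 : R).
Proof.
apply: mul_ex_right; rewrite -[X in _ --> X](mulr0 (2 * C0 * eps `^ delta * 0)).
apply: cvgM; last exact: powR_right p_gt0.
by apply: cvgM; [exact: cvg_cst|exact: powR_right delta0].
Qed.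

Lemma Bd_ge0 r : 0 < r -> 0 <= Bd r.
Proof.
by move=> rp; rewrite /Bd !mulr_ge0 ?powR_ge0 ?expR_ge0// ltW.
Qed.

(** To be used with [c1 = a + r^p] and [c2] equal to [b] or [- b]: what remains of the equation once
    the integrating factor has removed the limit dynamics. *)
Lemma perturb (c1 c2 u v r : R) : 0 < r -> r <= h0 ->
  `|c1| <= C0 * (eps * r) `^ delta * r `^ p -> `|c2| <= C0 * (eps * r) `^ delta * r `^ p ->
  `|u| <= Num.sqrt (V r) -> `|v| <= Num.sqrt (V r) ->
  `|ex 1 r * (c1 * u + c2 * v) / r| <= (delta + p + r `^ p / 2) * Bd r / r.
Proof.
move=> rp rh h1 h2 hu hv.
have sV : Num.sqrt (V r) <= ex (- (1/2)) r.
  rewrite -(ler_pXn2r (n := 2)) ?nnegrE ?sqrtr_ge0 ?expR_ge0//.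
  rewrite sqr_sqrtr ?V_ge0// /ex -expRM_natl.
  rewrite (_ : 2 * _ = -1 * r `^ p / p); first exact: V_near.
  by field; rewrite gt_eqF// p_gt0.
rewrite normrM normfV (gtr0_norm rp); apply: ler_wpM2r; first by rewrite invr_ge0 ltW.
rewrite normrM (ger0_norm (expR_ge0 _)) -/(ex 1 r).
set B := C0 * _ * _ in h1 h2.
have B0 : 0 <= B by exact: le_trans (normr_ge0 _) h1.
have s0 := expR_ge0 (- (1/2) * r `^ p / p); rewrite -/(ex _ _) in s0.
have k1 : `|c1 * u + c2 * v| <= 2 * B * ex (- (1/2)) r.
  apply: le_trans (ler_normD _ _) _; rewrite !normrM.
  have : `|c1| * `|u| <= B * ex (- (1/2)) r by rewrite ler_pM// (le_trans hu).
  have : `|c2| * `|v| <= B * ex (- (1/2)) r by rewrite ler_pM// (le_trans hv).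
  lra.
have e0 := expR_ge0 (1 * r `^ p / p); rewrite -/(ex _ _) in e0.
apply: le_trans (ler_wpM2l e0 k1) _.
have -> : ex 1 r * (2 * B * ex (- (1/2)) r) = Bd r.
  have -> : ex 1 r * (2 * B * ex (- (1/2)) r) = 2 * B * (ex 1 r * ex (- (1/2)) r) by ring.
  rewrite -expRD /Bd -/(ex (1/2) r) /B powRM ?(ltW eps0) ?(ltW rp)// !mulrA.
  by congr (_ * expR _); field; rewrite gt_eqF// p_gt0.
rewrite -[leLHS]mul1r ler_wpM2r ?Bd_ge0//.
by move: p1 delta0 (powR_ge0 r p); lra.
Qed.

Lemma sandwich (f f' : R -> R) (L : R) r : 0 < r -> r <= h0 ->
  (forall t, 0 < t -> der f t (f' t)) ->
  (forall t, 0 < t -> t <= h0 -> `|f' t| <= (delta + p + t `^ p / 2) * Bd t / t) ->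
  f t @[t --> 0^'+] --> L -> `|f r - L| <= Bd r.
Proof.
move=> rp rh df f'b fs; have bd x : x < r -> 0 < x -> `|f' x| <= (delta + p + x `^ p / 2) * Bd x / x.
  by move=> xr x0; exact: f'b x0 (le_trans (ltW xr) rh).
apply: norm_sandwich.
  apply: (@nonincr_right (fun r => f r - Bd r) (fun r => f' r - (delta + p + r `^ p / 2) * Bd r / r)) => //.
  - by move=> x x0; apply: derB; [exact: df|exact: der_Bd].
  - by move=> x /andP[x0 xr]; exact: norm_sub_le0 (bd x xr x0).
  - by apply: cvgB => //; exact: Bd_right.
apply: (@nonincr_right (fun r => - f r - Bd r) (fun r => - f' r - (delta + p + r `^ p / 2) * Bd r / r)) => //.
- by move=> x x0; apply: derB; [apply: derN; exact: df|exact: der_Bd].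
- by move=> x /andP[x0 xr]; exact: norm_subN_le0 (bd x xr x0).
- by apply: cvgB; [exact: cvgN|exact: Bd_right].
Qed.

Lemma diff_near r : 0 < r -> r <= h0 ->
  `|X r - ex (-1) r| <= Bd r * ex (-1) r /\ `|Y r| <= Bd r * ex (-1) r.
Proof.
move=> rp rh.
have e1 : ex 1 r * ex (-1) r = 1.
  by rewrite -expRD -expR0; congr expR; field; rewrite gt_eqF// p_gt0.
have e0 : 0 <= ex (-1) r by exact: expR_ge0.
have hX : `|X r * ex 1 r - 1| <= Bd r.
  apply: (@sandwich (fun r => X r * ex 1 r)
    (fun r => (a r * X r - b r * Y r) / r * ex 1 r + X r * (1 * r `^ p / r * ex 1 r))) => //.
  - by move=> t tp; apply: derM; [exact: dX|exact: der_ex].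
  - move=> t tp th; have [_ h1 h2] := coef_near tp th.
    have h2' : `|- b t| <= C0 * (eps * t) `^ delta * t `^ p by rewrite normrN.
    have := perturb tp th h1 h2' (X_leV t) (Y_leV t).
    by congr (`|_| <= _); field; rewrite gt_eqF.
  - by apply: mul_ex_right; exact: right_cvg X0.
have hY : `|Y r * ex 1 r - 0| <= Bd r.
  apply: (@sandwich (fun r => Y r * ex 1 r)
    (fun r => (a r * Y r + b r * X r) / r * ex 1 r + Y r * (1 * r `^ p / r * ex 1 r))) => //.
  - by move=> t tp; apply: derM; [exact: dY|exact: der_ex].
  - move=> t tp th; have [_ h1 h2] := coef_near tp th.
    have := perturb tp th h1 h2 (Y_leV t) (X_leV t).
    by congr (`|_| <= _); field; rewrite gt_eqF.
  - by apply: mul_ex_right; exact: right_cvg Y0.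
rewrite subr0 in hY.
split.
  rewrite (_ : X r - _ = (X r * ex 1 r - 1) * ex (-1) r); last by rewrite mulrBl -mulrA e1; ring.
  by rewrite normrM (ger0_norm e0) ler_wpM2r.
have -> : `|Y r| = `|Y r * ex 1 r| * ex (-1) r.
  by rewrite -{1}(ger0_norm e0) -normrM -mulrA e1 mulr1.
by rewrite ler_wpM2r.
Qed.

(** By [asub], this is at most twice the damping at [r] plus twice the damping at [r + h0], for
    every [r]; it is therefore a guaranteed decay power. *)
Definition P0 := - a h0.

(* [V r * V (r + h0) * (r + h0) ^ P0] is nonincreasing, by [asub] with [h := h0]. *)
Lemma V_far r : h0 <= r -> V (r + h0) ^+ 2 <= V h0 ^+ 2 * (2 * h0 / (r + h0)) `^ P0.
Proof.
move=> hr; have hp := h0_gt0.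
have rp : 0 < r by lra.
pose W r := V r * V (r + h0) * (r + h0) `^ P0.
pose W' r := (2 * a r * V r / r * V (r + h0) + V r * (2 * a (r + h0) * V (r + h0) / (r + h0) * (1 + 0)))
    * (r + h0) `^ P0 + V r * V (r + h0) * (P0 * (r + h0) `^ P0 / (r + h0) * (1 + 0)).
have : W r <= W h0.
  apply: (@der_nonincr _ W W') => //.
    move=> x /andP[hx _]; have x0 : 0 < x by lra.
    have xh : 0 < x + h0 by lra.
    have D := derD (der_id x) (derC h0 x).
    apply: derM; first apply: derM.
    - exact: der_V.
    - exact: (@der_comp _ V (fun y => y + h0) x _ _ (der_V xh) D).
    - exact: (@der_comp _ (fun y => y `^ P0) (fun y => y + h0) x _ _ (der_powR P0 xh) D).
  move=> x /andP[hx xr]; have x0 : 0 < x by lra.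
  have xh : 0 < x + h0 by lra.
  rewrite (_ : W' x = (2 * a x / x + 2 * a (x + h0) / (x + h0) + P0 / (x + h0)) *
     (V x * V (x + h0) * (x + h0) `^ P0)); last by rewrite /W'; field; rewrite !gt_eqF.
  apply: mulr_le0_ge0; last by rewrite !mulr_ge0 ?V_ge0 ?powR_ge0.
  (* As [a x <= 0], the larger denominator only weakens the damping; all terms then share the
     denominator [x + h0] and [asub] applies. *)
  have k : a x / x <= a x / (x + h0).
    have := ale0 x => ax.
    by rewrite ler_wnM2l// lef_pV2 ?posrE//; lra.
  apply: (@le_trans _ _ ((2 * a x + 2 * a (x + h0) + P0) / (x + h0))).
    rewrite [leRHS](_ : _ = 2 * (a x / (x + h0)) + 2 * a (x + h0) / (x + h0) + P0 / (x + h0)); last by ring.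
    apply: lerD => //; apply: lerD => //; rewrite -mulrA; exact: ler_wpM2l.
  rewrite pmulr_lle0 ?invr_gt0//.
  by have := asub x h0; rewrite /P0; lra.
rewrite /W => k1.
(* Monotonicity of [V] bounds the product at the two points below by a square at the later one; [V2]
   does the converse at the starting point. *)
have V1 : V (r + h0) ^+ 2 <= V r * V (r + h0).
  by rewrite expr2 ler_wpM2r ?V_ge0// V_nonincr//; lra.
have V2 : V h0 * V (h0 + h0) <= V h0 ^+ 2.
  by rewrite expr2 ler_wpM2l ?V_ge0// V_nonincr//; lra.
have rh : 0 < r + h0 by lra.
have q0 : 0 < (r + h0) `^ P0 by exact: powR_gt0.
apply: le_trans V1 _.
have h2 : 0 <= 2 * h0 by lra.
have E : (2 * h0 / (r + h0)) `^ P0 = (2 * h0) `^ P0 / (r + h0) `^ P0.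
  rewrite powRM ?invr_ge0//; last exact: ltW.
  congr (_ * _); rewrite -(powR_inv1 (ltW rh)) -powRrM mulN1r.
  by rewrite powRN.
rewrite E mulrA ler_pdivlMr//.
apply: le_trans k1 _.
rewrite (_ : h0 + h0 = 2 * h0); last by ring.
by rewrite (_ : 2 * h0 = h0 + h0) ?ler_wpM2r ?powR_ge0//; ring.
Qed.

Variables (d M : nat).
Hypothesis deltaM : delta <= M%:R.
Hypothesis epsd : eps * (8 * d + 1)%:R <= r0.

(** [K1] serves below [h0], [K2] and [K3] serve beyond it for the stable law and the equilibrium.
    The integer [M >= delta] replaces the real power of [eps]. None of them involves [p], which is
    the uniformity in [s]. *)
Definition K1 : R := 2 ^+ d * (2 ^+ (2 * M + 4 + 2 * d) * (2 * M + 4 + 2 * d)`!%:R).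
Definition K2 : R := 2 ^+ d * ((2 * d + 2 * M)`!%:R * r0^-1 ^+ (2 * M)).
Definition K3 : R := 1 + 2 ^+ (6 * d) * ((4 * d + 4 * M)`!%:R * r0^-1 ^+ (4 * M)).
Definition Kfin : R := 8 * C0 ^+ 2 * K1 + (2 * K2 + 2 * K3).

Lemma h0_ge : (8 * d + 1)%:R <= h0.
Proof. by rewrite /h0 ler_pdivlMr// mulrC. Qed.

Lemma h0_ge1 : 1 <= h0.
Proof. by apply: le_trans h0_ge; rewrite ler1n addn1. Qed.

Lemma powM_le (r : R) : 1 <= r -> r `^ delta <= r ^+ M.
Proof. by move=> r1; rewrite -powR_mulrn; [exact: ler_powR|exact: le_trans ler01 r1]. Qed.

Lemma epsM_le : eps ^+ M <= eps `^ delta.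
Proof.
rewrite -powR_mulrn; last exact: ltW.
by apply: ger_powR => //; rewrite eps0.
Qed.

Lemma h0inv (n : nat) : h0^-1 ^+ n = r0^-1 ^+ n * eps ^+ n.
Proof. by rewrite /h0 invf_div -exprMn mulrC. Qed.

Lemma ex1_le r : 1 <= r -> ex (-1) r <= expR (- (r / 2)).
Proof.
move=> r1; rewrite /ex ler_expR mulN1r mulNr lerN2.
have h : r <= r `^ p by exact: le1r_powR.
have r0' : 0 < r := lt_le_trans ltr01 r1.
apply: le_trans (ler_wpM2r _ h); last by rewrite invr_ge0 ltW// p_gt0.
apply: ler_wpM2l; first exact: ltW.
by rewrite lef_pV2 ?posrE ?p_gt0.
Qed.

Lemma ex_le1 r : 0 <= r -> ex (-1) r <= 1.
Proof.
move=> r_ge0; rewrite /ex -[leRHS]expR0 ler_expR mulN1r mulNr oppr_le0 divr_ge0 ?powR_ge0//.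
by rewrite ltW// p_gt0.
Qed.

(** For [r >= 1], [delta <= M] and [p <= 2] replace the real powers by natural ones, while
    [r^p / p >= r / 2] provides an exponential independent of [p]. *)
Lemma near_poly r : 0 < r -> (r `^ delta * r `^ p) ^+ 2 * ex (-1) r * (1 + r ^+ 2) ^+ d <= K1.
Proof.
move=> rp; have e0 : 0 <= ex (-1) r by exact: expR_ge0.
have a0 : 0 <= r `^ delta * r `^ p by rewrite mulr_ge0 ?powR_ge0.
have [r1|/ltW r1] := leP r 1.
  have k1 : r `^ delta * r `^ p <= 1.
    have h (q : R) : 0 <= q -> r `^ q <= 1.
      by move=> q0; rewrite -[leRHS](powRr0 r); apply: ger_powR; rewrite ?rp.
    by apply: mulr_ile1; rewrite ?powR_ge0 ?h ?(ltW delta0) ?(ltW p_gt0).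
  have k2 : (r `^ delta * r `^ p) ^+ 2 * ex (-1) r <= 1.
    by apply: mulr_ile1; rewrite ?exprn_ge0 ?expr_le1 ?ex_le1 ?(ltW rp).
  have k3 : (1 + r ^+ 2) ^+ d <= 2 ^+ d.
    rewrite lerXn2r ?nnegrE ?addr_ge0 ?sqr_ge0//.
    have : r ^+ 2 <= 1 by rewrite expr_le1// ltW.
    lra.
  apply: (@le_trans _ _ (1 * 2 ^+ d)).
    have q0 : 0 <= (1 + r ^+ 2) ^+ d by rewrite exprn_ge0// addr_ge0// sqr_ge0.
    exact: (ler_pM (mulr_ge0 (sqr_ge0 _) e0) q0 k2 k3).
  have k4 : 1 <= 2 ^+ (2 * M + 4 + 2 * d) :> R by apply: exprn_ege1; rewrite ler1n.
  have k5 : 1 <= (2 * M + 4 + 2 * d)`!%:R :> R by rewrite ler1n fact_gt0.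
  by rewrite mul1r /K1 ler_peMr ?exprn_ge0//; exact: mulr_ege1.
have k1 : r `^ delta * r `^ p <= r ^+ (M + 2).
  rewrite exprD ler_pM ?powR_ge0 ?powM_le//.
  by rewrite -(powR_mulrn 2 (ltW rp)); exact: ler_powR.
apply: (@le_trans _ _ ((r ^+ (M + 2)) ^+ 2 * expR (- (r / 2)) * (2 ^+ d * r ^+ (2 * d)))).
  have q0 : 0 <= (1 + r ^+ 2) ^+ d by rewrite exprn_ge0// addr_ge0// sqr_ge0.
  apply: ler_pM q0 _ (sq1_le d r1); first exact: mulr_ge0 (sqr_ge0 _) e0.
  apply: ler_pM (sqr_ge0 _) e0 _ (ex1_le r1).
  by rewrite lerXn2r ?nnegrE ?exprn_ge0// ltW.
have E : (r ^+ (M + 2)) ^+ 2 * r ^+ (2 * d) = r ^+ (2 * M + 4 + 2 * d).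
  by rewrite -exprM -exprD mulnDl [(M * 2)%N]mulnC.
rewrite (_ : _ * _ = 2 ^+ d * (r ^+ (2 * M + 4 + 2 * d) * expR (- (r / 2)))); last by rewrite -E; ring.
by rewrite /K1 ler_wpM2l ?exprn_ge0// exp_poly2// ltW.
Qed.

(** The squared modulus of the difference of the two transforms. *)
Definition Dq r := (X r - ex (-1) r) ^+ 2 + Y r ^+ 2.

(** The square of [Bd r * ex (-1) r] contains [ex (1/2) r ^ 2 * ex (-1) r ^ 2 = ex (-1) r], and this
    remaining exponential absorbs all powers of [r], the weight included. *)
Lemma D_near r : 0 < r -> r <= h0 ->
  Dq r * (1 + r ^+ 2) ^+ d <= 8 * C0 ^+ 2 * K1 * (eps `^ delta) ^+ 2.
Proof.
move=> rp rh; have [h1 h2] := diff_near rp rh.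
have B0 := Bd_ge0 rp; have e0 : 0 <= ex (-1) r by exact: expR_ge0.
have k : Dq r <= 2 * (Bd r * ex (-1) r) ^+ 2.
  rewrite mulr2n mulrDl mul1r /Dq; apply: lerD.
    by rewrite -real_normK ?num_real// lerXn2r ?nnegrE// mulr_ge0.
  by rewrite -real_normK ?num_real// lerXn2r ?nnegrE// mulr_ge0.
have E : 2 * (Bd r * ex (-1) r) ^+ 2 = 8 * C0 ^+ 2 * (eps `^ delta) ^+ 2 *
    ((r `^ delta * r `^ p) ^+ 2 * ex (-1) r).
  have ee : ex (1/2) r ^+ 2 * ex (-1) r = 1.
    rewrite /ex -expRM_natl -expRD -[RHS]expR0; congr expR; field.
    by rewrite gt_eqF// p_gt0.
  rewrite /Bd.
  transitivity (8 * C0 ^+ 2 * eps `^ delta ^+ 2 * ((r `^ delta * r `^ p) ^+ 2 * ex (-1) r) *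
    (ex (1 / 2) r ^+ 2 * ex (-1) r)); last by rewrite ee mulr1.
  ring.
have q0 : 0 <= (1 + r ^+ 2) ^+ d by rewrite exprn_ge0// addr_ge0// sqr_ge0.
apply: le_trans (ler_wpM2r q0 k) _.
rewrite E -[leLHS]mulrA [leRHS]mulrAC.
apply: ler_wpM2l; last exact: near_poly.
by apply: mulr_ge0; [apply: mulr_ge0 => //|]; exact: sqr_ge0.
Qed.

(** For [r >= h0 = r0 / eps] the exponential pays for the weight and for [2 M] further powers of
    [r], which become [eps^(2 M)]. *)
Lemma psi_far r : h0 <= r -> ex (-1) r ^+ 2 * (1 + r ^+ 2) ^+ d <= K2 * (eps `^ delta) ^+ 2.
Proof.
move=> hr; have r1 : 1 <= r := le_trans h0_ge1 hr.
have rp : 0 < r := lt_le_trans ltr01 r1.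
have k1 : ex (-1) r ^+ 2 <= expR (- r).
  rewrite (_ : - r = 2 * - (r / 2)); last by field.
  rewrite -[2 * _]/(2%:R * _) expRM_natl lerXn2r ?nnegrE ?expR_ge0//.
  exact: ex1_le.
have q0 : 0 <= (1 + r ^+ 2) ^+ d by rewrite exprn_ge0// addr_ge0// sqr_ge0.
apply: le_trans (ler_pM (sqr_ge0 _) q0 k1 (sq1_le d r1)) _.
rewrite mulrCA [expR _ * _]mulrC.
have := exp_tail (2 * d) (2 * M) h0_gt0 hr.
rewrite h0inv => k2.
apply: (le_trans (ler_wpM2l (exprn_ge0 d (ler0n _ 2)) k2)).
rewrite /K2 -!mulrA; apply: ler_wpM2l; first by rewrite exprn_ge0.
apply: ler_wpM2l => //; apply: ler_wpM2l; first by rewrite exprn_ge0// invr_ge0 ltW.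
rewrite mulnC exprM lerXn2r ?nnegrE ?powR_ge0 ?epsM_le//.
by rewrite exprn_ge0// ltW.
Qed.

Lemma V_far2 r : h0 <= r -> V r ^+ 2 * (1 + r ^+ 2) ^+ (2 * d) <=
  2 ^+ (6 * d) * (h0 ^+ (4 * d) * expR (- h0)).
Proof.
move=> hr; have h1 := h0_ge1; have hp := h0_gt0; have r1 : 1 <= r := le_trans h1 hr.
have rp : 0 < r := lt_le_trans ltr01 r1.
have Vh : V h0 ^+ 2 <= expR (- h0).
  rewrite (_ : - h0 = 2 * - (h0 / 2)); last by field.
  rewrite -[2 * _]/(2%:R * _) expRM_natl lerXn2r ?nnegrE ?expR_ge0 ?V_ge0//.
  by apply: le_trans (V_near hp (lexx _)) _; exact: ex1_le.
have q0 : 0 <= (1 + r ^+ 2) ^+ (2 * d) by rewrite exprn_ge0// addr_ge0// sqr_ge0.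
have e0 := expR_ge0 (- h0).
have s1 := sq1_le (2 * d) r1.
have E6 : 2 ^+ (6 * d) * (h0 ^+ (4 * d) * expR (- h0)) =
    expR (- h0) * (2 ^+ (2 * d) * (2 * h0) ^+ (4 * d)).
  have -> : 2 ^+ (6 * d) = 2 ^+ (2 * d) * 2 ^+ (4 * d) :> R by rewrite -exprD -mulnDl.
  rewrite (exprMn _ 2); move: (2 ^+ (2 * d)) (2 ^+ (4 * d)) (h0 ^+ _) (expR _) => u v w z; ring.
rewrite E6.
(* Up to [2 * h0] monotonicity of [V] suffices; further out [V_far] is applied at [r - h0], which is
   then at least [h0]. *)
have [r2|/ltW r2] := leP (2 * h0) r; last first.
  have k1 : V r ^+ 2 <= expR (- h0).
    apply: le_trans Vh; rewrite lerXn2r ?nnegrE ?V_ge0//.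
    by apply: V_nonincr => //; exact: ltW.
  apply: ler_pM => //; first exact: sqr_ge0.
  apply: le_trans s1 _; apply: ler_wpM2l; first by rewrite exprn_ge0.
  by rewrite mulnA lerXn2r// nnegrE ?(ltW rp)// mulr_ge0// ltW.
have hr' : h0 <= r - h0 by rewrite lerBrDr -mulr2n -mulr_natl.
have := V_far hr'; rewrite subrK => k1.
(* Origin of the factor 8 in [epsd]: [P0 >= h0^p / 2 >= h0 / 2 >= 4 d], the power needed against the
   growth [r^(4 d)] of the squared weight. *)
have P0ge : (4 * d)%:R <= P0.
  have [k2 _ _] := coef_near hp (lexx _).
  have k3 : h0 <= h0 `^ p by exact: le1r_powR.
  have k4 : (8 * d)%:R <= h0 by apply: le_trans h0_ge; rewrite ler_nat leq_addr.
  have k5 : (8 * d)%:R = 2 * (4 * d)%:R :> R by rewrite -natrM mulnA.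
  by rewrite /P0; move: k2 k3 k4; rewrite k5; lra.
have q1 : 0 < 2 * h0 / r by apply: divr_gt0 => //; exact: mulr_gt0.
have q2 : 2 * h0 / r <= 1 by rewrite ler_pdivrMr// mul1r.
have k2 : (2 * h0 / r) `^ P0 <= (2 * h0 / r) ^+ (4 * d).
  by rewrite -(powR_mulrn _ (ltW q1)); apply: ger_powR => //; rewrite q1.
have k3 : V r ^+ 2 <= expR (- h0) * (2 * h0 / r) ^+ (4 * d).
  apply: le_trans k1 _; apply: ler_pM => //; [exact: sqr_ge0|exact: powR_ge0].
apply: le_trans (ler_pM (sqr_ge0 _) q0 k3 s1) _.
rewrite expr_div_n mulnA.
have rn : r ^+ (2 * 2 * d) != 0 by rewrite expf_neq0// gt_eqF.
rewrite le_eqVlt; apply/orP; left; apply/eqP.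
move: ((2 * h0) ^+ (4 * d)) (r ^+ (2 * 2 * d)) (2 ^+ (2 * d)) rn => u v w vn; field.
exact: vn.
Qed.

Lemma V_far3 r : h0 <= r -> V r * (1 + r ^+ 2) ^+ d <= K3 * (eps `^ delta) ^+ 2.
Proof.
move=> hr; have := V_far2 hr.
have := exp_tail (4 * d) (4 * M) h0_gt0 (lexx h0).
rewrite h0inv => k1 k2.
have q0 : 0 <= (1 + r ^+ 2) ^+ d by rewrite exprn_ge0// addr_ge0// sqr_ge0.
set k3' := 2 ^+ (6 * d) * ((4 * d + 4 * M)`!%:R * r0^-1 ^+ (4 * M)) : R.
have k3'0 : 0 <= k3' by rewrite /k3' !mulr_ge0 ?exprn_ge0// invr_ge0 ltW.
have K3E : K3 = 1 + k3' by [].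
have eM0 : 0 <= eps ^+ M by rewrite exprn_ge0// ltW.
have k4 : (V r * (1 + r ^+ 2) ^+ d) ^+ 2 <= k3' * (eps ^+ M) ^+ 4.
  have -> : (V r * (1 + r ^+ 2) ^+ d) ^+ 2 = V r ^+ 2 * (1 + r ^+ 2) ^+ (2 * d).
    by rewrite exprMn -(exprM _ d) [(d * 2)%N]mulnC.
  apply: le_trans k2 _.
  rewrite -(exprM eps) (mulnC M) /k3' -!mulrA; apply: ler_wpM2l; first by rewrite exprn_ge0.
  exact: k1.
(* The summand 1 in [K3] gives [k3' <= K3 ^ 2], so a square root can be taken without leaving
   polynomial constants. *)
have k5 : (V r * (1 + r ^+ 2) ^+ d) ^+ 2 <= (K3 * (eps ^+ M) ^+ 2) ^+ 2.
  apply: le_trans k4 _; rewrite [leRHS]exprMn -(exprM _ 2 2); apply: ler_wpM2r; first by rewrite exprn_ge0.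
  by rewrite K3E; move: k3'0; nra.
have K30 : 0 <= K3 by rewrite K3E addr_ge0.
rewrite ler_pXn2r ?nnegrE ?mulr_ge0 ?V_ge0 ?sqr_ge0// in k5.
apply: le_trans k5 _; apply: ler_wpM2l => //.
by rewrite lerXn2r ?nnegrE ?powR_ge0 ?epsM_le.
Qed.

Lemma K123_ge0 : [/\ 0 <= K1, 0 <= K2 & 0 <= K3].
Proof.
split; rewrite /K1 /K2 /K3 ?addr_ge0// !mulr_ge0 ?exprn_ge0// invr_ge0 ltW//.
Qed.

(** Below [h0] the transforms are compared; beyond it no comparison is attempted, since each of them
    is small by itself. *)
Theorem decay_bound r : 0 < r -> Dq r * (1 + r ^+ 2) ^+ d <= Kfin * (eps `^ delta) ^+ 2.
Proof.
move=> rp; have [K10 K20 K30] := K123_ge0.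
have q0 : 0 <= (1 + r ^+ 2) ^+ d by rewrite exprn_ge0// addr_ge0// sqr_ge0.
have e0 : 0 <= (eps `^ delta) ^+ 2 by exact: sqr_ge0.
have [rh|/ltW rh] := leP r h0.
  apply: le_trans (D_near rp rh) _; apply: ler_wpM2r => //.
  by rewrite /Kfin lerDl addr_ge0// mulr_ge0.
have k : Dq r <= 2 * ex (-1) r ^+ 2 + 2 * V r.
  by rewrite /Dq /V; have := sqr_ge0 (X r + ex (-1) r); have := sqr_ge0 (Y r); nra.
apply: le_trans (ler_wpM2r q0 k) _.
have k1 := psi_far rh; have k2 := V_far3 rh.
have -> : (2 * ex (-1) r ^+ 2 + 2 * V r) * (1 + r ^+ 2) ^+ d =
  2 * (ex (-1) r ^+ 2 * (1 + r ^+ 2) ^+ d) + 2 * (V r * (1 + r ^+ 2) ^+ d) by ring.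
apply: (@le_trans _ _ ((2 * K2 + 2 * K3) * (eps `^ delta) ^+ 2)).
  have -> : (2 * K2 + 2 * K3) * (eps `^ delta) ^+ 2 =
    2 * (K2 * (eps `^ delta) ^+ 2) + 2 * (K3 * (eps `^ delta) ^+ 2) by ring.
  by apply: lerD; exact: ler_wpM2l.
apply: ler_wpM2r => //; rewrite /Kfin lerDr.
by apply: mulr_ge0 => //; apply: mulr_ge0 => //; exact: sqr_ge0.
Qed.

End ode.
End Decay.

(** * Transfer of the ray estimates to the transform of the equilibrium *)

Section EquilibriumFT.
Variable R : realType.
Variable d : nat.
Implicit Types (f g : 'rV[R]_d -> R) (x y xi : 'rV[R]_d).

Local Notation mu := (@leb R d).

Lemma sqrt_sum_ge (u v B : R) : Num.sqrt (u ^+ 2 + v ^+ 2) <= B -> `|u| <= B /\ `|v| <= B.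
Proof.
move=> h; split; apply: le_trans h; rewrite -sqrtr_sqr ler_sqrt ?addr_ge0 ?sqr_ge0//.
  by rewrite lerDl sqr_ge0.
by rewrite lerDr sqr_ge0.
Qed.

Lemma enormZ a x : 0 <= a -> enorm (a *: x) = a * enorm x.
Proof.
move=> a0; rewrite /enorm dotpZl dotpZr mulrA sqrtrM ?mulr_ge0//.
by rewrite -expr2 sqrtr_sqr ger0_norm.
Qed.

Lemma enorm_ge0 x : 0 <= enorm x. Proof. exact: sqrtr_ge0. Qed.

Lemma enorm_eq0 x : enorm x = 0 -> x = 0.
Proof.
move=> /(congr1 (fun t => t ^+ 2)); rewrite enorm_sq expr0n/= => /eqP.
rewrite psumr_eq0 => [|i _]; last by rewrite -expr2 sqr_ge0.
move=> /allP h; apply/rowP => i; rewrite mxE.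
by have := h i (mem_index_enum _); rewrite /= mulf_eq0 orbb => /eqP.
Qed.

Lemma enorm0 : enorm (0 : 'rV[R]_d) = 0.
Proof. by rewrite /enorm dotp0l sqrtr0. Qed.

Lemma ray xi : xi != 0 -> exists w r, [/\ 0 < r, enorm w = 1, enorm xi = r & xi = r *: w].
Proof.
move=> x0; have e0 : 0 < enorm xi.
  by rewrite lt_neqAle enorm_ge0 andbT eq_sym; apply: contra x0 => /eqP /enorm_eq0 ->.
exists ((enorm xi)^-1 *: xi), (enorm xi); split => //.
  by rewrite enormZ ?invr_ge0 ?ltW// mulVf// gt_eqF.
by rewrite scalerA divff ?scale1r// gt_eqF.
Qed.

(** Half of the squared modulus of [e^(i al) + e^(i be) - 2], expanded. *)
Lemma cos_sub_le (al be : R) : 1 - cos (be - al) <= 2 * (1 - cos al) + 2 * (1 - cos be).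
Proof.
rewrite cosB -subr_ge0.
have h1 := cos2Dsin2 al; have h2 := cos2Dsin2 be.
have := addr_ge0 (sqr_ge0 (cos al + cos be - 2)) (sqr_ge0 (sin al + sin be)); lra.
Qed.

(** Integration of the previous inequality against the density. With [x] and [y] at the radii [r]
    and [r + h] of one ray, the difference depends on [h] only; this is [asub]. *)
Lemma pdens_cos_sub f x y : pdens f ->
  1 - fc f (y - x) <= 2 * (1 - fc f x) + 2 * (1 - fc f y).
Proof.
move=> [fi f0 f1].
have E z : 1 - fc f z = \int[mu]_x ((1 - cos (dotp x z)) * f x).
  rewrite -[1 in LHS]f1 /fc -RintB//; last exact: intg_cos.
  by apply: Rint_eq => t; ring.
have I z : intg mu (fun x => (1 - cos (dotp x z)) * f x).
  apply: (intg_eq _ (intgB fi (intg_cos z fi))) => t; ring.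
rewrite !E -!RintZ// -RintD; [|exact: intgZ|exact: intgZ].
apply: Rint_le => //; first by apply: intgD; exact: intgZ.
move=> t; rewrite !mulrA -mulrDl; apply: ler_wpM2r => //.
rewrite (_ : dotp t (y - x) = dotp t y - dotp t x); first exact: cos_sub_le.
by rewrite dotpC dotpDl dotpNl !(dotpC t).
Qed.

Lemma fc_le1 f xi : pdens f -> fc f xi <= 1.
Proof.
move=> [fi f0 f1]; apply: le_trans (ler_norm _) _; apply: le_trans (fc_le _ fi) _.
by rewrite -f1; under [leLHS]Rint_eq do rewrite ger0_norm//.
Qed.

(** The small-frequency expansion of the hypothesis, split into real and imaginary parts. *)
Definition symbol_reg (J : 'rV[R]_d -> R) (s delta C0 : R) := forall xi, enorm xi <= 1 ->
  `|fc J xi - (1 - enorm xi `^ (2 * s))| <= C0 * enorm xi `^ (2 * s + delta) /\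
  `|fs J xi| <= C0 * enorm xi `^ (2 * s + delta).

Section one.
Variables (J F : 'rV[R]_d -> R) (s delta C0 eps : R).
Hypotheses (pJ : pdens J) (s12 : 1/2 < s < 1) (delta0 : 0 < delta) (C00 : 0 < C0).
Hypotheses (eps0 : 0 < eps) (eps1 : eps <= 1).
Hypothesis reg : symbol_reg J s delta C0.
Hypothesis eqF : equilibrium J s eps F.

Lemma eq_pdens : pdens F. Proof. by apply/prob_densityP; case: eqF. Qed.

Lemma epsK : eps `^ (- (2 * s)) * eps `^ (2 * s) = 1.
Proof.
rewrite -powRD; last by rewrite (gt_eqF eps0) implybT.
by rewrite addNr powRr0.
Qed.

Section dir.
Variable w : 'rV[R]_d.
Hypothesis w1 : enorm w = 1.
Let X r := fc F (r *: w).
Let Y r := fs F (r *: w).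
Let a r := eps `^ (- (2 * s)) * (fc J (eps *: (r *: w)) - 1).
Let b r := eps `^ (- (2 * s)) * fs J (eps *: (r *: w)).

(** The scaling [eps^(-2s)] cancels the main power of [eps] and leaves the small factor
    [(eps r)^delta]. *)
Lemma ray_reg (u r : R) : 0 < r -> `|u| <= C0 * (eps * r) `^ (2 * s + delta) ->
  `|eps `^ (- (2 * s)) * u| <= C0 * (eps * r) `^ delta * r `^ (2 * s).
Proof.
move=> r0 h; rewrite normrM (ger0_norm (powR_ge0 _ _)).
apply: le_trans (ler_wpM2l (powR_ge0 _ _) h) _.
have er : eps * r != 0 by rewrite mulf_neq0// gt_eqF.
rewrite powRD; last by rewrite er implybT.
rewrite [(eps * r) `^ (2 * s)]powRM; [|exact: ltW|exact: ltW].
rewrite [leLHS](_ : _ = (eps `^ (- (2 * s)) * eps `^ (2 * s)) * (C0 * (eps * r) `^ delta * r `^ (2 * s))).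
  by rewrite epsK mul1r.
ring.
Qed.

(** Collects the hypotheses of the comparison along a ray, with [p = 2 s]. *)
Lemma ray_data : [/\ 1 <= 2 * s <= 2,
  [/\ continuous X, continuous Y, X 0 = 1 & Y 0 = 0],
  (forall r, 0 < r -> der X r ((a r * X r - b r * Y r) / r)) /\
  (forall r, 0 < r -> der Y r ((a r * Y r + b r * X r) / r)),
  (forall r, a r <= 0) /\ (forall r h, - a h <= 2 * (- a r) + 2 * (- a (r + h))) &
  (forall r, 0 < r -> eps * r <= 1 -> `|a r + r `^ (2 * s)| <= C0 * (eps * r) `^ delta * r `^ (2 * s)) /\
  (forall r, 0 < r -> eps * r <= 1 -> `|b r| <= C0 * (eps * r) `^ delta * r `^ (2 * s))].
Proof.
have FP := eq_pdens; have [Fi F0 F1] := FP.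
have E r : 0 < r -> enorm (eps *: (r *: w)) = eps * r.
  by move=> r0; rewrite !enormZ ?w1 ?mulr1// ltW.
have p0 := powR_ge0 eps (- (2 * s)).
have [cF cF' ode] := equilibrium_ode w eps0 pJ eqF.
split.
- by move: s12 => /andP[? ?]; apply/andP; split; lra.
- split; [exact: cF|exact: cF'| |].
    by rewrite /X scale0r fc0.
  by rewrite /Y scale0r fs0.
- split=> r r0; have [D1 D2] := ode r r0; have [Ec Es] := gencol_FT s (r *: w) eps0 pJ FP.
    by apply: der_eq D1 _; rewrite Ec /a /b /X /Y; ring.
  by apply: der_eq D2 _; rewrite Es /a /b /X /Y; ring.
- split=> [r|r h].
    by rewrite /a mulr_ge0_le0// subr_le0 fc_le1.
  have := pdens_cos_sub (eps *: (r *: w)) (eps *: ((r + h) *: w)) pJ.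
  rewrite -scalerBr -scalerBl [r + h]addrC addrK => H.
  rewrite /a [leRHS](_ : _ = eps `^ (- (2 * s)) * (2 * (1 - fc J (eps *: (r *: w))) +
    2 * (1 - fc J (eps *: ((h + r) *: w))))); last by ring.
  by rewrite -mulrN opprB; exact: ler_wpM2l.
- split=> r r0 er; have := @reg (eps *: (r *: w)); rewrite E// => /(_ er) [h1 h2].
    have := ray_reg r0 h1; congr (`|_| <= _); rewrite /a powRM; [|exact: ltW|exact: ltW].
    rewrite !mulrBr mulrA epsK mul1r; ring.
  exact: ray_reg.
Qed.

End dir.

Lemma eq_small xi : enorm xi <= 1 -> 1 - fc F xi <= (1 + 2 * C0) * enorm xi.
Proof.
move=> x1; have [->|/ray[w [r [r0 w1 xr ->]]]] := eqVneq xi 0.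
  by rewrite fc0 enorm0; case: eq_pdens => _ _ ->; rewrite subrr mulr0.
have [/andP[p1 p2] [cX cY X0 Y0] [dX dY] [a0 asub] [areg breg]] := ray_data w1.
rewrite enormZ ?w1 ?mulr1; last exact: ltW.
have r01 : 0 <= r <= 1 by rewrite ltW//= -xr.
exact: (X_small p1 delta0 C00 eps0 eps1 dX dY cX cY X0 Y0 a0 areg breg r01).
Qed.

Lemma eq_decay (r0 : R) (M : nat) xi : 0 < r0 -> r0 <= 1 -> C0 * r0 `^ delta <= 1 / 2 ->
  delta <= M%:R -> eps * (8 * d + 1)%:R <= r0 ->
  ((fc F xi - expR (- (enorm xi `^ (2 * s)) / (2 * s))) ^+ 2 + fs F xi ^+ 2) *
    (1 + enorm xi ^+ 2) ^+ d <= Kfin C0 r0 d M * (eps `^ delta) ^+ 2.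
Proof.
move=> r00 r01 C0r0 dM epsd; have [->|/ray[w [r [rp w1 xr ->]]]] := eqVneq xi 0.
  have [K1 K2 K3] := @K123_ge0 R r0 r00 d M.
  rewrite fc0 fs0 enorm0; case: eq_pdens => _ _ ->; rewrite powR0; last by move: s12 => /andP[? _]; rewrite mulf_neq0//; lra.
  rewrite oppr0 mul0r expR0 subrr expr0n/= addr0 mul0r mulr_ge0 ?sqr_ge0//.
  apply: addr_ge0; last by rewrite addr_ge0// mulr_ge0.
  by apply: mulr_ge0 => //; apply: mulr_ge0 => //; exact: sqr_ge0.
have [/andP[p1 p2] [cX cY X0 Y0] [dX dY] [a0 asub] [areg breg]] := ray_data w1.
rewrite enormZ ?w1 ?mulr1; last exact: ltW.
have := decay_bound p1 p2 delta0 C00 eps0 eps1 dX dY cX cY X0 Y0 a0 asub areg breg r00 r01 C0r0 dM epsd rp.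
by rewrite /Dq /ex mulN1r.
Qed.

End one.
End EquilibriumFT.

(** * A triangular cutoff on the line and its transform *)

Section Fejer.
Variable R : realType.
Local Notation lam := (@lebesgue_measure R).

Lemma intg_itv (h : R -> R) (a b : R) : continuous h ->
  intg lam (fun t => \1_(`[a, b]) t * h t) /\
  \int[lam]_t (\1_(`[a, b]) t * h t) = \int[lam]_(t in `[a, b]) h t.
Proof.
move=> ch; split; last first.
  rewrite [RHS]Rintegral_mkcond; apply: Rint_eq => r.
  by rewrite patchE indicE; case: ifPn => _; rewrite ?mul1r ?mul0r.
have hi : lam.-integrable `[a, b] (EFin \o h).
  by apply: continuous_compact_integrable; [exact: segment_compact|exact: continuous_subspaceT].
have := hi; rewrite (integrable_mkcond _ _)//; apply: eq_integrable => // x _.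
by rewrite patchE/= indicE; case: ifPn => _; rewrite ?mul1r ?mul0r.
Qed.

(* [tri 0 = 2]: this null set is irrelevant, and the closed intervals suit the fundamental
   theorem of calculus. *)
Definition tri (t : R) : R := \1_(`[0, 1]) t * (1 - t) + \1_(`[-1, 0]) t * (1 + t).

(* The Fourier transform of [tri], a Fejer kernel. *)
Definition fej (x : R) : R := if x == 0 then 1 else 2 * (1 - cos x) / x ^+ 2.

Lemma tri_ge0 t : 0 <= tri t.
Proof.
rewrite /tri !indicE !mem_setE !in_itv/=.
by have [|] := leP 0 t; have [|] := leP t 1; have [|] := leP (-1) t; have [|] := leP t 0;
  rewrite /= ?mul0r ?mul1r; lra.
Qed.

Lemma tri_le2 t : tri t <= 2.
Proof.
rewrite /tri !indicE !mem_setE !in_itv/=.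
by have [|] := leP 0 t; have [|] := leP t 1; have [|] := leP (-1) t; have [|] := leP t 0;
  rewrite /= ?mul0r ?mul1r; lra.
Qed.

Lemma cont_trig (c th x : R) : continuous (fun t => (1 + c * t) * cos (th + x * t)).
Proof.
move=> t; have D : der (fun t => (1 + c * t) * cos (th + x * t)) t
  ((0 + c * 1) * cos (th + x * t) + (1 + c * t) * (- sin (th + x * t) * (0 + x * 1))).
  apply: derM; first by apply: derD; [exact: derC|apply: derZ; exact: der_id].
  apply: der_comp; first exact: der_cos.
  by apply: derD; [exact: derC|apply: derZ; exact: der_id].
exact: der_cont D.
Qed.

Lemma FTC_tri (c th x a b : R) : x != 0 -> a < b ->
  \int[lam]_(t in `[a, b]) ((1 + c * t) * cos (th + x * t)) =
  ((1 + c * b) * sin (th + x * b) / x + c * cos (th + x * b) / x ^+ 2) -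
  ((1 + c * a) * sin (th + x * a) / x + c * cos (th + x * a) / x ^+ 2).
Proof.
move=> x0 ab.
rewrite (FTC2 (F := fun t => (1 + c * t) * sin (th + x * t) / x + c * cos (th + x * t) / x ^+ 2))//.
  exact: cont_trig.
move=> t.
have Dl : der (fun t => th + x * t) t x.
  by apply: der_eq (derD (derC th t) (derZ x (der_id t))) _; ring.
have Dc : der (fun t => 1 + c * t) t c.
  by apply: der_eq (derD (derC 1 t) (derZ c (der_id t))) _; ring.
have D1 := derM (derM Dc (der_comp (der_sin _) Dl)) (derC x^-1 t).
have D2 := derM (derZ c (der_comp (der_cos _) Dl)) (derC (x ^- 2) t).
apply: der_eq (derD D1 D2) _.
by field.
Qed.

Lemma FTC_tri0 (c th a b : R) : a < b ->
  \int[lam]_(t in `[a, b]) ((1 + c * t) * cos (th + 0 * t)) =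
  ((b + c / 2 * b ^+ 2) - (a + c / 2 * a ^+ 2)) * cos th.
Proof.
move=> ab.
rewrite (FTC2 (F := fun t => (t + c / 2 * t ^+ 2) * cos th))//.
- by rewrite mulrBl.
- exact: cont_trig.
move=> t; apply: der_eq (derM (derD (der_id t) (derZ (c / 2) (derX 2 (der_id t)))) (derC (cos th) t)) _.
by rewrite mul0r addr0 /= expr1; field.
Qed.

(** The phase [th] is kept free for the induction on the dimension, where it accumulates the
    coordinates already integrated. By evenness of [tri], only the cosine of the phase survives. *)
Lemma tri_int (th x : R) : intg lam (fun t => tri t * cos (th + x * t)) /\
  \int[lam]_t (tri t * cos (th + x * t)) = cos th * fej x.
Proof.
have [i1 e1] := intg_itv 0 1 (@cont_trig (-1) th x).
have [i2 e2] := intg_itv (-1) 0 (@cont_trig 1 th x).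
have E t : \1_(`[0, 1]) t * ((1 + -1 * t) * cos (th + x * t)) +
  \1_(`[-1, 0]) t * ((1 + 1 * t) * cos (th + x * t)) = tri t * cos (th + x * t).
  by rewrite /tri; ring.
split; first by apply: (intg_eq _ (intgD i1 i2)); exact: E.
transitivity (\int[lam]_t (\1_(`[0, 1]) t * ((1 + -1 * t) * cos (th + x * t))) +
  \int[lam]_t (\1_(`[-1, 0]) t * ((1 + 1 * t) * cos (th + x * t)))).
  by rewrite -RintD//; apply: Rint_eq => t; rewrite E.
rewrite e1 e2 /fej; clear; case: eqVneq => [->|x0].
  by rewrite !FTC_tri0 ?ltrN10//; field.
rewrite !FTC_tri ?ltrN10// !mulr0 !addr0 !mulr1 !mulrN1 cosB cosD; field.
exact: x0.
Qed.

Lemma intg_tri : intg lam tri /\ \int[lam]_t tri t = 1.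
Proof.
have [i e] := tri_int 0 0.
have E t : tri t * cos (0 + 0 * t) = tri t by rewrite mul0r addr0 cos0 mulr1.
split; first by apply: (intg_eq _ i); exact: E.
rewrite -[RHS](_ : cos 0 * fej 0 = 1); last by rewrite cos0 /fej eqxx mulr1.
by rewrite -e; apply: Rint_eq => t; rewrite E.
Qed.

Lemma fej_ge0 x : 0 <= fej x.
Proof.
rewrite /fej; case: ifPn => // _.
by rewrite divr_ge0 ?sqr_ge0// mulr_ge0// subr_ge0 cos_le1.
Qed.

(** From [1 - cos x <= x^2] near 0 and [1 - cos x <= 2] at infinity. *)
Lemma fej_le x : fej x <= 8 * (1 + x ^+ 2)^-1.
Proof.
have h : 0 < 1 + x ^+ 2 by rewrite ltr_pwDl// sqr_ge0.
rewrite ler_pdivlMr// /fej; case: eqVneq => [->|x0]; first by rewrite expr0n/=; lra.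
have x2 : 0 < x ^+ 2 by rewrite lt_neqAle sqr_ge0 andbT eq_sym expf_neq0.
rewrite mulrAC ler_pdivrMr//.
have k1 := cos_geN1 x; have k2 := cos_quad x.
rewrite real_normK ?num_real// ler_norml in k2; move/andP: k2 => [_ k2].
have k3 := cos_le1 x.
nra.
Qed.

Lemma intg_cauchy : intg lam (fun x => (1 + x ^+ 2)^-1).
Proof.
have h0 x : 0 <= (1 + x ^+ 2)^-1 :> R by rewrite invr_ge0 addr_ge0// sqr_ge0.
have mc : mfun (fun x : R => (1 + x ^+ 2)^-1).
  by apply: continuous_measurable_fun; exact: continuous_oneDsqrV.
apply/intg_ge0P => //.
rewrite (@ge0_symfun_integralT _ (fun x => (1 + x ^+ 2)^-1))//; last 2 first.
- exact: continuous_oneDsqrV.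
- by move=> x /=; rewrite sqrrN.
have := integral0y_oneDsqr R; rewrite set_itvcy => ->.
by rewrite -EFinM ltry.
Qed.

(** The half-angle formula: [fej] is the square of [sin (x / 2) / (x / 2)], so its regularity at 0
    is inherited from [phasef]. *)
Lemma fejE x : fej x = phasef 0 1 (x / 2) ^+ 2.
Proof.
rewrite /fej /phasef /qg sin0 cos0 subr0 addr0 mul1r.
have [->|x0] := eqVneq x 0; first by rewrite mul0r eqxx expr1n.
rewrite ifF; last by apply/negbTE; rewrite mulf_neq0// invr_eq0.
rewrite mul1r {1}(_ : x = x / 2 + x / 2); last by field.
have h := cos2Dsin2 (x / 2).
have -> : 1 - cos (x / 2 + x / 2) = 2 * sin (x / 2) ^+ 2 by rewrite cosD -!expr2; lra.
field.
exact: x0.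
Qed.

Lemma cont_fej : continuous fej.
Proof.
have [g' H] := @phasefP R 0 1 ltr01; have D : forall u, der (phasef 0 1) u (g' u) by case: H.
move=> x; rewrite (_ : fej = fun x => phasef 0 1 (x / 2) ^+ 2); last by apply/funext => y; exact: fejE.
have Dh : der (fun y : R => y / 2) x (1 / 2).
  by apply: der_eq (derM (der_id x) (derC 2^-1 x)) _; ring.
exact: der_cont (derX 2 (der_comp (D _) Dh)).
Qed.

Lemma intg_fej : intg lam fej.
Proof.
apply: (intg_le _ (intgZ 8 intg_cauchy)); last first.
  by move=> x; rewrite ger0_norm ?fej_ge0// fej_le.
by apply: continuous_measurable_fun; exact: cont_fej.
Qed.

Lemma fej_ge_half x : 0 <= x <= 1 / 8 -> 1 / 2 <= fej x.
Proof.
move=> /andP[x0 x1]; rewrite /fej; have [//|xn] := eqVneq x 0; first lra.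
have xp : 0 < x by rewrite lt_neqAle eq_sym xn.
rewrite ler_pdivlMr ?exprn_gt0//.
have := cos_cub x; rewrite (ger0_norm x0) ler_norml => /andP[h _].
have : x ^+ 3 <= x ^+ 2 * (1 / 8) by rewrite exprSr ler_wpM2l ?sqr_ge0.
lra.
Qed.

(** The exact value plays the role of [2 pi], but positivity is enough; the lower bound comes from
    the interval [[0, 1/8]], where [fej >= 1/2]. *)
Lemma fej_mass : 0 < \int[lam]_x fej x.
Proof.
have cc : continuous (fun _ : R => 1 / 2 : R) by move=> x; exact: cvg_cst.
have [i e] := intg_itv 0 (1 / 8) cc.
have le8 : 0 < 1 / 8 :> R by lra.
have E : \int[lam]_(t in `[0, 1 / 8]) (1 / 2) = 1 / 16 :> R.
  rewrite (FTC2 (F := fun t => 1 / 2 * t))//; first by field.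
  by move=> x; apply: der_eq (derZ _ (der_id x)) _; rewrite mulr1.
apply: (@lt_le_trans _ _ (1 / 16)); first lra.
rewrite -E -e; apply: Rint_le => //; first exact: intg_fej.
move=> x; rewrite indicE mem_setE in_itv/=.
by case: (boolP (_ && _)) => [/fej_ge_half|_]; rewrite ?mul1r ?mul0r ?fej_ge0.
Qed.

End Fejer.

(** * Product functions on R^d *)

Section Product.
Variable R : realType.
Local Notation lam := (@lebesgue_measure R).

Definition prodf d (h : R -> R) (x : 'rV[R]_d) := \prod_(i < d) h (x ord0 i).

Lemma prodf_ge0 h d x : (forall t, 0 <= h t) -> 0 <= @prodf d h x.
Proof. by move=> h0; rewrite prodr_ge0. Qed.

Lemma prodf_cons1 h n t (y : 'rV[R]_n) : prodf h (cons1 (t, y)) = h t * prodf h y.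
Proof.
rewrite /prodf big_ord_recl cons1_0; congr (_ * _).
by apply: eq_bigr => i _; rewrite cons1_S.
Qed.

Lemma meas_prodf h d : mfun h -> mfun (@prodf d h : bor R d -> R).
Proof.
move=> mh; apply: measurable_prod => i _.
exact: (measurableT_comp mh (@meas_coord R d i)).
Qed.

Lemma RintS n (f : bor R n.+1 -> R) (g : R -> R) : mfun f ->
  (forall x, 0 <= f x) -> intg lam g ->
  (forall t, intg (leb R n) (fun y => f (cons1 (t, y))) /\
     \int[leb R n]_y f (cons1 (t, y)) = g t) ->
  intg (leb R n.+1) f /\ \int[leb R n.+1]_x f x = \int[lam]_t g t.
Proof.
move=> mf f0 gi H.
have g0 t : 0 <= g t by rewrite -(H t).2 Rint_ge0.
have E : (\int[leb R n.+1]_x (f x)%:E = (\int[lam]_t g t)%:E)%E.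
  rewrite lebS//; last exact/measurable_EFinP.
  rewrite Rint_fin//; apply: eq_integral => t _.
  by have [h1 h2] := H t; rewrite -Rint_fin// h2.
by split; [apply/intg_ge0P => //; rewrite E ltry|rewrite /Rintegral E].
Qed.

Lemma Rint0 (f : bor R 0 -> R) : mfun f -> (forall x, 0 <= f x) ->
  intg (leb R 0) f /\ \int[leb R 0]_x f x = f (0 : 'rV[R]_0).
Proof.
move=> mf f0.
have E : (\int[leb R 0]_x (f x)%:E = (f (0 : 'rV[R]_0))%:E)%E.
  by rewrite leb0//; exact/measurable_EFinP.
by split; [apply/intg_ge0P => //; rewrite E ltry|rewrite /Rintegral E].
Qed.

Lemma prodf_int h d : intg lam h -> (forall t, 0 <= h t) ->
  intg (leb R d) (prodf h) /\ \int[leb R d]_x prodf h x = (\int[lam]_t h t) ^+ d.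
Proof.
move=> hi h0; have mh := intg_meas hi.
elim: d => [|n [IH1 IH2]].
  have [||h1 h2] := @Rint0 (prodf h).
  - exact: meas_prodf.
  - by move=> x; exact: prodf_ge0.
  - by split; rewrite // h2 /prodf big_ord0.
rewrite exprSr -RintZ//.
apply: RintS.
- exact: meas_prodf.
- by move=> x; exact: prodf_ge0.
- exact: intgZ.
- move=> t; split; first by apply: (intg_eq _ (intgZ (h t) IH1)) => y; rewrite prodf_cons1.
  by rewrite mulrC -IH2 -RintZ//; apply: Rint_eq => y; rewrite prodf_cons1.
Qed.

Lemma dotp_cons1 n (x : 'rV[R]_n.+1) t (y : 'rV[R]_n) :
  dotp x (cons1 (t, y)) = x ord0 ord0 * t + dotp (\row_j x ord0 (lift ord0 j)) y.
Proof.
rewrite /dotp big_ord_recl cons1_0; congr (_ + _).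
by apply: eq_bigr => i _; rewrite cons1_S mxE.
Qed.

(** The cosine is shifted by 1 to keep the integrand nonnegative, so that coordinates can be split
    off by Tonelli; the shift contributes the total mass 1 of the product of [tri]. *)
Lemma tri_cos_prod d th (x : 'rV[R]_d) :
  intg (leb R d) (fun xi => prodf (@tri R) xi * (1 + cos (th + dotp x xi))) /\
  \int[leb R d]_xi (prodf (@tri R) xi * (1 + cos (th + dotp x xi))) =
  1 + cos th * prodf (@fej R) x.
Proof.
have [ti t1] := intg_tri R.
have P0 n e (xi : 'rV[R]_n) : 0 <= prodf (@tri R) xi * (1 + cos e).
  apply: mulr_ge0; first by apply: prodf_ge0; exact: tri_ge0.
  by have := cos_geN1 e; lra.
have M n e (z : 'rV[R]_n) : mfun
    (fun xi : bor R n => prodf (@tri R) xi * (1 + cos (e + dotp z xi))).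
  apply: measurable_funM; first exact: meas_prodf (intg_meas ti).
  apply: measurable_funD => //; apply: (measurableT_comp (@meas_cos R)).
  by apply: measurable_funD => //; exact: meas_dotp.
elim: d th x => [|n IH] th x.
  have [h1 h2] := @Rint0 _ (M 0%N th x) (fun xi => P0 _ _ xi).
  split=> //; rewrite h2 /prodf !big_ord0 !mul1r.
  by rewrite /dotp big_ord0 addr0 mulr1.
set P := prodf (@fej R) (\row_j x ord0 (lift ord0 j)).
have [ci ce] := tri_int th (x ord0 ord0).
have gi : intg lam (fun t => tri t + P * (tri t * cos (th + x ord0 ord0 * t))).
  by apply: intgD => //; exact: intgZ.
have -> : 1 + cos th * prodf (@fej R) x =
    \int[lam]_t (tri t + P * (tri t * cos (th + x ord0 ord0 * t))).
  rewrite RintD//; last exact: intgZ.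
  rewrite RintZ// ce t1; congr (_ + _).
  rewrite /prodf big_ord_recl mulrA [RHS]mulrC; congr (_ * _).
  by rewrite /P /prodf; apply: eq_bigr => i _; rewrite mxE.
apply: RintS => //.
move=> t; have [h1 h2] := IH (th + x ord0 ord0 * t) (\row_j x ord0 (lift ord0 j)).
have E y : tri t * (prodf (@tri R) y * (1 + cos (th + x ord0 ord0 * t + dotp (\row_j x ord0 (lift ord0 j)) y)))
    = prodf (@tri R) (cons1 (t, y)) * (1 + cos (th + dotp x (cons1 (t, y)))).
  by rewrite prodf_cons1 dotp_cons1 !addrA mulrA.
split; first by apply: (intg_eq _ (intgZ (tri t) h1)) => y; exact: E.
transitivity (tri t * (1 + cos (th + x ord0 ord0 * t) * P)); last by ring.
by rewrite -h2 -RintZ//; apply: Rint_eq => y; rewrite E.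
Qed.

Lemma tri_FT d (x : 'rV[R]_d) :
  [/\ intg (leb R d) (prodf (@tri R)), fc (prodf (@tri R)) x = prodf (@fej R) x &
    \int[leb R d]_xi prodf (@tri R) xi = 1].
Proof.
have [ti t1] := intg_tri R.
have [h1 h2] := @prodf_int _ d ti (@tri_ge0 R).
rewrite t1 expr1n in h2; split=> //.
have [k1 k2] := tri_cos_prod 0 x; rewrite cos0 mul1r in k2.
apply: (addrI 1); rewrite -k2 -[X in X + _]h2 -RintD//; last exact: intg_cos.
by apply: Rint_eq => xi; rewrite add0r dotpC; ring.
Qed.

End Product.

(** * A regularized pairing expressed through Fourier transforms *)

Section Bilinear.
Variable R : realType.
Variable d : nat.
Implicit Types (f g : 'rV[R]_d -> R) (x y z xi : 'rV[R]_d).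

Local Notation mu := (@leb R d).
Local Notation lam := (@lebesgue_measure R).

(** Takes the place of [(2 pi)^d]. *)
Definition mass : R := (\int[lam]_t fej t) ^+ d.

Lemma mass_gt0 : 0 < mass. Proof. by rewrite exprn_gt0// fej_mass. Qed.

Definition pfej : 'rV[R]_d -> R := prodf (@fej R).

(** A cutoff in frequency with compact support, whose transform is an approximate identity up to the
    factor [mass]. *)
Definition cutk (eta : R) xi := prodf (@tri R) (eta *: xi).

Lemma pfej_ge0 x : 0 <= pfej x.
Proof. by apply: prodf_ge0; exact: fej_ge0. Qed.

Lemma pfej_int : intg mu pfej /\ \int[mu]_x pfej x = mass.
Proof. by have := prodf_int d (intg_fej R) (@fej_ge0 R). Qed.

Lemma cutk_ge0 eta xi : 0 <= cutk eta xi.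
Proof. by apply: prodf_ge0; exact: tri_ge0. Qed.

Lemma cutk_le eta xi : cutk eta xi <= 2 ^+ d.
Proof.
rewrite /cutk /prodf -[d in leRHS]card_ord -prodr_const.
by apply: ler_prod => i _; rewrite tri_ge0 tri_le2.
Qed.

Lemma cutk_FT eta z : 0 < eta -> intg mu (cutk eta) /\ fc (cutk eta) z = rescale pfej eta z.
Proof.
move=> e0; have en0 : eta != 0 by rewrite gt_eqF.
have [ti te _] := tri_FT (eta^-1 *: z).
have [h1 _] := Rint_affine 0 en0 ti.
split; first by apply: (intg_eq _ h1) => x; rewrite addr0.
rewrite /rescale -/pfej /pfej -te /fc.
have [_ ->] := Rint_affine 0 en0 (intg_cos (eta^-1 *: z) ti).
rewrite gtr0_norm// mulKf ?expf_neq0//.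
apply: Rint_eq => xi; rewrite addr0 /cutk dotpZl dotpZr mulrA divff ?mul1r//.
Qed.

Definition cau (t : R) := (1 + t ^+ 2)^-1.

(** A positive integrable weight that dominates [(1 + |xi|^2)^(-d)]; being a product, it is
    integrated one coordinate at a time. *)
Definition pcau : 'rV[R]_d -> R := prodf cau.

Lemma cau_gt0 t : 0 < cau t.
Proof. by rewrite invr_gt0 ltr_pwDl// sqr_ge0. Qed.

Lemma pcau_gt0 x : 0 < pcau x.
Proof. by apply: prodr_gt0 => i _; exact: cau_gt0. Qed.

Lemma pcau_int : intg mu pcau.
Proof.
have h t : 0 <= cau t by exact/ltW/cau_gt0.
by have [] := prodf_int d (intg_cauchy R) h.
Qed.

(** Fubini yields measurability only of integrable functions, so the transform is multiplied by the
    weight [pcau] and divided by it afterwards. *)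
Lemma meas_trigint f (h : R -> R) : intg mu f -> mfun h -> (forall t, `|h t| <= 1) ->
  mfun ((fun xi => \int[mu]_x (h (dotp x xi) * f x)) : bor R d -> R).
Proof.
move=> fi mh hb.
have m : mfun (fun p : bor R d * bor R d => h (dotp p.1 p.2)).
  by apply: (measurableT_comp mh); exact: meas_dotp.
have [_ k2] := swap_bdd fi pcau_int m (fun p => hb _).
rewrite (_ : (fun xi => _) = (fun xi => (pcau xi)^-1 * (pcau xi * \int[mu]_x (h (dotp x xi) * f x)))); last first.
  by apply/funext => xi; rewrite mulKf// gt_eqF// pcau_gt0.
apply: measurable_funM; last exact: intg_meas k2.
rewrite (_ : (fun xi => _) = prodf (fun t => 1 + t ^+ 2)); last first.
  by apply/funext => xi; rewrite /pcau /prodf -prodfV; apply: eq_bigr => i _; rewrite /cau invrK.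
by apply: meas_prodf; apply: continuous_measurable_fun; exact: continuous_oneDsqr.
Qed.

Lemma meas_fc f : intg mu f -> mfun (fc f : bor R d -> R).
Proof. by move=> fi; apply: meas_trigint => //; [exact: meas_cos|exact: normr_cos]. Qed.

Lemma meas_fs f : intg mu f -> mfun (fs f : bor R d -> R).
Proof. by move=> fi; apply: meas_trigint => //; [exact: meas_sin|exact: normr_sin]. Qed.

(* [smear eta f g] tends to [mass * int f g] as [eta] tends to 0, and is given by the Fourier
   transforms of [f] and [g]: this replaces Plancherel's theorem. *)
Definition smear (eta : R) f g : R :=
  \int[mu]_x (f x * \int[mu]_y (g y * rescale pfej eta (x - y))).

Lemma smear_inner eta g x : 0 < eta -> intg mu g ->
  \int[mu]_y (g y * rescale pfej eta (x - y)) =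
  \int[mu]_xi (cutk eta xi * (cos (dotp x xi) * fc g xi + sin (dotp x xi) * fs g xi)).
Proof.
move=> e0 gi.
have m : mfun (fun p : bor R d * bor R d => cos (dotp (x - p.1) p.2)).
  by apply: (measurableT_comp (@meas_cos R)); apply: meas_dotp => //; exact: meas_subv.
have [E _] := swap_bdd gi (cutk_FT 0 e0).1 m (fun p => normr_cos _).
transitivity (\int[mu]_y (g y * \int[mu]_xi (cutk eta xi * cos (dotp (x - y) xi)))).
  apply: Rint_eq => y; congr (_ * _); rewrite -(cutk_FT _ e0).2.
  by apply: Rint_eq => xi; rewrite mulrC dotpC.
rewrite E; apply: Rint_eq => xi; congr (_ * _).
rewrite /fc /fs -!RintZ -?RintD; try by [exact: intgZ (intg_cos _ _)|exact: intgZ (intg_sin _ _)|exact: intg_cos|exact: intg_sin].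
by apply: Rint_eq => y; rewrite dotpDl dotpNl cosB; ring.
Qed.

Lemma smear_FT eta f g : 0 < eta -> intg mu f -> intg mu g ->
  smear eta f g = \int[mu]_xi (cutk eta xi * (fc f xi * fc g xi + fs f xi * fs g xi)) /\
  intg mu (fun xi => cutk eta xi * (fc f xi * fc g xi + fs f xi * fs g xi)).
Proof.
move=> e0 fi gi.
pose h (p : bor R d * bor R d) := cos (dotp p.1 p.2) * fc g p.2 + sin (dotp p.1 p.2) * fs g p.2.
pose M := \int[mu]_x `|g x|.
have mc : mfun (fun p : bor R d * bor R d => cos (dotp p.1 p.2)).
  by apply: (measurableT_comp (@meas_cos R)); exact: meas_dotp.
have ms : mfun (fun p : bor R d * bor R d => sin (dotp p.1 p.2)).
  by apply: (measurableT_comp (@meas_sin R)); exact: meas_dotp.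
have mh : mfun h.
  apply: measurable_funD; apply: measurable_funM => //.
    exact: (measurableT_comp (meas_fc gi)).
  exact: (measurableT_comp (meas_fs gi)).
have hM p : `|h p| <= 1 * M + 1 * M.
  apply: le_trans (ler_normD _ _) _; rewrite !normrM.
  by apply: lerD; apply: ler_pM; rewrite ?normr_cos ?normr_sin ?fc_le ?fs_le.
have [E I] := swap_bdd fi (cutk_FT 0 e0).1 mh hM.
have {}E : smear eta f g = \int[mu]_xi (cutk eta xi * \int[mu]_x (h (x, xi) * f x)).
  by rewrite -E; apply: Rint_eq => x; rewrite smear_inner.
suff Ep xi : \int[mu]_x (h (x, xi) * f x) = fc f xi * fc g xi + fs f xi * fs g xi.
  split; first by rewrite E; apply: Rint_eq => xi; rewrite Ep.
  by apply: (intg_eq _ I) => xi; rewrite Ep.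
apply/esym; rewrite mulrC [fs f xi * _]mulrC -!RintZ; [|exact: intg_sin|exact: intg_cos].
rewrite -RintD; [|exact: intgZ (intg_cos _ _)|exact: intgZ (intg_sin _ _)].
by apply: Rint_eq => x; rewrite /h/=; ring.
Qed.

Lemma conv_pfej eta g : 0 < eta -> intg mu g ->
  intg mu (fun x => \int[mu]_y (g y * rescale pfej eta (x - y))) /\
  \int[mu]_x (\int[mu]_y (g y * rescale pfej eta (x - y))) = mass * \int[mu]_y g y.
Proof.
move=> e0 gi; have [pi pm] := pfej_int.
have [ri _ _ rm] := rescale_FT e0 pi.
have [h1 _ h3] := RFubini (intg_conv_kernel ri gi).
have E x y : rescale pfej eta (x - y) * g y = g y * rescale pfej eta (x - y) by rewrite mulrC.
split; first by apply: (intg_eq _ h1) => x; apply: Rint_eq => y; exact: E.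
transitivity (\int[mu]_x \int[mu]_y (rescale pfej eta (x - y) * g y)).
  by apply: Rint_eq => x; apply: Rint_eq => y; rewrite E.
rewrite h3 -RintZ//; apply: Rint_eq => y /=.
have [k1 k2] := Rint_shift (- y) ri.
rewrite mulrC -pm -rm -k2 -RintZ//.
by apply: Rint_eq => x; rewrite E.
Qed.

Lemma smear_affine eta g M x : 0 < eta -> mfun (g : bor R d -> R) ->
  (forall y, `|g y| <= M) ->
  \int[mu]_y (g y * rescale pfej eta (x - y)) = \int[mu]_z (g (x - eta *: z) * pfej z).
Proof.
move=> e0 mg gM; have [pi pm] := pfej_int.
have [ri _ _ rm] := rescale_FT e0 pi.
have e1 : - eta != 0 by rewrite oppr_eq0 gt_eqF.
have n1 : (-1 : R) != 0 by rewrite oppr_eq0 oner_neq0.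
have [ri' _] := Rint_affine x n1 ri.
have I : intg mu (fun y => g y * rescale pfej eta (x - y)).
  apply: (intg_mulb (M := M)) => //.
  by apply: (intg_eq _ ri') => y; rewrite scaleN1r addrC.
have [_ ->] := Rint_affine x e1 I.
have [_ I2] := Rint_affine x e1 I.
rewrite normrN gtr0_norm// -RintZ; last exact: (Rint_affine x e1 I).1.
apply: Rint_eq => z; rewrite /rescale opprD addrCA subrr addr0 scaleNr opprK scalerA.
rewrite mulVf ?gt_eqF// scale1r [- _ + x]addrC.
move: (g _) (pfej z) => u v; field.
by rewrite expf_neq0// gt_eqF.
Qed.

(** Dominated convergence twice: inside, after the substitution [y = x - eta z], by continuity and
    boundedness of [g]; outside, with the majorant [M * mass * |f|]. *)
Lemma smear_lim f g M : intg mu f -> intg mu g -> continuous g -> (forall y, `|g y| <= M) ->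
  smear (harmonic n) f g @[n --> \oo] --> mass * \int[mu]_x (f x * g x).
Proof.
move=> fi gi cg gM; have [pi pm] := pfej_int.
have mg : mfun (g : bor R d -> R) by exact: intg_meas gi.
have h0 n : 0 < harmonic n :> R by rewrite /harmonic invr_gt0.
have fgi : intg mu (fun x => f x * g x).
  by apply: (@intg_eq _ _ _ mu (fun x => g x * f x)) => [x|]; [rewrite mulrC|exact: (intg_mulb (M := M))].
rewrite -RintZ//.
have [|x|||] // := @Rint_dct _ _ _ mu
  (fun n x => f x * \int[mu]_y (g y * rescale pfej (harmonic n) (x - y)))
  (fun x => mass * (f x * g x)) (fun x => M * mass * `|f x|).
- move=> n; apply: measurable_funM; first exact: intg_meas fi.
  exact: intg_meas (conv_pfej (h0 n) gi).1.
- rewrite mulrCA; apply: cvgM; first exact: cvg_cst.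
  under eq_fun do rewrite (smear_affine _ (h0 _) mg gM).
  rewrite -pm mulrC -RintZ//.
  have [|z|||] // := @Rint_dct _ _ _ mu
    (fun n z => g (x - harmonic n *: z) * pfej z)
    (fun z => g x * pfej z) (fun z => M * pfej z).
  + move=> n; apply: measurable_funM; last exact: intg_meas pi.
    apply: (@eq_measurable_fun _ _ _ _ _ (fun z : bor R d => g (- harmonic n *: z + x))).
      by move=> z _; rewrite scaleNr addrC.
    exact: (measurableT_comp mg (@measurable_affine R d _ x)).
  + apply: cvgM; last exact: cvg_cst.
    apply: continuous_cvg; first exact: cg.
    rewrite -[X in _ --> X]subr0 -(scale0r z); apply: cvgB; first exact: cvg_cst.
    by apply: cvgZl; exact: cvg_harmonic.
  + exact: intgZ.
  + by move=> n z; rewrite normrM (ger0_norm (pfej_ge0 _)) ler_wpM2r ?pfej_ge0.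
- exact/intgZ/intg_abs.
- move=> n x; rewrite normrM mulrC; apply: ler_wpM2r => //.
  rewrite (smear_affine _ (h0 _) mg gM) -pm -RintZ//.
  apply: Rint_normb; last 2 first.
  + exact: intgZ.
  + by move=> z; rewrite normrM (ger0_norm (pfej_ge0 _)) ler_wpM2r ?pfej_ge0.
  apply: (intg_mulb (M := M)) => //.
  apply: (@eq_measurable_fun _ _ _ _ _ (fun z : bor R d => g (- harmonic n *: z + x))).
    by move=> z _; rewrite scaleNr addrC.
  exact: (measurableT_comp mg (@measurable_affine R d _ x)).
Qed.

(** Uses [g x * g y <= (g x ^ 2 + g y ^ 2) / 2] and the fact that the kernel has integral [mass] in
    each variable. This is the half of Plancherel's identity that is needed for [g]. *)
Lemma smear_self eta g M : 0 < eta -> intg mu g -> (forall y, `|g y| <= M) ->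
  smear eta g g <= mass * \int[mu]_x (g x ^+ 2).
Proof.
move=> e0 gi gM; have [pi pm] := pfej_int.
have mg : mfun (g : bor R d -> R) by exact: intg_meas gi.
have g2i : intg mu (fun x => g x ^+ 2).
  by apply: (intg_eq _ (intg_mulb mg gM gi)) => x; rewrite expr2.
have [ri _ _ rm] := rescale_FT e0 pi.
have r0 y : 0 <= rescale pfej eta y.
  by rewrite mulr_ge0 ?pfej_ge0// invr_ge0 exprn_ge0// ltW.
have n1 : (-1 : R) != 0 by rewrite oppr_eq0 oner_neq0.
have K x : intg mu (fun y => rescale pfej eta (x - y)) /\
    \int[mu]_y rescale pfej eta (x - y) = mass.
  have [k1 k2] := Rint_affine x n1 ri.
  split; first by apply: (intg_eq _ k1) => y; rewrite scaleN1r addrC.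
  rewrite -pm -rm k2 normrN1 expr1n mul1r.
  by apply: Rint_eq => y; rewrite scaleN1r addrC.
have [c1 c2] := conv_pfej e0 g2i.
have [c1' _] := conv_pfej e0 gi.
have -> : mass * \int[mu]_x (g x ^+ 2) = \int[mu]_x (mass / 2 * (g x ^+ 2) +
   1 / 2 * \int[mu]_y (g y ^+ 2 * rescale pfej eta (x - y))).
  rewrite RintD; [|exact: intgZ|exact: intgZ].
  by rewrite !RintZ// c2; field.
have gb h : intg mu h -> intg mu (fun x => g x * h x) by exact: (intg_mulb (M := M)).
apply: Rint_le; first exact: gb.
  by apply: intgD; exact: intgZ.
move=> x; have [k1 k2] := K x.
have i1 : intg mu (fun y => g y * rescale pfej eta (x - y)) by exact: gb.
have i2 : intg mu (fun y => g y ^+ 2 * rescale pfej eta (x - y)).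
  by apply: (intg_eq _ (gb _ i1)) => y; rewrite expr2 mulrA.
rewrite -k2 (_ : _ / 2 * _ = (g x ^+ 2 / 2) * \int[mu]_y rescale pfej eta (x - y)); last by ring.
rewrite -!RintZ// -RintD; [|exact: intgZ|exact: intgZ].
apply: Rint_le; first exact: intgZ.
  by apply: intgD; exact: intgZ.
move=> y; move: (rescale _ _ _) (r0 (x - y)) => r r1.
have := mulr_ge0 (sqr_ge0 (g x - g y)) r1; lra.
Qed.

Lemma pcau_enorm xi : 1 <= pcau xi * (1 + enorm xi ^+ 2) ^+ d.
Proof.
rewrite mulrC -ler_pdivrMr ?pcau_gt0// mul1r /pcau /prodf -prodfV.
rewrite [leRHS](_ : _ = \prod_(i < d) (1 + enorm xi ^+ 2)); last by rewrite prodr_const card_ord.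
apply: ler_prod => i _; rewrite /cau invrK addr_ge0 ?sqr_ge0//= lerD2l enorm_sq /dotp (bigD1 i)//= -expr2 lerDl.
by apply: sumr_ge0 => j _; rewrite -expr2 sqr_ge0.
Qed.

(** Cauchy-Schwarz on the Fourier side, in the additive form with a parameter [l] to be optimized
    later. The factor [2 ^ d] is the bound of [cutk]; the transform of [f] is integrated by means of
    [pcau], that of [g] by [smear_self]. *)
Lemma pairing_bound f g A l M : intg mu f -> intg mu g -> continuous g ->
  (forall y, `|g y| <= M) -> 0 < l ->
  (forall xi, (fc f xi ^+ 2 + fs f xi ^+ 2) * (1 + enorm xi ^+ 2) ^+ d <= A) ->
  mass * `|\int[mu]_x (f x * g x)| <=
    1 / 2 * (l * (2 ^+ d * A * \int[mu]_x pcau x) + l^-1 * (mass * \int[mu]_x (g x ^+ 2))).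
Proof.
move=> fi gi cg gM l0 fA; have h0 n : 0 < harmonic n :> R by rewrite /harmonic invr_gt0.
rewrite -{1}(gtr0_norm mass_gt0) -normrM.
have L := smear_lim fi gi cg gM.
have L' : `|smear (harmonic n) f g| @[n --> \oo] --> `|mass * \int[mu]_x (f x * g x)|.
  exact: cvg_norm.
apply: (cvgr_to_le L'); apply: nearW => n.
have e0 := h0 n; set eta := harmonic n in e0 *.
apply: le_trans (_ : _ <= 1 / 2 * (l * (2 ^+ d * A * \int[mu]_x pcau x) + l^-1 * smear eta g g)) _; last first.
  apply: ler_wpM2l; first lra.
  rewrite lerD2l; apply: ler_wpM2l; first by rewrite invr_ge0 ltW.
  exact: smear_self e0 gi gM.
have [-> I1] := smear_FT e0 fi gi; have [-> I2] := smear_FT e0 gi gi.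
have pi := pcau_int.
rewrite mulrDr !mulrA -RintZ// -[X in _ <= _ + X]RintZ// -RintD; [|exact: intgZ|exact: intgZ].
apply: Rint_normb => //; first by apply: intgD; exact: intgZ.
move=> xi; have k0 := cutk_ge0 eta xi; have k2 := cutk_le eta xi.
have h1 := fA xi; have h2 := pcau_enorm xi; have p0 := pcau_gt0 xi.
set a := fc f xi in h1 *; set c := fs f xi in h1 *; set b := fc g xi; set e := fs g xi.
have q0 : 0 <= a ^+ 2 + c ^+ 2 by rewrite addr_ge0// sqr_ge0.
have h3 : a ^+ 2 + c ^+ 2 <= A * pcau xi.
  apply: le_trans (ler_wpM2r (ltW p0) h1); rewrite -mulrA -[leLHS]mulr1.
  by apply: ler_wpM2l => //; rewrite mulrC.
have h4 : cutk eta xi * (a ^+ 2 + c ^+ 2) <= 2 ^+ d * (A * pcau xi) by exact: ler_pM.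
have h5 : `|a * b + c * e| <= 1 / 2 * (l * (a ^+ 2 + c ^+ 2) + l^-1 * (b * b + e * e)).
  (* Young's inequality as a square; both signs of [t] are used to reach the absolute value. *)
  have k (s t : R) : 0 <= (l * s - t) ^+ 2 / l by rewrite divr_ge0 ?sqr_ge0// ltW.
  have E s t : (l * s - t) ^+ 2 / l = l * s ^+ 2 - 2 * s * t + l^-1 * (t * t).
    by field; rewrite gt_eqF.
  have := k a b; have := k a (- b); have := k c e; have := k c (- e).
  by rewrite !E ler_norml => *; apply/andP; split; lra.
rewrite normrM (ger0_norm k0).
apply: le_trans (ler_wpM2l k0 h5) _.
have := ler_wpM2l (ltW l0) h4; lra.
Qed.


End Bilinear.

(** * Continuous approximation of Borel sets and duality for weighted integrals of [|f|] *)

Section Density.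
Variable R : realType.
Variable d : nat.
Implicit Types (f g h : 'rV[R]_d -> R) (x y z xi : 'rV[R]_d).

Local Notation mu := (@leb R d).

Section approx.
Variable f : 'rV[R]_d -> R.
Hypothesis fi : intg mu f.

(** Approximation of the indicator in L^1 for the finite measure [|f| dx]. *)
Definition approximable (A : set 'rV[R]_d) := measurable (A : set (bor R d)) /\
  forall e : R, 0 < e -> exists h, [/\ continuous h, (forall x, 0 <= h x <= 1) &
    \int[mu]_x (`|f x| * `|\1_A x - h x|) <= e].

Lemma intg_l1 (u : bor R d -> R) : mfun u -> (forall x, `|u x| <= 1) ->
  intg mu (fun x => `|f x| * `|u x|).
Proof.
move=> mu1 u1.
apply: (@intg_eq _ _ _ mu (fun x => `|u x| * `|f x|)) => [x|]; first by rewrite mulrC.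
apply: (intg_mulb (M := 1)) (intg_abs fi); first exact: measurableT_comp.
by move=> x; rewrite normr_id.
Qed.

Lemma sub01 (a b : R) : 0 <= a <= 1 -> 0 <= b <= 1 -> `|a - b| <= 1.
Proof. by move=> /andP[? ?] /andP[? ?]; rewrite ler_norml; apply/andP; split; lra. Qed.

Lemma indic01 (A : set 'rV[R]_d) x : 0 <= (\1_A x : R) <= 1.
Proof. by rewrite indicE; case: (_ \in _); rewrite lexx ler01. Qed.

Lemma intg_l1_indic (A : set (bor R d)) (u : bor R d -> R) : measurable A ->
  mfun u -> (forall x, 0 <= u x <= 1) ->
  intg mu (fun x => `|f x| * `|\1_A x - u x|).
Proof.
move=> mA mu1 u1; apply: intg_l1; last by move=> x; apply: sub01; [exact: indic01|exact: u1].
by apply: measurable_funB => //; exact: measurable_indic.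
Qed.

(** Stability under pointwise limits: half of [e] pays for the limit, by dominated convergence, and
    half for the approximation of one [u n]. *)
Lemma approx_seq (A : set (bor R d)) (u : nat -> bor R d -> R) :
  (forall n, mfun (u n)) -> (forall n x, 0 <= u n x <= 1) ->
  (forall x, u n x @[n --> \oo] --> (\1_A x : R)) -> measurable A ->
  (forall n (e : R), 0 < e -> exists h, [/\ continuous h, (forall x, 0 <= h x <= 1) &
    \int[mu]_x (`|f x| * `|u n x - h x|) <= e]) -> approximable A.
Proof.
move=> mu1 u01 uA mA H; split=> // e e0; have e20 : 0 < e / 2 by rewrite divr_gt0.
have [|x|||_ L] // := @Rint_dct _ _ _ mu (fun n x => `|f x| * `|\1_A x - u n x|)
  (fun=> 0) (fun x => `|f x|).
- move=> n; exact: intg_meas (intg_l1_indic mA (mu1 n) (u01 n)).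
- rewrite -(mulr0 `|f x|); apply: cvgM; first exact: cvg_cst.
  rewrite -(normr0 R) -(subrr (\1_A x)); apply: cvg_norm.
  by apply: cvgB; [exact: cvg_cst|exact: uA].
- exact: intg_abs.
- move=> n x; rewrite normrM !normr_id; apply: ler_piMr => //.
  by apply: sub01; [exact: indic01|exact: u01].
have L0 : \int[mu]_x (`|f x| * `|\1_A x - u n x|) @[n --> \oo] --> (0 : R).
  by rewrite /Rintegral integral0 in L.
have /cvgrPdist_le/(_ _ e20)[N _ /(_ N (leqnn N)) hN] := L0.
have [h [ch h01 hh]] := H N _ e20.
exists h; split=> //.
have mh : mfun (h : bor R d -> R) by exact: cont_bor.
have i1 := intg_l1_indic mA (mu1 N) (u01 N).
have i2 : intg mu (fun x => `|f x| * `|u N x - h x|).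
  apply: intg_l1; first exact: measurable_funB.
  by move=> x; exact: sub01.
apply: (@le_trans _ _ (\int[mu]_x (`|f x| * `|\1_A x - u N x| + `|f x| * `|u N x - h x|))).
  apply: Rint_le; [exact: intg_l1_indic|exact: intgD|move=> x].
  rewrite -mulrDr; apply: ler_wpM2l => //.
  by rewrite -[X in `|X|](subrKA (u N x)) ler_normD.
rewrite RintD//.
move: hN; rewrite sub0r normrN ger0_norm; first by move=> hN; lra.
by apply: Rint_ge0 => x; exact: mulr_ge0.
Qed.

Lemma approx_ball x (r : R) : 0 < r -> approximable (ball x r).
Proof.
move=> r0.
pose v y : R := ppart (1 - `|x - y| / r).
have v01 y : 0 <= v y <= 1.
  rewrite /v /ppart le_max lexx orbT ge_max ler01 andbT.
  by rewrite lerBlDr lerDl divr_ge0// ltW.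
have cv : continuous v.
  apply: (@cont_comp1 _ _ (fun t => ppart (1 - t))); first exact: cont_ppart1.
  apply: contM; last exact: contC.
  move=> y; apply: (@continuous_comp _ _ _ (fun y : 'rV[R]_d => x - y) (fun y : 'rV[R]_d => `|y|)).
    by apply: continuousB; [exact: cst_continuous|by []].
  exact: norm_continuous.
have vE y : ball x r y <-> 0 < v y.
  rewrite -ball_normE /ball_/= /v /ppart lt_max ltxx orbF subr_gt0 ltr_pdivrMr// mul1r.
  by [].
(* Increases to the indicator of the set where [v] is positive, which is the open ball. *)
pose u n y : R := 1 - (1 - v y) ^+ n.
have w01 y : 0 <= 1 - v y <= 1 by have /andP[? ?] := v01 y; apply/andP; split; lra.
have u01 n y : 0 <= u n y <= 1.
  have /andP[a b] := w01 y; have := exprn_ge0 n a; have := exprn_ile1 n a b.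
  by rewrite /u => ? ?; apply/andP; split; lra.
have cu n : continuous (u n).
  apply: (@cont_comp1 _ _ (fun t => 1 - (1 - t) ^+ n)) cv => t.
  exact: der_cont (derB (derC 1 t) (derX n (derB (derC 1 t) (der_id t)))).
apply: (approx_seq (u := u)) => //.
- by move=> n; apply: cont_bor; exact: cu.
- move=> y; rewrite indicE; case: (boolP (y \in _)) => [|].
    rewrite inE => /vE v0; rewrite -[X in _ --> X]subr0.
    apply: cvgB; first exact: cvg_cst.
    by apply: cvg_expr; have /andP[? ?] := w01 y; rewrite ger0_norm//; lra.
  rewrite notin_setE => h; have v0 : v y = 0.
    by apply/eqP; have /andP[a _] := v01 y; rewrite eq_le a andbT leNgt; apply/negP => /vE.
  rewrite /u v0 subr0; under eq_fun do rewrite expr1n subrr; exact: cvg_cst.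
- by apply: open_bor; exact: ball_open.
- move=> n e e0; exists (u n); split=> //.
  rewrite /Rintegral integral0_eq ?ltW//.
  by move=> y _; rewrite subrr normr0 mulr0.
Qed.

Lemma approx0 : approximable set0.
Proof.
split; first exact: measurable0.
move=> e e0; exists (fun=> 0); split; first exact: contC.
  by move=> x; rewrite lexx ler01.
rewrite /Rintegral integral0_eq ?ltW//.
by move=> y _; rewrite indic0 subrr normr0 mulr0.
Qed.

Lemma approxC A : approximable A -> approximable (~` A).
Proof.
move=> [mA H]; split; first exact: measurableC.
move=> e /H[h [ch h01 hh]]; exists (fun x => 1 + -1 * h x); split.
- by apply: contD; [exact: contC|apply: contM => //; exact: contC].
- by move=> x; have /andP[? ?] := h01 x; apply/andP; split; lra.
- apply: le_trans hh; rewrite le_eqVlt; apply/orP; left; apply/eqP.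
  apply: Rint_eq => x; congr (_ * _); rewrite -normrN; congr (`|_|).
  by rewrite !indicE in_setC; case: (_ \in _) => /=; ring.
Qed.

(** The probabilistic sum [1 - (1 - c) (1 - e)] is 1-Lipschitz in each variable and agrees with
    disjunction on 0 and 1. *)
Lemma or01 (a b : bool) (c e : R) : 0 <= c <= 1 -> 0 <= e <= 1 ->
  `|(a || b)%:R - (c + e + -1 * (c * e))| <= `|a%:R - c| + `|b%:R - e|.
Proof.
move=> /andP[c0 c1] /andP[e0 e1].
have h1 : 0 <= (1 - c) * (1 - e) by rewrite mulr_ge0// subr_ge0.
have h2 : 0 <= c * (1 - e) by rewrite mulr_ge0// subr_ge0.
have h3 : 0 <= e * (1 - c) by rewrite mulr_ge0// subr_ge0.
have h4 : 0 <= c * e by rewrite mulr_ge0.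
have n1 : `|1 - c| = 1 - c by rewrite ger0_norm// subr_ge0.
have n2 : `|1 - e| = 1 - e by rewrite ger0_norm// subr_ge0.
have n3 : `|0 - c| = c by rewrite sub0r normrN ger0_norm.
have n4 : `|0 - e| = e by rewrite sub0r normrN ger0_norm.
by case: a; case: b => /=; rewrite ?n1 ?n2 ?n3 ?n4 ler_norml; apply/andP; split; lra.
Qed.

Lemma approxU A B : approximable A -> approximable B -> approximable (A `|` B).
Proof.
move=> [mA HA] [mB HB]; split; first exact: measurableU.
move=> e e0; have e20 : 0 < e / 2 by rewrite divr_gt0.
have [h1 [c1 k1 l1]] := HA _ e20; have [h2 [c2 k2 l2]] := HB _ e20.
have k x : 0 <= h1 x + h2 x + -1 * (h1 x * h2 x) <= 1.
  have /andP[? ?] := k1 x; have /andP[? ?] := k2 x; apply/andP; split; nra.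
have c : continuous (fun x => h1 x + h2 x + -1 * (h1 x * h2 x)).
  by apply: contD; [exact: contD|apply: contM; [exact: contC|exact: contM]].
exists (fun x => h1 x + h2 x + -1 * (h1 x * h2 x)); split=> //.
have i1 := intg_l1_indic mA (cont_bor c1) k1.
have i2 := intg_l1_indic mB (cont_bor c2) k2.
apply: (@le_trans _ _ (\int[mu]_x (`|f x| * `|\1_A x - h1 x| + `|f x| * `|\1_B x - h2 x|))).
  apply: Rint_le; [|exact: intgD|].
    by apply: intg_l1_indic => //; [exact: measurableU|exact: cont_bor].
  move=> x; rewrite -mulrDr; apply: ler_wpM2l => //.
  have /andP[? ?] := k1 x; have /andP[? ?] := k2 x.
  by rewrite !indicE in_setU; exact: or01.
by rewrite RintD//; lra.
Qed.

Lemma approx_bigcup (F : nat -> set 'rV[R]_d) : (forall n, approximable (F n)) ->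
  approximable (\bigcup_n F n).
Proof.
move=> HF; pose G n := \bigcup_(i < n) F i.
have HG n : approximable (G n).
  elim: n => [|n IH]; first by rewrite /G bigcup_mkord big_ord0; exact: approx0.
  by rewrite /G bigcup_mkord big_ord_recr/= -bigcup_mkord; exact: approxU.
apply: (@approx_seq _ (fun n => \1_(G n))).
- by move=> n; apply: measurable_indic; exact: (HG n).1.
- by move=> n x; exact: indic01.
- move=> x; rewrite indicE; case: (boolP (x \in _)) => [|].
    rewrite inE => -[N _ FN]; apply: cvg_near_cst; exists N.+1 => // n /= hn.
    by rewrite indicE mem_set//; exists N.
  rewrite notin_setE => h; apply: cvg_near_cst; apply: nearW => n.
  by rewrite indicE memNset// => -[i _ Fi]; apply: h; exists i.
- by apply: bigcup_measurable => n _; exact: (HF n).1.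
- by move=> n; exact: (HG n).2.
Qed.

Lemma approx_open U : open U -> approximable U.
Proof.
move=> oU; rewrite (open_rational_balls oU).
set B := fun p : 'rV[rat]_d * rat => _.
have -> : \bigcup_p B p = \bigcup_n (if unpickle n is Some p then B p else set0).
  apply/seteqP; split=> x.
    by move=> [p _ Bp]; exists (pickle p) => //; rewrite pickleK.
  by move=> [n _]; case: (unpickle n) => // p Bp; exists p.
apply: approx_bigcup => n; case: (unpickle n) => [p|]; last exact: approx0.
rewrite /B; case: ifPn => [/asboolP[r0 _]|_]; last exact: approx0.
by apply: approx_ball; rewrite ltr0q.
Qed.

(** The approximable sets are closed under complement and countable union and contain the open sets,
    hence contain the generated sigma-algebra. *)
Theorem approx_borel (A : set (bor R d)) : measurable A -> approximable A.
Proof.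
move=> mA.
suff : <<s [set U : set 'rV[R]_d | open U] >> `<=` approximable by apply.
apply: smallest_sub; last by move=> U; exact: approx_open.
split; [exact: approx0| |exact: approx_bigcup].
by move=> B; rewrite setTD; exact: approxC.
Qed.

End approx.

(** The sign of [f] is [2 * \1_E - 1] with [E] the set where [f >= 0]. Replacing the indicator by a
    continuous [h] gives an admissible multiplier at a cost of at most [2 * M * e], and [e] is
    arbitrary. *)
Theorem abs_duality (f w : 'rV[R]_d -> R) (M B : R) : intg mu f -> continuous w -> (forall x, 0 <= w x <= M) ->
  (forall h, continuous h -> (forall x, `|h x| <= 1) -> \int[mu]_x (f x * (h x * w x)) <= B) ->
  \int[mu]_x (`|f x| * w x) <= B.
Proof.
move=> fi cw wM H.
have mf := intg_meas fi; have mw : mfun (w : bor R d -> R) by exact: cont_bor.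
pose E : set (bor R d) := [set x | 0 <= f x].
have mE : measurable E.
  rewrite (_ : E = f @^-1` `[0, +oo[%classic).
    by rewrite -[X in measurable X]setTI; exact: mf.
  by apply/seteqP; split=> x /=; rewrite in_itv/= andbT.
apply: (@le_lim0 _ _ _ (2 * M) 1 ltr01) => e /andP[e0 _].
have [_ /(_ _ e0)[h [ch h01 hh]]] := approx_borel fi mE.
have ch2 : continuous (fun x => 2 * h x + -1).
  by apply: contD; [apply: contM => //; exact: contC|exact: contC].
have h1 x : `|2 * h x + -1| <= 1.
  by have /andP[? ?] := h01 x; rewrite ler_norml; apply/andP; split; lra.
have K := H _ ch2 h1.
have M0 : 0 <= M by have /andP[a b] := wM 0; exact: le_trans a b.
have i0 := intg_l1_indic fi mE (cont_bor ch) h01.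
have i1 : intg mu (fun x => f x * ((2 * h x + -1) * w x)).
  have i : intg mu (fun x => ((2 * h x + -1) * w x) * f x).
    apply: (intg_mulb (M := 1 * M)) => //.
      by apply: measurable_funM => //; exact: cont_bor ch2.
    by move=> x; rewrite normrM; apply: ler_pM => //; have /andP[? ?] := wM x; rewrite ger0_norm.
  by apply: (intg_eq _ i) => x; rewrite mulrC.
have i2 : intg mu (fun x => `|f x| * w x).
  have i : intg mu (fun x => w x * `|f x|).
    apply: (intg_mulb (M := M)) (intg_abs fi) => //.
    by move=> x; have /andP[? ?] := wM x; rewrite ger0_norm.
  by apply: (intg_eq _ i) => x; rewrite mulrC.
apply: (@le_trans _ _ (\int[mu]_x (f x * ((2 * h x + -1) * w x) + (2 * M) * (`|f x| * `|\1_E x - h x|)))).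
  apply: Rint_le => //; first by apply: intgD => //; exact: intgZ.
  move=> x; have /andP[w0 w1] := wM x; have /andP[h0 h1'] := h01 x.
  have -> : `|f x| = f x * (2 * \1_E x + -1).
    rewrite indicE; case: (boolP (x \in E)) => [|]; rewrite ?inE ?notin_setE /E/= => h'.
      by rewrite ger0_norm//; ring.
    by rewrite ltr0_norm; [ring|rewrite ltNge; apply/negP].
  set t := \1_E x; rewrite -subr_ge0.
  have -> : f x * (2 * t + -1) * `|t - h x| = `|f x| * `|t - h x|.
    congr (_ * _); rewrite /t indicE; case: (boolP (x \in E)) => [|]; rewrite ?inE ?notin_setE /E/= => h'.
      by rewrite ger0_norm//; ring.
    by rewrite ltr0_norm; [ring|rewrite ltNge; apply/negP].
  rewrite -normrM.
  have : f x * (t - h x) * w x <= `|f x * (t - h x)| * M.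
    apply: le_trans (ler_norm _) _; rewrite normrM; apply: ler_wpM2l => //.
    by rewrite ger0_norm.
  lra.
rewrite RintD//; last exact: intgZ.
rewrite RintZ//; apply: lerD => //; apply: ler_wpM2l => //.
exact: mulr_ge0.
Qed.

End Density.

(** * Nonnegativity of the stable density through a central limit theorem *)

Section Stable.
Variable R : realType.

Lemma cvg_dominated (u B : nat -> R) (l : R) (N : nat) :
  (forall n, (N <= n)%N -> `|u n - l| <= B n) ->
  B n @[n --> \oo] --> (0 : R) -> u n @[n --> \oo] --> l.
Proof.
move=> H B0; apply/cvgrPdist_le => e e0.
have /cvgrPdist_le/(_ _ e0) := B0; apply: filterS2 (nbhs_infty_ge N) => n Nn.
rewrite sub0r normrN distrC => h; apply: le_trans (H _ Nn) _.
exact: le_trans (ler_norm _) h.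
Qed.

Lemma expr_lip (a b : R) n : 0 <= a <= 1 -> 0 <= b <= 1 -> `|a ^+ n - b ^+ n| <= n%:R * `|a - b|.
Proof.
move=> /andP[a0 a1] /andP[b0 b1]; elim: n => [|n IH]; first by rewrite !expr0 subrr normr0 mul0r.
rewrite !exprS (_ : _ - _ = a * (a ^+ n - b ^+ n) + (a - b) * b ^+ n); last by ring.
apply: le_trans (ler_normD _ _) _; rewrite !normrM -natr1 mulrDl mul1r.
apply: lerD.
  by apply: le_trans IH; rewrite ger0_norm// ler_piMl.
by rewrite ler_piMr// ger0_norm ?exprn_ge0// exprn_ile1.
Qed.

(** From [1 - u <= e^(-u) <= 1 / (1 + u) <= 1 - u + u^2]. *)
Lemma expN_quad (u : R) : 0 <= u -> `|1 - u - expR (- u)| <= u ^+ 2.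
Proof.
move=> u0; have h1 := expR_ge1Dx (- u).
have h2 : expR (- u) <= (1 + u)^-1.
  by rewrite expRN lef_pV2 ?posrE ?expR_gt0 ?expR_ge1Dx//; lra.
have h3 : (1 + u)^-1 <= 1 - u + u ^+ 2.
  rewrite -div1r ler_pdivrMr; last lra.
  have : 0 <= u ^+ 3 by rewrite exprn_ge0.
  rewrite !exprS expr0; lra.
rewrite ler_norml; apply/andP; split; have := sqr_ge0 u; lra.
Qed.

(** Here [c] and [g] are the two parts of the symbol, [x = |xi|^p] and [t = |xi|^delta]: the squared
    modulus, transform of the symmetrized density, is [1 - 2 x] up to a smaller error. *)
Lemma q_close (c g x t C0 : R) : 0 <= C0 -> 0 <= x -> 0 <= t <= 1 ->
  `|c - (1 - x)| <= C0 * (x * t) -> `|g| <= C0 * (x * t) ->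
  `|c ^+ 2 + g ^+ 2 - (1 - 2 * x)| <= x * (((1 + C0) ^+ 2 + C0 ^+ 2) * x + 2 * C0 * t).
Proof.
move=> C00 x0 /andP[t0 t1] h1 h2.
have xt : C0 * (x * t) <= C0 * x by rewrite ler_wpM2l// ler_piMr.
have k1 : (c - 1) ^+ 2 <= ((1 + C0) * x) ^+ 2.
  rewrite -real_normK ?num_real// lerXn2r ?nnegrE//; first by rewrite mulr_ge0//; lra.
  by move: h1; rewrite !ler_norml => /andP[? ?]; apply/andP; split; lra.
have k2 : g ^+ 2 <= (C0 * x) ^+ 2.
  rewrite -real_normK ?num_real// lerXn2r ?nnegrE//; first by rewrite mulr_ge0//; lra.
  exact: le_trans h2 xt.
rewrite (_ : _ - _ = (c - 1) ^+ 2 + g ^+ 2 + 2 * (c - (1 - x))); last by ring.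
have := sqr_ge0 (c - 1); have := sqr_ge0 g => g0 c0.
by move: h1; rewrite !ler_norml => /andP[? ?]; apply/andP; split; lra.
Qed.

Variable d : nat.
Implicit Types (f g h J T : 'rV[R]_d -> R) (x y z xi : 'rV[R]_d).
Local Notation mu := (@leb R d).

(* Symmetrization makes the Fourier transform real and nonnegative, so that its powers
   stay real. *)
Lemma symm_pdens J : pdens J -> exists T, [/\ pdens T,
  forall xi, fc T xi = fc J xi ^+ 2 + fs J xi ^+ 2 & forall xi, fs T xi = 0].
Proof.
move=> pJ; have [Ji J0 J1] := pJ.
have n1 : (-1 : R) != 0 by rewrite oppr_eq0 oner_neq0.
have RE h : intg mu h -> intg mu (fun x => h (- x)) /\ \int[mu]_x h (- x) = \int[mu]_x h x.
  move=> hi; have [h1 ->] := Rint_affine 0 n1 hi.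
  have E x : h (-1 *: x + 0) = h (- x) by rewrite addr0 scaleN1r.
  split; first by apply: (intg_eq _ h1) => x; exact: E.
  by rewrite normrN1 expr1n mul1r; apply: Rint_eq => x; rewrite E.
have [i1 i2] := RE _ Ji.
have pJ' : pdens (fun x => J (- x)) by split=> //; rewrite i2.
have c' xi : fc (fun x => J (- x)) xi = fc J xi.
  rewrite /fc -(RE _ (intg_cos xi Ji)).2; apply: Rint_eq => x.
  by rewrite dotpNl cosN.
have s' xi : fs (fun x => J (- x)) xi = - fs J xi.
  rewrite /fs -(RE _ (intg_sin xi Ji)).2 -mulN1r -RintZ; last exact: (RE _ (intg_sin xi Ji)).1.
  by apply: Rint_eq => x; rewrite dotpNl sinN; ring.
exists (Defs.conv J (fun x => J (- x))); split; first exact: conv_pdens.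
  by move=> xi; have [-> _] := conv_FT xi pJ pJ'; rewrite c' s'; ring.
by move=> xi; have [_ ->] := conv_FT xi pJ pJ'; rewrite c' s'; ring.
Qed.

(** The exponent is [n.+1] because the zeroth convolution power is a Dirac mass, not a density. *)
Lemma conv_power T n : pdens T -> (forall xi, fs T xi = 0) -> exists P, [/\ pdens P,
  forall xi, fc P xi = fc T xi ^+ n.+1 & forall xi, fs P xi = 0].
Proof.
move=> pT T0; elim: n => [|n [P [pP P1 P2]]]; first by exists T.
exists (Defs.conv T P); split; first exact: conv_pdens.
  by move=> xi; have [-> _] := conv_FT xi pT pP; rewrite P1 P2 [in RHS]exprS mulr0 subr0.
by move=> xi; have [_ ->] := conv_FT xi pT pP; rewrite T0 P2 mul0r mulr0 addr0.
Qed.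

Section clt.
Variables (J : 'rV[R]_d -> R) (s delta C0 : R).
Hypotheses (pJ : pdens J) (s12 : 1/2 < s < 1) (delta0 : 0 < delta) (C00 : 0 < C0).
Hypothesis reg : symbol_reg J s delta C0.

(* [2 ^ j] independent symmetrized steps of size [t j]: [2 * 2 ^ j * t j ^ p = 1 / p]. *)
Let p := 2 * s.
Let th : R := 2 `^ (- p^-1).
Let c : R := (2 * p) `^ (- p^-1).
Let t j := c * th ^+ j.

Lemma clt_p : 1 < p < 2. Proof. by move: s12 => /andP[? ?]; rewrite /p; apply/andP; split; lra. Qed.

Lemma clt_t0 j : 0 < t j.
Proof.
have /andP[p1 _] := clt_p.
by rewrite /t mulr_gt0 ?exprn_gt0 ?powR_gt0// mulr_gt0//; lra.
Qed.

Lemma clt_th (q : R) : 0 < q -> 0 <= th `^ q < 1.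
Proof.
move=> q0; rewrite powR_ge0/= /th -powRrM /powR gt_eqF// -[ltRHS]expR0 ltr_expR.
have /andP[p1 _] := clt_p.
have l2 : 0 < ln 2 :> R by rewrite ln_gt0// ltr1n.
by rewrite mulNr mulNr oppr_lt0 !mulr_gt0// invr_gt0; lra.
Qed.

Lemma clt_tq j (q : R) : t j `^ q = c `^ q * (th `^ q) ^+ j.
Proof.
rewrite /t powRM ?exprn_ge0 ?powR_ge0//; congr (_ * _).
by rewrite -(powR_mulrn j (powR_ge0 2 _)) -(powR_mulrn j (powR_ge0 _ q)) powRAC.
Qed.

Lemma clt_tp j : t j `^ p = (2 * p)^-1 * (2^-1) ^+ j.
Proof.
have /andP[p1 _] := clt_p; have pn : p != 0 by rewrite gt_eqF//; lra.
have e : - p^-1 * p = -1 by rewrite mulNr mulVf.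
rewrite clt_tq /c /th -!powRrM e !powR_inv1//; lra.
Qed.

Lemma geom_cvg0 (K r : R) : 0 <= r < 1 -> K * r ^+ j @[j --> \oo] --> (0 : R).
Proof.
move=> /andP[r0 r1]; rewrite -(mulr0 K); apply: cvgM; first exact: cvg_cst.
by apply: cvg_expr; rewrite ger0_norm.
Qed.

(** The limit is the [2 ^ j]-th power of [expR (- 2 x j)]. By [expr_lip] the powers differ by at
    most [2 ^ j] times the distance of their bases; this distance is [x j] times a vanishing factor,
    and [2 ^ j * x j] is constant. *)
Theorem clt : exists P : nat -> 'rV[R]_d -> R, [/\ forall j, pdens (P j),
  forall j xi, fs (P j) xi = 0 &
  forall xi, fc (P j) xi @[j --> \oo] --> expR (- (enorm xi `^ p) / p)].
Proof.
have [T [pT T1 T0]] := symm_pdens pJ.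
have H j : exists P, [/\ pdens P, forall xi, fc P xi = fc T (t j *: xi) ^+ (2 ^ j) &
    forall xi, fs P xi = 0].
  have [_ r1 r2 _] := rescale_FT (clt_t0 j) (let: And3 i _ _ := pT in i).
  have [||P [h1 h2 h3]] := @conv_power (rescale T (t j)) (2 ^ j).-1.
  - exact: rescale_pdens (clt_t0 j) pT.
  - by move=> xi; rewrite r2.
  - by exists P; split=> // xi; rewrite h2 prednK ?expn_gt0// r1.
have [P HP] := choice H.
exists P; split; [by move=> j; case: (HP j)|by move=> j xi; case: (HP j)|].
move=> xi; set e := enorm xi; have e0 : 0 <= e by exact: enorm_ge0.
have /andP[p1 p2] := clt_p; have pn : p != 0 by rewrite gt_eqF//; lra.
pose L := e `^ p / p; have L0 : 0 <= L by rewrite divr_ge0 ?powR_ge0//; lra.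
have te j : enorm (t j *: xi) = t j * e by rewrite enormZ// ltW// clt_t0.
pose x j := (t j * e) `^ p; pose td j := (t j * e) `^ delta.
have xE j : x j = L / 2 * 2^-1 ^+ j.
  by rewrite /x powRM ?(ltW (clt_t0 j))// clt_tp /L; field.
have tdE j : td j = (c `^ delta * e `^ delta) * (th `^ delta) ^+ j.
  by rewrite /td powRM ?(ltW (clt_t0 j))// clt_tq; ring.
pose K := (1 + C0) ^+ 2 + C0 ^+ 2.
pose B j := L / 2 * ((K + 4) * x j + 2 * C0 * td j).
have half : 0 <= (2^-1 : R) < 1 by apply/andP; split; lra.
have B0 : B j @[j --> \oo] --> (0 : R).
  rewrite -(mulr0 (L / 2)); apply: cvgM; first exact: cvg_cst.
  rewrite -[X in _ --> X](addr0 (0 : R)); apply: cvgD.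
    rewrite -(mulr0 (K + 4)); apply: cvgM; first exact: cvg_cst.
    by rewrite (funext xE); exact: geom_cvg0.
  rewrite -(mulr0 (2 * C0)); apply: cvgM; first exact: cvg_cst.
  by rewrite (funext tdE); apply: geom_cvg0; exact: clt_th.
have th1 : 0 <= th < 1 by have := clt_th ltr01; rewrite powRr1// powR_ge0.
(* From this index on the scaled frequency lies in the unit ball, where the expansion of the symbol
   holds. *)
have [N _ HN] : \forall j \near \oo, t j * e <= 1.
  have /cvgrPdist_le/(_ _ ltr01) := geom_cvg0 (c * e) th1.
  apply: filterS => j; rewrite sub0r normrN /t mulrAC; exact: le_trans (ler_norm _).
apply: (@cvg_dominated _ B _ N) B0 => j /HN tj.
have [_ -> _] := HP j.
have tj0 : 0 <= t j * e by rewrite mulr_ge0// ltW// clt_t0.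
have x0 : 0 <= x j by exact: powR_ge0.
have n0 : (2 ^ j)%:R != 0 :> R by rewrite pnatr_eq0 expn_eq0.
have nx : (2 ^ j)%:R * x j = L / 2.
  by rewrite xE natrX mulrCA -exprMn divff// expr1n mulr1.
have EL : expR (- (e `^ p) / p) = expR (- (2 * x j)) ^+ (2 ^ j).
  rewrite -expRM_natl; congr expR; rewrite mulrN (mulrCA _ 2) nx /L; field.
  exact: pn.
rewrite EL.
have q0 : 0 <= fc T (t j *: xi) <= 1.
  by rewrite (fc_le1 _ pT) T1 addr_ge0// sqr_ge0.
have ex01 : 0 <= expR (- (2 * x j)) <= 1.
  by rewrite expR_ge0 -[leRHS]expR0 ler_expR oppr_le0 mulr_ge0.
apply: le_trans (expr_lip _ q0 ex01) _.
have td01 : 0 <= td j <= 1.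
  have o1 : 1 `^ delta = 1 :> R by rewrite powR1.
  rewrite powR_ge0 -[leRHS]o1; apply: ge0_ler_powR; rewrite ?nnegrE//.
  exact: ltW.
have [r1 r2] := @reg (t j *: xi) ltac:(by rewrite te).
have E1 : enorm (t j *: xi) `^ (2 * s + delta) = x j * td j.
  rewrite te -/p; apply: powRD; apply/implyP => /eqP h.
  by exfalso; move: h p1 delta0; lra.
rewrite E1 te -/p -/(x j) in r1; rewrite E1 in r2.
have k1 := q_close (ltW C00) x0 td01 r1 r2.
have k2 := expN_quad (mulr_ge0 (ler0n R 2) x0).
have k3 : `|fc T (t j *: xi) - expR (- (2 * x j))| <= x j * ((K + 4) * x j + 2 * C0 * td j).
  rewrite T1 -[X in `|X|](subrKA (1 - 2 * x j)); apply: le_trans (ler_normD _ _) _.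
  by apply: le_trans (lerD k1 k2) _; rewrite /K; lra.
apply: le_trans (ler_wpM2l (ler0n _ _) k3) _.
by rewrite mulrA nx.
Qed.

End clt.
Lemma cont_prodf (h : R -> R) : continuous h -> continuous (prodf h : 'rV[R]_d -> R).
Proof.
move=> ch; rewrite /prodf; elim: (index_enum _) => [|i r IH].
  by under eq_fun do rewrite big_nil; exact: contC.
under eq_fun do rewrite big_cons; apply: contM => //.
by apply: (cont_comp1 ch); exact: coord_continuous.
Qed.

Lemma cont_pcau : continuous (@pcau R d).
Proof. by apply: cont_prodf; exact: continuous_oneDsqrV. Qed.

Lemma pcau_le1 x : pcau x <= 1.
Proof.
apply: (@le_trans _ _ (\prod_(i < d) (1 : R))); last by rewrite big1_eq.
apply: ler_prod => i _; rewrite (ltW (cau_gt0 _))/= invf_le1 ?lerDl ?sqr_ge0//.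
by rewrite ltr_pwDl// sqr_ge0.
Qed.

(** [smear] depends on [f] only through its transforms, so it passes to the limit under their
    pointwise convergence; for the densities [P j] it is an integral of nonnegative functions. *)
Lemma smear_limit_ge0 (P : nat -> 'rV[R]_d -> R) f g eta : 0 < eta ->
  intg mu f -> intg mu g -> (forall x, 0 <= g x) ->
  (forall j, pdens (P j)) ->
  (forall xi, fc (P j) xi @[j --> \oo] --> fc f xi) ->
  (forall xi, fs (P j) xi @[j --> \oo] --> fs f xi) -> 0 <= smear eta f g.
Proof.
move=> e0 fi gi g0 pP Pc Ps.
have Pi j : intg mu (P j) by case: (pP j).
have P1 j : \int[mu]_x `|P j x| = 1.
  by case: (pP j) => _ h <-; apply: Rint_eq => x; rewrite ger0_norm.
have [-> _] := smear_FT e0 fi gi.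
have [ci _] := @cutk_FT R d eta 0 e0.
have [|xi|||_ L] // := @Rint_dct _ _ _ mu
  (fun j xi => cutk eta xi * (fc (P j) xi * fc g xi + fs (P j) xi * fs g xi))
  (fun xi => cutk eta xi * (fc f xi * fc g xi + fs f xi * fs g xi))
  (fun xi => (2 * \int[mu]_x `|g x|) * cutk eta xi).
- by move=> j; exact: intg_meas (smear_FT e0 (Pi j) gi).2.
- apply: cvgM; first exact: cvg_cst.
  by apply: cvgD; apply: cvgM; [exact: Pc|exact: cvg_cst|exact: Ps|exact: cvg_cst].
- exact: intgZ.
- move=> j xi; rewrite normrM (ger0_norm (cutk_ge0 _ _)) mulrC.
  apply: ler_wpM2r; first exact: cutk_ge0.
  apply: le_trans (ler_normD _ _) _; rewrite !normrM mulr2n mulrDl mul1r.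
  have b1 : `|fc (P j) xi| <= 1 by rewrite -(P1 j) fc_le.
  have b2 : `|fs (P j) xi| <= 1 by rewrite -(P1 j) fs_le.
  rewrite -[X in _ <= X + X]mul1r.
  by apply: lerD; apply: ler_pM => //; [exact: fc_le|exact: fs_le].
apply: (cvgr_to_ge L); apply: nearW => j.
have [<- _] := smear_FT e0 (Pi j) gi.
have [pi _] := @pfej_int R d.
apply: Rint_ge0 => x; apply: mulr_ge0; first by case: (pP j).
apply: Rint_ge0 => y; apply: mulr_ge0 => //; apply: mulr_ge0; last exact: pfej_ge0.
by rewrite invr_ge0 exprn_ge0// ltW.
Qed.

(** The tests are [h * pcau] with [h] a continuous approximation of the indicator of the set where
    [f] is negative; [pcau] makes them integrable without losing positivity. The negative part then
    has zero integral against [pcau]. *)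
Lemma pairing_ge0_ae f : intg mu f ->
  (forall g, intg mu g -> continuous g -> (forall x, 0 <= g x <= 1) -> 0 <= \int[mu]_x (f x * g x)) ->
  {ae mu, forall x, f x = Num.max (f x) 0}.
Proof.
move=> fi H; have mf := intg_meas fi.
pose fm x := Num.max (- f x) 0.
have fm0 x : 0 <= fm x by rewrite /fm le_max lexx orbT.
have fme x : fm x = (`|f x| - f x) / 2 by rewrite /fm; case: (ger0P (f x)) => h; [rewrite max_r|rewrite max_l]; lra.
have fmi : intg mu fm.
  by apply: (intg_eq _ (intgZ (1 / 2) (intgB (intg_abs fi) fi))) => x; rewrite fme; ring.
have pl x : `|pcau x| <= 1 by rewrite ger0_norm ?pcau_le1// ltW// pcau_gt0.
have mp : mfun (@pcau R d : bor R d -> R) by apply: cont_bor; exact: cont_pcau.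
have fpi : intg mu (fun x => pcau x * fm x) by exact: (intg_mulb (M := 1)).
pose E : set (bor R d) := [set x | f x < 0].
have mE : measurable E.
  rewrite (_ : E = f @^-1` `]-oo, 0[%classic).
    by rewrite -[X in measurable X]setTI; exact: mf.
  by apply/seteqP; split=> x /=; rewrite in_itv.
have Z : \int[mu]_x (pcau x * fm x) <= 0.
  apply: (@le_lim0 _ _ _ 1 1 ltr01) => e /andP[e0 _].
  have [_ /(_ _ e0)[h [ch h01 hh]]] := approx_borel fi mE.
  have c' : continuous (fun x => h x * pcau x) by apply: contM => //; exact: cont_pcau.
  have b' x : 0 <= h x * pcau x <= 1.
    have /andP[? ?] := h01 x; rewrite mulr_ge0 ?(ltW (pcau_gt0 _))//=.
    by rewrite mulr_ile1 ?pcau_le1 ?(ltW (pcau_gt0 _)).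
  have hb x : `|h x| <= 1 by have /andP[? ?] := h01 x; rewrite ger0_norm.
  have i' : intg mu (fun x => h x * pcau x).
    exact: (intg_mulb (cont_bor ch) hb (pcau_int R d)).
  have K := H _ i' c' b'.
  have i1 := intg_l1_indic fi mE (cont_bor ch) h01.
  have i2 : intg mu (fun x => f x * (h x * pcau x)).
    have i : intg mu (fun x => (h x * pcau x) * f x).
      apply: (intg_mulb (M := 1) (cont_bor c') _ fi) => x.
      by have /andP[? ?] := b' x; rewrite ger0_norm.
    by apply: (intg_eq _ i) => x; rewrite mulrC.
  rewrite add0r mul1r.
  apply: (@le_trans _ _ (\int[mu]_x (`|f x| * `|\1_E x - h x| - f x * (h x * pcau x)))); last first.
    by rewrite RintB//; lra.
  apply: Rint_le => //; first exact: intgB.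
  move=> x; have -> : fm x = - (f x * \1_E x).
    rewrite /fm indicE; case: (boolP (x \in E)) => [|]; rewrite ?inE ?notin_setE /E/= => h'.
      by rewrite max_l ?mulr1// oppr_ge0 ltW.
    by rewrite max_r ?mulr0 ?oppr0// oppr_le0 leNgt; apply/negP.
  rewrite -normrM; have p0 := pcau_gt0 x; have p1 := pcau_le1 x.
  have k : - (f x * (\1_E x - h x)) * pcau x <= `|f x * (\1_E x - h x)|.
    apply: le_trans (ler_norm _) _; rewrite normrM normrN ler_piMr//.
  lra.
have Z' : \int[mu]_x (pcau x * fm x) = 0.
  apply/eqP; rewrite eq_le Z/=; apply: Rint_ge0 => x.
  by rewrite mulr_ge0// ltW// pcau_gt0.
have Z2 : (\int[mu]_x `|(pcau x * fm x)%:E| = 0)%E.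
  rewrite -(_ : (\int[mu]_x (pcau x * fm x))%:E = 0%E); last by rewrite Z'.
  rewrite Rint_fin//; apply: eq_integral => x _.
  by rewrite gee0_abs// lee_fin mulr_ge0// ltW// pcau_gt0.
have mpf : mfun (fun x : bor R d => (pcau x * fm x)%:E).
  by apply/measurable_EFinP; exact: intg_meas fpi.
have := (ae_eq_integral_abs mu measurableT mpf).1 Z2.
apply: filterS => x /(_ Logic.I) [] /eqP; rewrite mulf_eq0 gt_eqF ?pcau_gt0//= fme => /eqP h.
by rewrite max_l//; have := normr_ge0 (f x); lra.
Qed.

Lemma Rint_ae (f g : bor R d -> R) : intg mu f -> mfun g ->
  {ae mu, forall x, f x = g x} -> intg mu g /\ \int[mu]_x g x = \int[mu]_x f x.
Proof.
move=> fi mg fg; have mf := intg_meas fi.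
have aeF := ae_filter_ringOfSetsType mu.
have ae1 : ae_eq mu setT (EFin \o f) (EFin \o g) by apply: filterS fg => x + _ /= => ->.
have ae2 : ae_eq mu setT (abse \o (EFin \o f)) (abse \o (EFin \o g)).
  by apply: filterS fg => x + _ /= => ->.
have mf' : mfun (EFin \o f) by exact/measurable_EFinP.
have mg' : mfun (EFin \o g) by exact/measurable_EFinP.
split; last by rewrite /Rintegral; congr fine; exact/esym/ae_eq_integral.
apply/integrableP; split=> //; move: fi => /integrableP[_]; congr (_ < _)%E.
by apply: ae_eq_integral => //; exact: measurableT_comp.
Qed.

(** Its transform determines [G] only up to a null set, so [G] is replaced by its positive part,
    which is nonnegative everywhere and has the same transforms. *)
Theorem stable_pdens J G (s delta C0 : R) : pdens J -> 1/2 < s < 1 -> 0 < delta -> 0 < C0 ->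
  symbol_reg J s delta C0 ->
  frac_equilibrium s G -> exists Gp, [/\ pdens Gp, {ae mu, forall x, G x = Gp x},
    forall xi, fc Gp xi = expR (- (enorm xi `^ (2 * s)) / (2 * s)) & forall xi, fs Gp xi = 0].
Proof.
move=> pJ s12 d0 C00 reg [/integP Gi GF].
have Gc xi : fc G xi = expR (- (enorm xi `^ (2 * s)) / (2 * s)).
  by rewrite -fourier_reE//; exact: (GF xi).1.
have Gs xi : fs G xi = 0.
  by apply: oppr_inj; rewrite oppr0 -fourier_imE//; exact: (GF xi).2.
have [P [pP P0 Pc]] := clt pJ s12 d0 C00 reg.
have ae : {ae mu, forall x, G x = Num.max (G x) 0}.
  apply: pairing_ge0_ae => // g gi cg g01.
  have g0 x : 0 <= g x by have /andP[] := g01 x.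
  have gb x : `|g x| <= 1 by have /andP[? ?] := g01 x; rewrite ger0_norm.
  rewrite -(pmulr_rge0 _ (mass_gt0 R d)).
  apply: (cvgr_to_ge (smear_lim Gi gi cg gb)); apply: nearW => n.
  apply: (smear_limit_ge0 _ Gi gi g0 pP) => [|xi|xi].
  - by rewrite /harmonic invr_gt0.
  - by rewrite Gc; exact: Pc.
  - by rewrite Gs; under eq_fun do rewrite P0; exact: cvg_cst.
have mG := intg_meas Gi.
have mM : mfun (fun x : bor R d => Num.max (G x) 0) by exact: measurable_maxr.
have [Mi M1] := Rint_ae Gi mM ae.
have aeF := ae_filter_ringOfSetsType mu.
have T (h : R -> R) xi : mfun h -> intg mu (fun x => h (dotp x xi) * G x) ->
    \int[mu]_x (h (dotp x xi) * Num.max (G x) 0) = \int[mu]_x (h (dotp x xi) * G x).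
  move=> mh hi; apply: (Rint_ae hi _ _).2.
    by apply: measurable_funM => //; apply: (measurableT_comp mh); exact: meas_dotp.
  by apply: filterS ae => x <-.
exists (fun x => Num.max (G x) 0); split=> //.
- split=> //; first by move=> x; rewrite le_max lexx orbT.
  rewrite M1 -fc0 Gc enorm0 powR0 ?oppr0 ?mul0r ?expR0//.
  by move: s12 => /andP[? ?]; rewrite mulf_neq0//; lra.
- by move=> xi; rewrite -Gc; apply: (T cos); [exact: meas_cos|exact: intg_cos].
- by move=> xi; rewrite -[RHS](Gs xi); apply: (T sin); [exact: meas_sin|exact: intg_sin].
Qed.

End Stable.

(** * Moments of order below one from the behavior of the transform near 0 *)

Section Moments.
Variable R : realType.

(** On this interval [1 - cos v >= v^2 / 2 - 2 v^3 >= v^2 / 4 >= 1 / 1024], and [1024 = 32 ^ 2]. *)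
Lemma one_sub_cos_ge (v : R) : 1 / 16 <= v <= 1 / 8 -> 1 <= 32 ^+ 2 * (1 - cos v).
Proof.
move=> /andP[v1 v2]; have v0 : 0 <= v by lra.
have := cos_cub v; rewrite (ger0_norm v0) ler_norml => /andP[h _].
have h2 : 1 / 256 <= v ^+ 2 by nra.
have h3 : v ^+ 3 <= 1 / 8 * v ^+ 2 by rewrite exprS ler_wpM2r ?sqr_ge0.
lra.
Qed.

(** Takes the least [j] with [8 u <= 2 ^ j]; minimality gives the lower bound. *)
Lemma dyadic (u : R) : 1 < u -> exists j, 1 / 16 <= (2 ^+ j)^-1 * u <= 1 / 8.
Proof.
move=> u1.
have ex : exists j, 8 * u <= (2 ^ j)%:R.
  exists (Num.bound (8 * u)); apply: le_trans (ltW (archi_boundP _)) _; first lra.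
  by rewrite ler_nat ltnW// ltn_expl.
case: (ex_minnP ex) => -[|j] h1 h2; first by rewrite expn0 in h1; lra.
have h3 : (2 ^ j)%:R < 8 * u.
  by rewrite ltNge; apply/negP => /h2; rewrite ltnn.
have p0 : 0 < (2 : R) ^+ j.+1 by rewrite exprn_gt0.
rewrite natrX in h1; rewrite natrX in h3.
exists j.+1; rewrite [_^-1 * u]mulrC ler_pdivlMr// ler_pdivrMr//.
by rewrite exprS in h1 *; apply/andP; split; lra.
Qed.

(** A discrete substitute for writing [|u|^m] as an integral of [(1 - cos (r u)) r^(-1-m)]: one
    dyadic scale [2^(-j)] comparable to [1 / |u|] suffices. *)
Lemma powR_dyadic (m u : R) : 0 < m -> exists j,
  `|u| `^ m <= 1 + 32 ^+ 2 * ((2 `^ m) ^+ j * (1 - cos ((2 ^+ j)^-1 * u))).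
Proof.
move=> m0; have cc v : 0 <= 1 - cos v :> R by rewrite subr_ge0 cos_le1.
have [u1|u1] := leP `|u| 1.
  exists 0%N; have : `|u| `^ m <= 1.
    have o1 : 1 `^ m = 1 :> R by rewrite powR1.
    by rewrite -[leRHS]o1; apply: ge0_ler_powR; rewrite ?nnegrE// ltW.
  have : 0 <= (2 `^ m) ^+ 0 * (1 - cos ((2 ^+ 0)^-1 * u)) by rewrite mulr_ge0 ?exprn_ge0 ?powR_ge0.
  lra.
have [j hj] := dyadic u1; exists j.
have p0 : 0 < (2 : R) ^+ j by rewrite exprn_gt0.
have k1 : `|u| `^ m <= (2 `^ m) ^+ j.
  rewrite -powR_mulrn ?powR_ge0// powRAC; apply: ge0_ler_powR; rewrite ?nnegrE ?powR_ge0//.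
    exact: ltW.
  rewrite powR_mulrn//; move: hj => /andP[_]; rewrite mulrC ler_pdivrMr//; lra.
have -> : cos ((2 ^+ j)^-1 * u) = cos ((2 ^+ j)^-1 * `|u|).
  by case: (ger0P u) => // _; rewrite mulrN cosN.
have k2 := one_sub_cos_ge hj.
have : (2 `^ m) ^+ j * 1 <= (2 `^ m) ^+ j * (32 ^+ 2 * (1 - cos ((2 ^+ j)^-1 * `|u|))).
  by apply: ler_wpM2l => //; rewrite exprn_ge0// powR_ge0.
lra.
Qed.

(** With [t = c / (a + b)] in [[0, 1]], one has [t <= t^q]; the two shares add up to 1. *)
Lemma powR_subadd (q a b : R) : 0 < q <= 1 -> 0 <= a -> 0 <= b ->
  (a + b) `^ q <= a `^ q + b `^ q.
Proof.
move=> /andP[q0 q1] a0 b0; have [/eqP ab|ab] := eqVneq (a + b) 0.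
  by rewrite (eqP ab) powR0 ?gt_eqF// addr_ge0 ?powR_ge0.
have s0 : 0 < a + b by rewrite lt_neqAle eq_sym ab addr_ge0.
have K c : 0 <= c -> c <= a + b -> (a + b) `^ q * (c / (a + b)) <= c `^ q.
  rewrite le_eqVlt => /predU1P[<-|c0] cab; first by rewrite mul0r mulr0 powR_ge0.
  have c' : 0 < c / (a + b) by rewrite divr_gt0.
  apply: (@le_trans _ _ ((a + b) `^ q * (c / (a + b)) `^ q)).
    apply: ler_wpM2l; first exact: powR_ge0.
    by apply: ger1_powR => //; rewrite c' ler_pdivrMr// mul1r.
  by rewrite -powRM ?(ltW s0) ?(ltW c')// mulrC divfK.
have k1 := K a a0 ltac:(lra); have k2 := K b b0 ltac:(lra).
apply: le_trans (lerD k1 k2); rewrite -mulrDr -mulrDl divff// mulr1//.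
Qed.

Variable d : nat.
Implicit Types (f g h J T P : 'rV[R]_d -> R) (x y z xi : 'rV[R]_d).
Local Notation mu := (@leb R d).

Lemma jbr_powE x (m : R) : jbr x `^ m = (1 + enorm x ^+ 2) `^ (m / 2).
Proof.
rewrite /jbr -powR12_sqrt; last by rewrite addr_ge0// sqr_ge0.
by rewrite -powRrM mulrC.
Qed.

Lemma jbr_ge1 x : 1 <= jbr x.
Proof. by rewrite /jbr -[leLHS]sqrtr1 ler_sqrt ?addr_ge0 ?sqr_ge0// lerDl sqr_ge0. Qed.

Lemma jbr_pow_le x (m : R) : 0 < m <= 1 -> jbr x `^ m <= 1 + \sum_i `|x ord0 i| `^ m.
Proof.
move=> /andP[m0 m1]; rewrite jbr_powE enorm_sq /dotp.
have q : 0 < m / 2 <= 1 by apply/andP; split; lra.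
have S (r : seq 'I_d) : (\sum_(i <- r) x ord0 i * x ord0 i) `^ (m / 2) <=
    \sum_(i <- r) `|x ord0 i| `^ m.
  elim: r => [|i r IH]; first by rewrite !big_nil powR0//; case/andP: q => ? _; rewrite gt_eqF.
  rewrite !big_cons; apply: le_trans (powR_subadd q _ _) _.
  - by rewrite -expr2 sqr_ge0.
  - by apply: sumr_ge0 => j _; rewrite -expr2 sqr_ge0.
  - apply: lerD => //; rewrite -expr2 -(real_normK (num_real (x ord0 i))) -powR_mulrn// -powRrM.
    by rewrite mulrC divfK.
apply: le_trans (powR_subadd q _ _) _ => //.
  by apply: sumr_ge0 => j _; rewrite -expr2 sqr_ge0.
by rewrite powR1 lerD2l; exact: S.
Qed.

Lemma meas_jbr_pow (m : R) : mfun (fun x : bor R d => jbr x `^ m).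
Proof.
rewrite (_ : (fun x => _) = (fun x => (1 + dotp x x) `^ (m / 2))); last first.
  by apply/funext => x; rewrite jbr_powE enorm_sq.
apply: (measurableT_comp (@measurable_powR R (m / 2))).
by apply: measurable_funD => //; exact: meas_dotp.
Qed.

Lemma geom_sum_le (r K : R) n : 0 <= r < 1 -> 0 <= K ->
  \sum_(0 <= j < n) K * r ^+ j <= K / (1 - r).
Proof.
move=> /andP[r0 r1] K0; rewrite ler_pdivlMr ?subr_gt0//.
suff -> : (\sum_(0 <= j < n) K * r ^+ j) * (1 - r) = K * (1 - r ^+ n).
  by rewrite ler_piMr// gerBl exprn_ge0.
elim: n => [|n IH]; first by rewrite big_geq// expr0 subrr mulr0 mul0r.
by rewrite big_nat_recr//= mulrDl IH exprSr; ring.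
Qed.

Section moment.
Variables (P : 'rV[R]_d -> R) (K m : R).
Hypotheses (pP : pdens P) (K0 : 0 <= K) (m01 : 0 < m < 1).
Hypothesis low : forall xi, enorm xi <= 1 -> 1 - fc P xi <= K * enorm xi.

(** The sum of the geometric series of ratio [2^m / 2], which is below 1 exactly because [m < 1]. *)
Definition Bmom : R := 32 ^+ 2 * K / (1 - 2 `^ m / 2).

Lemma mom_ratio : 0 <= 2 `^ m / 2 < 1.
Proof.
move: m01 => /andP[m0 m1]; apply/andP; split; first by rewrite divr_ge0 ?powR_ge0.
rewrite ltr_pdivrMr// mul1r -[ltRHS]powRr1// /powR gt_eqF// ltr_expR.
have l2 : 0 < ln 2 :> R by rewrite ln_gt0// ltr1n.
by rewrite ltr_pM2r.
Qed.

(** At scale [j] the growth [2^(j m)] meets [1 - fc P (e j) <= K 2^(-j)], whence a convergent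
    geometric series. *)
Lemma moment_coord (i : 'I_d) :
  (\int[mu]_x (`|x ord0 i| `^ m * P x)%:E <= (1 + Bmom)%:E)%E.
Proof.
have [Pi P0 P1] := pP; have mP := intg_meas Pi; have /andP[m0 m1] := m01.
pose e j : 'rV[R]_d := (2 ^+ j)^-1 *: delta_mx ord0 i.
have de j x : dotp x (e j) = (2 ^+ j)^-1 * x ord0 i.
  rewrite dotpZr; congr (_ * _); rewrite /dotp (bigD1 i)//= mxE !eqxx mulr1 big1 ?addr0// => l li.
  by rewrite mxE (negbTE li) andbF mulr0.
have ne j : enorm (e j) = (2 ^+ j)^-1.
  rewrite enormZ ?invr_ge0 ?exprn_ge0// (_ : enorm _ = 1) ?mulr1//.
  rewrite /enorm /dotp (bigD1 i)//= mxE !eqxx mulr1 big1 ?addr0 ?sqrtr1// => l li.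
  by rewrite mxE (negbTE li) andbF mulr0.
have cc v : 0 <= 1 - cos v :> R by rewrite subr_ge0 cos_le1.
pose t j (x : bor R d) : R := 32 ^+ 2 * (2 `^ m) ^+ j * (1 - cos (dotp x (e j))) * P x.
have c0 j : 0 <= 32 ^+ 2 * (2 `^ m) ^+ j by rewrite mulr_ge0 ?sqr_ge0// exprn_ge0// powR_ge0.
have t0 j x : 0 <= t j x by rewrite mulr_ge0// mulr_ge0.
have tE j x : t j x = 32 ^+ 2 * (2 `^ m) ^+ j * (P x - cos (dotp x (e j)) * P x) by rewrite /t; ring.
have ti j : intg mu (t j).
  by apply: (intg_eq _ (intgZ (32 ^+ 2 * (2 `^ m) ^+ j) (intgB Pi (intg_cos (e j) Pi)))) => x; rewrite tE.
have tI j : \int[mu]_x t j x <= 32 ^+ 2 * K * (2 `^ m / 2) ^+ j.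
  have -> : \int[mu]_x t j x = 32 ^+ 2 * (2 `^ m) ^+ j * \int[mu]_x (P x - cos (dotp x (e j)) * P x).
    by rewrite -RintZ; [by apply: Rint_eq => x; rewrite tE|exact: intgB (intg_cos _ _)].
  rewrite RintB//; last exact: intg_cos.
  rewrite P1 -/(fc P (e j)).
  have := @low (e j); rewrite ne => h.
  have {}h : 1 - fc P (e j) <= K * (2 ^+ j)^-1 by apply: h; rewrite invf_le1 ?exprn_ege1 ?exprn_gt0// ler1n.
  apply: le_trans (ler_wpM2l (c0 j) h) _; rewrite expr_div_n.
  by rewrite le_eqVlt; apply/orP; left; apply/eqP; ring.
have mt j : mfun (fun x : bor R d => (t j x)%:E).
  by apply/measurable_EFinP; exact: intg_meas (ti j).
apply: (@le_trans _ _ (\int[mu]_x ((P x)%:E + \sum_(0 <= j <oo) (t j x)%:E))%E).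
  apply: ge0_le_integral => //.
  - by move=> x _; rewrite lee_fin mulr_ge0 ?powR_ge0.
  - apply/measurable_EFinP; apply: measurable_funM => //.
    apply: (measurableT_comp (@measurable_powR R m)).
    by apply: measurableT_comp => //; exact: meas_coord.
  - apply: emeasurable_funD; first exact/measurable_EFinP.
    by apply: ge0_emeasurable_sum => // *; rewrite lee_fin.
  (* The good scale depends on [x]; the whole series of nonnegative terms dominates its
     contribution. *)
  - move=> x _; have [j hj] := powR_dyadic (x ord0 i) m0.
    have h1 : ((t j x)%:E <= \sum_(0 <= j <oo) (t j x)%:E)%E.
      apply: le_trans (nneseries_lim_ge j.+1 _); last by move=> *; rewrite lee_fin.
      by rewrite big_nat_recr//= leeDr// sume_ge0// => *; rewrite lee_fin.
    apply: le_trans (leeD2l _ h1); rewrite -EFinD lee_fin.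
    apply: le_trans (ler_wpM2r (P0 x) hj) _; rewrite /t de.
    by rewrite le_eqVlt; apply/orP; left; apply/eqP; ring.
rewrite ge0_integralD//; last 4 first.
- by move=> x _; rewrite lee_fin.
- exact/measurable_EFinP.
- by move=> x _; rewrite nneseries_ge0// => *; rewrite lee_fin.
- by apply: ge0_emeasurable_sum => // *; rewrite lee_fin.
rewrite -Rint_fin// P1 EFinD; apply: leeD2l.
rewrite integral_nneseries//; last by move=> *; rewrite lee_fin.
apply: lime_le; first by apply: is_cvg_nneseries => n _ _; apply: integral_ge0 => x _; rewrite lee_fin.
apply: nearW => n.
under eq_bigr do rewrite -Rint_fin//.
rewrite sumEFin lee_fin; apply: le_trans (geom_sum_le n mom_ratio _).
  by apply: ler_sum => j _; exact: tI.
by rewrite mulr_ge0// sqr_ge0.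
Qed.

Theorem moment_bound : intg mu (fun x => jbr x `^ m * P x) /\
  \int[mu]_x (jbr x `^ m * P x) <= 1 + d%:R * (1 + Bmom).
Proof.
have [Pi P0 P1] := pP; have mP := intg_meas Pi; have /andP[m0 m1] := m01.
have mf : mfun (fun x : bor R d => jbr x `^ m * P x).
  by apply: measurable_funM => //; exact: meas_jbr_pow.
have f0 x : 0 <= jbr x `^ m * P x by rewrite mulr_ge0 ?powR_ge0.
have mc i : mfun (fun x : bor R d => (`|x ord0 i| `^ m * P x)%:E).
  apply/measurable_EFinP; apply: measurable_funM => //.
  apply: (measurableT_comp (@measurable_powR R m)).
  by apply: measurableT_comp => //; exact: meas_coord.
have B : (\int[mu]_x (jbr x `^ m * P x)%:E <= (1 + d%:R * (1 + Bmom))%:E)%E.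
  apply: (@le_trans _ _ (\int[mu]_x ((P x)%:E + \sum_(i < d) (`|x ord0 i| `^ m * P x)%:E))%E).
    apply: ge0_le_integral => //.
    - by move=> x _; rewrite lee_fin.
    - exact/measurable_EFinP.
    - by apply: emeasurable_funD; [exact/measurable_EFinP|exact: emeasurable_sum].
    - move=> x _; rewrite sumEFin -EFinD lee_fin -mulr_suml -[X in X + _]mul1r -mulrDl.
      by apply: ler_wpM2r => //; apply: jbr_pow_le; rewrite m0 ltW.
  rewrite ge0_integralD//; last 4 first.
  - by move=> x _; rewrite lee_fin.
  - exact/measurable_EFinP.
  - by move=> x _; rewrite sume_ge0// => i _; rewrite lee_fin mulr_ge0 ?powR_ge0.
  - exact: emeasurable_sum.
  rewrite -Rint_fin// P1 EFinD; apply: leeD2l.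
  rewrite ge0_integral_sum//; last by move=> i x _; rewrite lee_fin mulr_ge0 ?powR_ge0.
  apply: le_trans (lee_sum _ (fun i _ => moment_coord i)) _.
  by rewrite sumEFin lee_fin sumr_const card_ord mulr_natl.
have fi : intg mu (fun x => jbr x `^ m * P x).
  by apply/intg_ge0P => //; apply: le_lt_trans B _; exact: ltry.
by split=> //; rewrite -lee_fin Rint_fin.
Qed.

End moment.
End Moments.

(** * Interpolation between decay of the transform and a moment *)

Section Interpolation.
Variable R : realType.
Variable d : nat.
Implicit Types (f g h J T P : 'rV[R]_d -> R) (x y z xi : 'rV[R]_d).
Local Notation mu := (@leb R d).

Lemma cont_jbr_pow (q : R) : continuous (fun x : 'rV[R]_d => jbr x `^ q).
Proof.
move=> x; rewrite (_ : (fun x => _) = (fun x => (1 + dotp x x) `^ (q / 2))); last first.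
  by apply/funext => y; rewrite jbr_powE enorm_sq.
have p : 0 < 1 + dotp x x by rewrite ltr_pwDl// dotp_ge0.
apply: (@continuous_comp _ _ _ (fun x : 'rV[R]_d => 1 + dotp x x) (fun t : R => t `^ (q / 2))).
  by apply: contD; [exact: contC|exact: cont_sq].
exact: der_cont (der_powR (q / 2) p).
Qed.

Lemma coord_lt_jbr x i : `|x ord0 i| < jbr x.
Proof.
rewrite -sqrtr_sqr /jbr ltr_sqrt; last by rewrite ltr_pwDl// sqr_ge0.
rewrite enorm_sq /dotp (bigD1 i)//= -expr2.
have : 0 <= \sum_(j < d | j != i) x ord0 j * x ord0 j.
  by apply: sumr_ge0 => j _; rewrite -expr2 sqr_ge0.
lra.
Qed.

Lemma jbr_gt0 x : 0 < jbr x.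
Proof. exact: lt_le_trans ltr01 (jbr_ge1 x). Qed.

Lemma intg_box (r : R) : 0 <= r -> intg mu (\1_(@box R d r) : bor R d -> R) /\
  \int[mu]_x (\1_(@box R d r) x) = (2 * r) ^+ d.
Proof.
move=> r0; have mb := @measurable_box R d r.
have E : (\int[mu]_x (\1_(@box R d r) x)%:E = ((2 * r) ^+ d)%:E)%E.
  by rewrite integral_indic// setIT; exact: leb_box.
split; last by rewrite /Rintegral E.
by apply/intg_ge0P => //; rewrite E ltry.
Qed.

Section interp.
Variables (k m rho : R).
Hypotheses (k0 : 0 <= k) (km : k < m) (rho0 : 0 < rho).

(* Dominates [jbr ^ k] up to a multiple of [jbr ^ m] and vanishes where [jbr x >= rho]. *)
Definition iw x : R := ppart (jbr x `^ k - rho `^ (k - m) * jbr x `^ m).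

Lemma cont_iw : continuous iw.
Proof.
rewrite /iw (_ : (fun x => _) = (fun x => (fun t => ppart (1 - t))
    (1 + -1 * jbr x `^ k + rho `^ (k - m) * jbr x `^ m))); last first.
  by apply/funext => x /=; congr ppart; ring.
apply: (@cont_comp1 _ _ (fun t => ppart (1 - t))); first exact: cont_ppart1.
apply: contD; last by apply: contM; [exact: contC|exact: cont_jbr_pow].
by apply: contD; [exact: contC|apply: contM; [exact: contC|exact: cont_jbr_pow]].
Qed.

Lemma iw_ge0 x : 0 <= iw x.
Proof. by rewrite /iw /ppart le_max lexx orbT. Qed.

Lemma iw_ge x : jbr x `^ k <= iw x + rho `^ (k - m) * jbr x `^ m.
Proof.
have : jbr x `^ k - rho `^ (k - m) * jbr x `^ m <= iw x by rewrite /iw /ppart le_max lexx.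
lra.
Qed.

Lemma iw_supp x : iw x <= rho `^ k * \1_(@box R d rho) x.
Proof.
have j0 := jbr_gt0 x.
have [jr|rj] := ltP (jbr x) rho.
  rewrite indicE mem_set; last by move=> i; exact/ltW/(lt_trans (coord_lt_jbr x i)).
  rewrite mulr1 /iw /ppart ge_max powR_ge0 andbT.
  apply: (@le_trans _ _ (jbr x `^ k)); first by rewrite gerBl mulr_ge0 ?powR_ge0.
  by apply: ge0_ler_powR => //; rewrite ?nnegrE; exact: ltW.
apply: (@le_trans _ _ 0); last by rewrite mulr_ge0 ?powR_ge0.
rewrite /iw /ppart ge_max lexx andbT subr_le0.
have h : rho `^ (m - k) <= jbr x `^ (m - k).
  by apply: ge0_ler_powR => //; rewrite ?nnegrE ?subr_ge0; exact: ltW.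
have e : jbr x `^ m = jbr x `^ k * jbr x `^ (m - k).
  by rewrite -powRD ?(gt_eqF j0) ?implybT// addrC subrK.
rewrite e mulrCA ler_peMr ?powR_ge0//.
have e2 : rho `^ (k - m) = (rho `^ (m - k))^-1 by rewrite -powRN opprB.
by rewrite e2 mulrC ler_pdivlMr ?powR_gt0// mul1r.
Qed.

Lemma iw_le x : iw x <= rho `^ k.
Proof.
apply: le_trans (iw_supp x) _; by rewrite ler_piMr ?powR_ge0.
Qed.

(** The value of the pairing bound for [l = u / E] and the cube volume [(2 rho)^d], divided by
    [mass * rho^(k - m)]. *)
Definition Qint (A0 : R) : R := 1 / 2 * 2 ^+ d * (A0 * (\int[mu]_x pcau x) / mass R d + 1).

Lemma interp f (A0 Mm : R) : intg mu f -> 0 <= A0 ->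
  (forall xi, (fc f xi ^+ 2 + fs f xi ^+ 2) * (1 + enorm xi ^+ 2) ^+ d <=
     A0 * (rho `^ (- (m + d%:R / 2))) ^+ 2) ->
  intg mu (fun x => jbr x `^ m * `|f x|) ->
  \int[mu]_x (jbr x `^ m * `|f x|) <= Mm ->
  intg mu (fun x => jbr x `^ k * `|f x|) /\
  \int[mu]_x (jbr x `^ k * `|f x|) <= (Qint A0 + Mm) * rho `^ (k - m).
Proof.
move=> fi A00 fA mi mM.
set E := rho `^ (- (m + d%:R / 2)) in fA; have E0 : 0 < E by exact: powR_gt0.
pose u := rho `^ (k + d%:R / 2); have u0 : 0 < u by exact: powR_gt0.
have rn : rho != 0 by rewrite gt_eqF.
have Eu : E * u = rho `^ (k - m).
  by rewrite -powRD ?rn ?implybT//; congr powR; ring.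
have uu : (rho `^ k) ^+ 2 * rho ^+ d = u ^+ 2.
  rewrite -!powR_mulrn ?powR_ge0 ?(ltW rho0)// -!powRrM -powRD ?rn ?implybT//.
  by congr powR; field.
have [bi be] := intg_box (ltW rho0).
have wb x : `|iw x| <= rho `^ k by rewrite ger0_norm ?iw_ge0 ?iw_le.
have mw : mfun (iw : bor R d -> R) by apply: cont_bor; exact: cont_iw.
have wi : intg mu (fun x => `|f x| * iw x).
  have i := intg_mulb mw wb (intg_abs fi).
  by apply: (intg_eq _ i) => x; rewrite mulrC.
have mass0 := mass_gt0 R d.
have Main : \int[mu]_x (`|f x| * iw x) <= Qint A0 * rho `^ (k - m).
  apply: (abs_duality fi cont_iw (M := rho `^ k)) => [x|h ch h1].
    by rewrite iw_ge0 iw_le.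
  pose g x := h x * iw x.
  have cg : continuous g by apply: contM => //; exact: cont_iw.
  have gle x : `|g x| <= rho `^ k * \1_(@box R d rho) x.
    rewrite normrM (ger0_norm (iw_ge0 x)); apply: le_trans (iw_supp x).
    by rewrite ler_piMl ?iw_ge0.
  have gb x : `|g x| <= rho `^ k.
    rewrite normrM (ger0_norm (iw_ge0 x)); apply: le_trans (iw_le x).
    by rewrite ler_piMl ?iw_ge0.
  have gi : intg mu g.
    by apply: (intg_le (cont_bor cg) (intgZ (rho `^ k) bi)); exact: gle.
  have g2 : \int[mu]_x (g x ^+ 2) <= (rho `^ k) ^+ 2 * (2 * rho) ^+ d.
    rewrite -be -RintZ//; apply: Rint_le; last first.
    - move=> x; rewrite -real_normK ?num_real//.
      have -> : (rho `^ k) ^+ 2 * \1_(@box R d rho) x = (rho `^ k * \1_(@box R d rho) x) ^+ 2.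
        by rewrite exprMn indicE; case: (_ \in _); rewrite ?expr1n ?expr0n.
      by rewrite lerXn2r ?nnegrE ?(le_trans _ (gle x)).
    - exact: intgZ.
    - by apply: (intg_eq _ (intg_mulb (cont_bor cg) gb gi)) => x; rewrite expr2.
  (* Up to a dimensional factor, [u] is the L^2 norm of [rho^k] on the cube and [E] is the size of
     the transform of [f]; this [l] makes both terms of the pairing bound proportional to
     [E * u = rho^(k - m)]. *)
  have l0 : 0 < u / E by rewrite divr_gt0.
  have := pairing_bound fi gi cg gb l0 fA.
  set c2 := \int[mu]_x pcau x; set S := \int[mu]_x (g x ^+ 2) in g2 *.
  move=> K.
  have K2 : mass R d * `|\int[mu]_x (f x * g x)| <= mass R d * (Qint A0 * rho `^ (k - m)).
    apply: le_trans K _.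
    have -> : mass R d * (Qint A0 * rho `^ (k - m)) = 1 / 2 * (u / E * (2 ^+ d * (A0 * E ^+ 2) * c2) +
        (u / E)^-1 * (mass R d * ((rho `^ k) ^+ 2 * (2 * rho) ^+ d))).
      rewrite -Eu exprMn [_ * (2 ^+ d * _)]mulrCA uu /Qint -/c2; field.
      by rewrite !gt_eqF.
    apply: ler_wpM2l; first lra.
    rewrite lerD2l; apply: ler_wpM2l; first by rewrite invr_ge0 ltW.
    by apply: ler_wpM2l => //; exact: ltW.
  rewrite ler_pM2l// in K2.
  exact: le_trans (ler_norm _) K2.
have ki : intg mu (fun x => jbr x `^ k * `|f x|).
  apply: (intg_le _ (intgD wi (intgZ (rho `^ (k - m)) mi))).
    apply: measurable_funM; first exact: meas_jbr_pow.
    exact: intg_meas (intg_abs fi).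
  move=> x; rewrite ger0_norm ?mulr_ge0 ?powR_ge0// [`|f x| * _]mulrC mulrA -mulrDl.
  by apply: ler_wpM2r => //; exact: iw_ge.
split=> //.
apply: (@le_trans _ _ (\int[mu]_x (`|f x| * iw x + rho `^ (k - m) * (jbr x `^ m * `|f x|)))).
  apply: Rint_le => //; first by apply: intgD => //; exact: intgZ.
  move=> x; rewrite [`|f x| * _]mulrC mulrA -mulrDl.
  by apply: ler_wpM2r => //; exact: iw_ge.
rewrite RintD//; last exact: intgZ.
rewrite RintZ// mulrDl; apply: lerD => //.
by rewrite mulrC ler_wpM2r ?powR_ge0.
Qed.

End interp.
End Interpolation.

(** * Extraction of the hypotheses and assembly of the estimate *)

Lemma H1_reg (R : realType) (d : nat) (J : R -> 'rV[R]_d -> R) (delta : R) : H1 J delta ->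
  0 < delta /\ exists2 C0 : R, 0 < C0 & forall s, 1/2 < s < 1 -> pdens (J s) /\
    symbol_reg (J s) s delta C0.
Proof.
move=> [HJ [d0 [[C0 [C00 reg]] _]]]; split=> //; exists C0 => // s s12.
have pJ : pdens (J s) by apply/prob_densityP; case: (HJ s s12).
have [Ji _ _] := pJ; split=> // xi x1.
have := reg s s12 xi x1; rewrite fourier_reE// fourier_imE// => /sqrt_sum_ge.
by rewrite normrN.
Qed.

(** From [1 - e^(-y) <= y] and [2 s >= 1]. The form matches the bound for the equilibrium, so both
    densities share one moment constant. *)
Lemma stable_low (R : realType) (d : nat) (s K : R) (xi : 'rV[R]_d) : 1/2 < s < 1 -> 1 <= K ->
  enorm xi <= 1 -> 1 - expR (- (enorm xi `^ (2 * s)) / (2 * s)) <= K * enorm xi.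
Proof.
move=> /andP[s1 s2] K1 x1; have x0 := enorm_ge0 xi.
have h1 := expR_ge1Dx (- (enorm xi `^ (2 * s)) / (2 * s)).
have h2 : enorm xi `^ (2 * s) <= enorm xi.
  have [->|xn] := eqVneq (enorm xi) 0; first by rewrite powR0// mulf_neq0//; lra.
  by apply: ge1r_powR; [rewrite lt_neqAle eq_sym xn x0|lra].
have h3 : enorm xi `^ (2 * s) / (2 * s) <= enorm xi `^ (2 * s).
  by rewrite ler_pdivrMr; [rewrite ler_peMr ?powR_ge0//; lra|lra].
have h4 : enorm xi <= K * enorm xi by rewrite ler_peMl.
rewrite mulNr in h1 *; lra.
Qed.

Lemma L1k_norm_ae (R : realType) (d : nat) (k : R) (f g : 'rV[R]_d -> R) :
  mfun (f : bor R d -> R) -> mfun (g : bor R d -> R) ->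
  {ae leb R d, forall x, f x = g x} -> intg (leb R d) (fun x => jbr x `^ k * `|g x|) ->
  L1k_norm k f = (\int[leb R d]_x (jbr x `^ k * `|g x|))%:E.
Proof.
move=> mf mg fg gi.
have M h : mfun (h : bor R d -> R) ->
    mfun (fun x : bor R d => jbr x `^ k * `|h x|).
  by move=> mh; apply: measurable_funM; [exact: meas_jbr_pow|exact: measurableT_comp].
rewrite /L1k_norm iint_EFin; last by move=> x; rewrite mulr_ge0 ?powR_ge0.
  rewrite Rint_fin//; apply: ae_eq_integral => //; try by apply/measurable_EFinP; exact: M.
  have aeF := ae_filter_ringOfSetsType (leb R d).
  by apply: filterS fg => x + _ /= => ->.
by apply/borel_funP; exact: M.
Qed.

Lemma small_radius (R : realType) (C0 delta : R) : 0 < C0 -> 0 < delta ->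
  exists2 r0 : R, 0 < r0 <= 1 & C0 * r0 `^ delta <= 1 / 2.
Proof.
move=> C00 d0; pose a := Num.min 1 (1 / (2 * C0)).
have a0 : 0 < a by rewrite lt_min ltr01 divr_gt0// mulr_gt0.
have a1 : a <= 1 by rewrite ge_min lexx.
have a2 : a <= 1 / (2 * C0) by rewrite ge_min lexx orbT.
exists (a `^ delta^-1).
  rewrite powR_gt0//= -[leRHS](powRr0 a); apply: ger_powR; first by rewrite a0.
  by rewrite invr_ge0 ltW.
rewrite -powRrM mulVf ?gt_eqF// powRr1; last exact: ltW.
by rewrite -ler_pdivlMl//; apply: le_trans a2 _; rewrite le_eqVlt; apply/orP; left; apply/eqP; field; rewrite gt_eqF.
Qed.

Theorem theorem4p6 (R : realType) (d : nat) (J : R -> 'rV[R]_d -> R) (delta : R) :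
  (0 < d)%N -> H1 J delta ->
  forall k m : R, 0 <= k -> k < m -> m < 1 ->
  let theta := (m - k) / (m + d%:R / 2) in
  exists C : R, forall s eps : R, 1/2 < s < 1 -> 0 < eps <= 1 ->
    forall F G : 'rV[R]_d -> R,
      equilibrium (J s) s eps F -> frac_equilibrium s G ->
      (L1k_norm k (fun x => (F x - G x)%R) <= (C * eps `^ (theta * delta))%:E)%E.
Proof.
move=> _ /H1_reg[delta0 [C0 C00 HJ]] k m k0 km m1 theta.
have m0 : 0 < m := le_lt_trans k0 km.
have m01 : 0 < m < 1 by rewrite m0.
have d2 : 0 <= d%:R / 2 :> R by rewrite divr_ge0.
have sg0 : 0 < m + d%:R / 2 by lra.
have th0 : 0 < theta by rewrite divr_gt0// subr_gt0.
have [r0 /andP[r00 r01] C0r0] := small_radius C00 delta0.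
pose M := Num.bound delta; have dM : delta <= M%:R by exact/ltW/archi_boundP/ltW.
pose K := 1 + 2 * C0; have K1 : 1 <= K by rewrite /K; lra.
have K0 : 0 <= K by lra.
pose A0 := Kfin C0 r0 d M.
have A00 : 0 <= A0.
  have [k1 k2 k3] := @K123_ge0 R r0 r00 d M.
  apply: addr_ge0; last by rewrite addr_ge0// mulr_ge0.
  by apply: mulr_ge0 => //; apply: mulr_ge0 => //; exact: sqr_ge0.
pose Mm := 2 * (1 + d%:R * (1 + Bmom K m)).
pose N : R := (8 * d + 1)%:R.
have N0 : 0 < N by rewrite ltr0n addn1.
pose e0 := (r0 / N) `^ (theta * delta).
have e00 : 0 < e0 by rewrite powR_gt0// divr_gt0.
have Q0 : 0 <= Qint d A0.
  apply: mulr_ge0; first by rewrite mulr_ge0 ?exprn_ge0.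
  rewrite addr_ge0// divr_ge0 ?(ltW (mass_gt0 _ _))// mulr_ge0//.
  by apply: Rint_ge0 => x; exact/ltW/pcau_gt0.
exists (Mm / e0 + (Qint d A0 + Mm)) => s eps s12 /andP[eps0 eps1] F G eqF eqG.
have [pJ reg] := HJ s s12.
have [Gp [pG aeG Gc Gs]] := stable_pdens pJ s12 delta0 C00 reg eqG.
have pFs := eq_pdens eqF; have [Fi F0 F1] := pFs; have [Gi G0 G1] := pG.
have GGi : intg (leb R d) G by case: eqG => /integP.
have [mFi mFb] := moment_bound pFs K0 m01 (fun xi => eq_small pJ s12 delta0 C00 eps0 eps1 reg eqF (xi := xi)).
have [mGi mGb] : intg (leb R d) (fun x => jbr x `^ m * Gp x) /\
    \int[leb R d]_x (jbr x `^ m * Gp x) <= 1 + d%:R * (1 + Bmom K m).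
  by apply: moment_bound => // xi x1; rewrite Gc; exact: stable_low.
pose f x := F x - Gp x.
have fi : intg (leb R d) f by exact: intgB.
have mf : mfun (f : bor R d -> R) by exact: intg_meas fi.
have mfm : mfun (fun x : bor R d => jbr x `^ m * `|f x|).
  by apply: measurable_funM; [exact: meas_jbr_pow|exact: measurableT_comp].
have fle x : jbr x `^ m * `|f x| <= jbr x `^ m * F x + jbr x `^ m * Gp x.
  rewrite -mulrDr; apply: ler_wpM2l; first exact: powR_ge0.
  by apply: le_trans (ler_normB _ _) _; rewrite !ger0_norm.
have fmi : intg (leb R d) (fun x => jbr x `^ m * `|f x|).
  apply: (intg_le mfm (intgD mFi mGi)) => x.
  by rewrite ger0_norm// mulr_ge0 ?powR_ge0.
have fmb : \int[leb R d]_x (jbr x `^ m * `|f x|) <= Mm.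
  apply: le_trans (Rint_le fmi (intgD mFi mGi) fle) _.
  by rewrite RintD// /Mm mulrDl mul1r; exact: lerD.
have Mm0 : 0 <= Mm.
  by apply: le_trans fmb; apply: Rint_ge0 => x; rewrite mulr_ge0 ?powR_ge0.
have P0 : 0 <= eps `^ (theta * delta) by exact: powR_ge0.
have aeF := ae_filter_ringOfSetsType (leb R d).
suff [ki kb] : intg (leb R d) (fun x => jbr x `^ k * `|f x|) /\
    \int[leb R d]_x (jbr x `^ k * `|f x|) <= (Mm / e0 + (Qint d A0 + Mm)) * eps `^ (theta * delta).
  have -> : L1k_norm k (fun x => F x - G x) = (\int[leb R d]_x (jbr x `^ k * `|f x|))%:E.
    apply: L1k_norm_ae => //; last by apply: filterS aeG => x; rewrite /f => ->.
    by apply: measurable_funB; [exact: intg_meas Fi|exact: intg_meas GGi].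
  by rewrite lee_fin.
(* For large [eps] the weight of order [k] is bounded by that of order [m], and the moment bound
   [Mm] is at most [Mm / e0] times the rate. *)
have [big|small] := ltP r0 (eps * N).
  have kle x : jbr x `^ k * `|f x| <= jbr x `^ m * `|f x|.
    by apply: ler_wpM2r => //; apply: ler_powR; [exact: jbr_ge1|exact: ltW].
  have ki : intg (leb R d) (fun x => jbr x `^ k * `|f x|).
    apply: (intg_le _ fmi) => [|x]; last by rewrite ger0_norm// mulr_ge0 ?powR_ge0.
    by apply: measurable_funM; [exact: meas_jbr_pow|exact: measurableT_comp].
  split=> //; apply: le_trans (Rint_le ki fmi kle) _; apply: le_trans fmb _.
  have h : e0 <= eps `^ (theta * delta).
    apply: ge0_ler_powR; rewrite ?nnegrE; [exact/ltW/mulr_gt0|exact/ltW/divr_gt0|exact: ltW|].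
    by rewrite ler_pdivrMr// ltW.
  rewrite mulrDl -[leLHS]addr0; apply: lerD; last by rewrite mulr_ge0// addr_ge0.
  by rewrite mulrAC ler_pdivlMr// ler_wpM2l.
pose rho := eps `^ (- delta / (m + d%:R / 2)).
have rho0 : 0 < rho by exact: powR_gt0.
have E1 : rho `^ (- (m + d%:R / 2)) = eps `^ delta.
  by rewrite -powRrM; congr powR; field; rewrite gt_eqF//; lra.
have E2 : rho `^ (k - m) = eps `^ (theta * delta).
  by rewrite -powRrM; congr powR; rewrite /theta; field; rewrite gt_eqF//; lra.
have [|ki kb] := interp k0 km rho0 fi A00 _ fmi fmb.
- move=> xi; rewrite E1.
  have -> : fc f xi = fc F xi - expR (- (enorm xi `^ (2 * s)) / (2 * s)).
    rewrite -Gc /fc -RintB; [|exact: intg_cos|exact: intg_cos].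
    by apply: Rint_eq => x; rewrite /f; ring.
  have -> : fs f xi = fs F xi.
    rewrite -[RHS]subr0 -(Gs xi) /fs -RintB; [|exact: intg_sin|exact: intg_sin].
    by apply: Rint_eq => x; rewrite /f; ring.
  exact: (eq_decay pJ s12 delta0 C00 eps0 eps1 reg eqF xi r00 r01 C0r0 dM small).
- split=> //; apply: le_trans kb _; rewrite E2; apply: ler_wpM2r => //.
  by rewrite lerDr divr_ge0// ltW.
Qed.
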